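(* Let $T>0$ and let $b:[0,T]\times\mathbb{R}^n\to\mathbb{R}^n$ be a (Borel) vector field. Assume that there is a constant $C$ such that $$|b(t,x)|\le C(1+|x|)$$ and $$|b(t,x)-b(t,y)|\le C\,|x-y|\,\log\!\big(e+1/|x-y|\big)$$ for all $x,y\in\mathbb{R}^n$ (with $x\neq y$ in the second inequality) and almost every $t\in[0,T]$. If $\rho_0\in L^1(\mathbb{R}^n)$, then the Cauchy problem $$\begin{cases}\partial_t\rho+\operatorname{div}(b\,\rho)=0 & \text{in }(0,T)\times\mathbb{R}^n,\\ \rho(0,\cdot)=\rho_0 & \text{in }\mathbb{R}^n\end{cases}$$ has at most one weak solution $\rho\in L^1(0,T;L^1(\mathbb{R}^n))$.
   Context: A function $\rho\in L^1(0,T;L^1(\mathbb{R}^n))$ is a weak solution of the Cauchy problem if $$\int_0^T\int_{\mathbb{R}^n}\big[\partial_t\varphi(t,x)+\langle b(t,x),\nabla\varphi(t,x)\rangle\big]\rho(t,x)\,dx\,dt+\int_{\mathbb{R}^n}\varphi(0,x)\rho_0(x)\,dx=0$$ for all $\varphi\in C_c^\infty([0,T)\times\mathbb{R}^n)$. *)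

(* Defs.v *)
From HB Require Import structures.
From mathcomp Require Import all_boot all_order all_algebra.
From mathcomp Require Import all_classical all_reals all_analysis.

Set Implicit Arguments.
Unset Strict Implicit.
Unset Printing Implicit Defensive.

Import Order.TTheory GRing.Theory Num.Theory.
Import numFieldNormedType.Exports.

Local Open Scope classical_set_scope.
Local Open Scope ring_scope.

Definition borel_rV_display : measure_display.
Proof. by []. Qed.

Section borel_rV.
Context {R : realType} (n : nat).

Let borel0 : <<s @open 'rV[R]_n >> set0.
Proof. exact: sigma_algebra0. Qed.

Let borelC A : <<s @open 'rV[R]_n >> A -> <<s @open 'rV[R]_n >> (~` A).
Proof. exact: sigma_algebraC. Qed.

Let borel_bigcup (F : (set 'rV[R]_n)^nat) :
  (forall i, <<s @open 'rV[R]_n >> (F i)) ->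
  <<s @open 'rV[R]_n >> (\bigcup_i (F i)).
Proof. exact: sigma_algebra_bigcup. Qed.

HB.instance Definition _ := @isMeasurable.Build borel_rV_display
  'rV[R]_n <<s @open 'rV[R]_n >> borel0 borelC borel_bigcup.

End borel_rV.

Lemma measurable_coord_rV {R : realType} (n : nat) (i : 'I_n) :
  measurable_fun setT (fun x : 'rV[R]_n => x 0 i : measurableTypeR R).
Proof.
apply: (measurability _ (measurable_realfun.RGenOpens.measurableE R)).
move=> _ [_ [a [b ->]] <-].
rewrite setTI; apply: sub_sigma_algebra; apply: open_comp => // x _.
exact: coord_continuous.
Qed.

Section cons_rV.
Context {R : realType} (n : nat).

Definition cons_rV (p : measurableTypeR R * 'rV[R]_n) : 'rV[R]_n.+1 :=
  \row_i oapp (p.2 0) p.1 (unlift ord0 i).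

Lemma cons_rV0 p : cons_rV p 0 0 = p.1.
Proof. by rewrite mxE unlift_none. Qed.

Lemma cons_rVS p j : cons_rV p 0 (lift ord0 j) = p.2 0 j.
Proof. by rewrite mxE liftK. Qed.

Let cons_rV_ball (c : 'rV[R]_n.+1) (r : R) : 0 < r ->
  cons_rV @^-1` ball c r =
  ball (c 0 0) r `*` ball (\row_j c 0 (lift ord0 j) : 'rV[R]_n) r.
Proof.
move=> r0; apply/seteqP; split => [p|p]/=.
- move=> [_ pr]; split=> /=.
    by have := pr 0 0; rewrite cons_rV0.
  split => // i j; rewrite !ord1 mxE.
  by have := pr 0 (lift ord0 j); rewrite cons_rVS.
- move=> [/= p1 [_ p2]]; split => // i j; rewrite !ord1.
  case: (unliftP ord0 j) => [k ->|->].
    by rewrite cons_rVS; have := p2 0 k; rewrite mxE.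
  by rewrite cons_rV0.
Qed.

Lemma measurable_cons_rV : measurable_fun setT cons_rV.
Proof.
apply: (@measurability _ _ _ _ _ _ (@open 'rV[R]_n.+1)) => //.
move=> _ [U oU <-]; rewrite setTI.
pose B (z : 'rV[rat]_n.+1 * nat) :=
  ball (map_mx ratr z.1 : 'rV[R]_n.+1) z.2.+1%:R^-1.
have -> : U = \bigcup_z (if `[< B z `<=` U >] then B z else set0).
  apply/seteqP; split => [x Ux|x [z _]]; last by case: asboolP => // + xz; apply.
  have /nbhs_ballP[e /= e0 xeU] : nbhs x U by exact: open_nbhs_nbhs.
  have [k ke] : exists k, k.+1%:R^-1 < e / 2.
    have [|k] := @ltr_add_invr R 0 (e / 2); first exact: divr_gt0.
    by rewrite add0r; exists k.
  have k0 : 0 < k.+1%:R^-1 :> R by rewrite invr_gt0.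
  have /choice[q qx] : forall i, exists q : rat, ball (x 0 i) k.+1%:R^-1 (ratr q).
    move=> i; have [||y [xy [q _ qy]]] := @dense_rat R (ball (x 0 i) k.+1%:R^-1).
    - by exists (x 0 i); exact: ballxx.
    - exact: ball_open.
    by exists q; rewrite qy.
  have xB : B (\row_i q i, k) x.
    by split => // i j; rewrite !ord1 !mxE; exact/ball_sym/qx.
  exists (\row_i q i, k) => //; case: asboolP => // -[].
  move=> y yB; apply: xeU.
  apply: (@ball_split _ _ (map_mx ratr (\row_i q i) : 'rV[R]_n.+1)).
    by apply: (le_ball (ltW ke)); exact: ball_sym.
  exact: (le_ball (ltW ke)).
rewrite preimage_bigcup.
apply: countable_bigcupT_measurable => // -[c k].
case: asboolP => _; last by rewrite preimage_set0.
rewrite /B cons_rV_ball ?invr_gt0//; apply: measurableX.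
  by rewrite ball_itv; exact: measurable_itv.
by apply: sub_sigma_algebra; exact: ball_open.
Qed.

End cons_rV.

Section lebesgue_measure_rVS.
Local Open Scope ereal_scope.
Context {R : realType} (n : nat).
Variable mu : {sigma_finite_measure set 'rV[R]_n -> \bar R}.

Definition lebesgue_measure_rVS : set 'rV[R]_n.+1 -> \bar R :=
  pushforward (lebesgue_measure \x mu) (@cons_rV R n).

Let measurable_cons_preimage A :
  measurable A -> measurable (@cons_rV R n @^-1` A).
Proof.
by move=> mA; rewrite -[X in measurable X]setTI; exact: measurable_cons_rV.
Qed.

Let lebesgue_rVS0 : lebesgue_measure_rVS set0 = 0.
Proof. by rewrite /lebesgue_measure_rVS /pushforward preimage_set0 measure0. Qed.

Let lebesgue_rVS_ge0 A : 0 <= lebesgue_measure_rVS A.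
Proof. by rewrite /lebesgue_measure_rVS /pushforward; exact: measure_ge0. Qed.

Let lebesgue_rVS_sigma_additive : semi_sigma_additive lebesgue_measure_rVS.
Proof.
move=> F mF tF mUF; rewrite /lebesgue_measure_rVS /pushforward preimage_bigcup.
apply: measure_semi_sigma_additive.
- by move=> i; exact: measurable_cons_preimage.
- apply/trivIsetP => /= i j _ _ ij; rewrite -preimage_setI.
  by move/trivIsetP : tF => /(_ _ _ _ _ ij) ->//; rewrite preimage_set0.
- by rewrite -preimage_bigcup; exact: measurable_cons_preimage.
Qed.

HB.instance Definition _ := isMeasure.Build _ _ _ lebesgue_measure_rVS
  lebesgue_rVS0 lebesgue_rVS_ge0 lebesgue_rVS_sigma_additive.

Let measurable_uncons :
  measurable_fun setT
    (fun x : 'rV[R]_n.+1 => (x 0%R 0%R : measurableTypeR R,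
                             \row_j x 0%R (lift ord0 j) : 'rV[R]_n)%R).
Proof.
apply: measurable_fun_pair; first exact: measurable_coord_rV.
apply: (@measurability _ _ _ _ _ _ (@open 'rV[R]_n)) => // _ [U oU <-].
rewrite setTI; apply: sub_sigma_algebra; apply: open_comp => // x _.
move=> A /= /nbhs_ballP[e /= e0 eA]; apply/nbhs_ballP; exists e => //=.
by move=> y [_ xy]; apply: eA; split=> // i j; rewrite !mxE.
Qed.

Let lebesgue_rVS_sigma_finite : sigma_finite setT lebesgue_measure_rVS.
Proof.
(* [sigma_finiteT] is not found for a product measure: the instance for
   products of subprobabilities takes precedence. *)
have [F TF Ffin] : sigma_finite setT (@lebesgue_measure R \x mu).
  have /sigma_finiteP[F [TF ndF Foo]] := sigma_finiteT (@lebesgue_measure R).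
  have /sigma_finiteP[G [TG ndG Goo]] := sigma_finiteT mu.
  exists (fun k => F k `*` G k).
    rewrite -setXTT TF TG; apply/seteqP; split => [[x y]|[x y] [k _ []/=]].
      move=> [/= [k _ Fkx] [l _ Gly]]; exists (maxn k l) => //; split.
      - by move: x Fkx; exact/subsetPset/ndF/leq_maxl.
      - by move: y Gly; exact/subsetPset/ndG/leq_maxr.
    by split; exists k.
  move=> k; have [? ?] := Foo k; have [? ?] := Goo k.
  split; first exact: measurableX.
  by rewrite product_measure1E// lte_mul_pinfty// ge0_fin_numE.
pose g (x : 'rV[R]_n.+1) := (x 0 0 : measurableTypeR R,
                             \row_j x 0 (lift ord0 j) : 'rV[R]_n)%R.
have cK : cancel (@cons_rV R n) g.
  move=> [a c]; rewrite /g cons_rV0; congr pair.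
  by apply/rowP => j; rewrite mxE cons_rVS.
exists (fun k => g @^-1` F k).
  by rewrite -preimage_bigcup -TF preimage_setT.
move=> k; have [mF Fk] := Ffin k; split.
  by rewrite -[X in measurable X]setTI; exact: measurable_uncons.
rewrite /lebesgue_measure_rVS /pushforward -comp_preimage.
by rewrite (_ : _ \o _ = id) ?preimage_id//; apply/funext => z; exact: cK.
Qed.

HB.instance Definition _ := Measure_isSigmaFinite.Build _ _ _
  lebesgue_measure_rVS lebesgue_rVS_sigma_finite.

End lebesgue_measure_rVS.

Fixpoint lebesgue_measure_rV {R : realType} (n : nat) :
    {sigma_finite_measure set 'rV[R]_n -> \bar R} :=
  match n with
  | 0%N => @dirac _ 'rV[R]_0 0%R R
  | m.+1 => lebesgue_measure_rVS (lebesgue_measure_rV m)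
  end.

Lemma lebesgue_measure_rV_box (R : realType) (n : nat) (a b : 'rV[R]_n) :
  (forall i, a 0 i <= b 0 i) ->
  lebesgue_measure_rV n [set x | forall i, a 0 i < x 0 i <= b 0 i] =
  (\prod_i (b 0 i - a 0 i))%:E.
Proof.
elim: n a b => [|n IH] a b ab.
  rewrite big_ord0 /= diracE mem_set//.
  by move=> [].
rewrite big_ord_recl /=.
rewrite /lebesgue_measure_rVS /pushforward.
pose a' : 'rV[R]_n := \row_j a 0 (lift ord0 j).
pose b' : 'rV[R]_n := \row_j b 0 (lift ord0 j).
have -> : @cons_rV R n @^-1` [set x | forall i, a 0 i < x 0 i <= b 0 i] =
  [set` `]a 0 0, b 0 0]] `*` [set x : 'rV[R]_n | forall i, a' 0 i < x 0 i <= b' 0 i].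
  apply/seteqP; split => [p|p]/=.
    move=> H; split; first by have := H 0; rewrite cons_rV0 /= in_itv.
    by move=> j; have := H (lift ord0 j); rewrite cons_rVS !mxE.
  move=> [/= + H] i; rewrite in_itv /= => H0.
  case: (unliftP ord0 i) => [j ->|->]; last by rewrite cons_rV0.
  by rewrite cons_rVS; have := H j; rewrite !mxE.
rewrite product_measure1E//; last first.
  rewrite (_ : [set _ | _] = \bigcap_(i in [set: 'I_n])
     ((fun x : 'rV[R]_n => x 0 i) @^-1` `]a' 0 i, b' 0 i])); last first.
    apply/seteqP; split => x /= H i; first by move=> _ /=; rewrite in_itv/=.
    by have := H i I; rewrite /= in_itv.
  apply: fin_bigcap_measurable => // i _; rewrite -[X in measurable X]setTI.
  by apply: measurable_coord_rV => //; exact: measurable_itv.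
rewrite IH => [|i]; last by rewrite !mxE.
rewrite EFinM; congr (_ * _)%E.
  apply: etrans (lebesgue_measure_itv `]a 0 0, b 0 0]) _; rewrite /= lte_fin.
  case: ltP => [_|ba]; first by rewrite EFinB.
  by rewrite (@le_anti _ _ (a 0 0) (b 0 0)) ?subrr// ab ba.
by congr EFin; apply: eq_bigr => i _; rewrite !mxE.
Qed.

Section euclidean_calculus.
Context {R : realType} {n : nat}.
Implicit Types (x y : 'rV[R]_n) (f : 'rV[R]_n -> R).

Definition dot x y : R := \sum_i x 0 i * y 0 i.

(* Not [`|x|], which is the sup norm on ['rV[R]_n]. *)
Definition enorm x : R := Num.sqrt (dot x x).

Definition grad f x : 'rV[R]_n := \row_i 'D_(delta_mx 0 i) (f : _ -> R^o) x.

End euclidean_calculus.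

(* On a finite-dimensional domain, existence and continuity of all iterated
   directional derivatives up to order k is being of class C^k. *)
Fixpoint Ck {R : realType} {V W : normedModType R} (k : nat) (f : V -> W) :=
  match k with
  | 0%N => continuous f
  | k'.+1 => continuous f /\
      forall v, (forall x, derivable f x v) /\ Ck k' (fun x => 'D_v f x)
  end.

Definition smooth {R : realType} {V W : normedModType R} (f : V -> W) :=
  forall k, Ck k f.

Section continuity_equation.
Context {R : realType} {n : nat} (T : R).

(* C_c^oo([0,T) x R^n): smoothness on a set that is not open is that of an
   extension to an open neighbourhood, and the extension can be taken to be
   global; the support is compact in [0,T) x R^n, so that it may meet t = 0
   but stays away from t = T. *)
Definition test_function (phi : R -> 'rV[R]_n -> R) :=
  smooth (fun z : R^o * 'rV[R]_n => phi z.1 z.2 : R^o) /\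
  exists K : set (R * 'rV[R]_n),
    [/\ compact K, K `<=` [set` `[0, T[] `*` [set: 'rV[R]_n] &
        forall t x, t \in `[0, T[ -> ~ K (t, x) -> phi t x = 0].

(* Representatives of the elements of L^1(0,T; L^1(R^n)). *)
Definition L1L1 (rho : R -> 'rV[R]_n -> R) :=
  measurable_fun ([set` `]0, T[] `*` [set: 'rV[R]_n])
    (fun z : R * 'rV[R]_n => rho z.1 z.2) /\
  (\int[lebesgue_measure]_(t in [set` `]0%R, T[%R])
     \int[lebesgue_measure_rV n]_x `|rho t x|%:E < +oo)%E.

(* Equality in L^1(0,T; L^1(R^n)). *)
Definition L1L1_eq (rho1 rho2 : R -> 'rV[R]_n -> R) :=
  {ae lebesgue_measure, forall t, t \in `]0, T[ ->
    {ae lebesgue_measure_rV n, forall x, rho1 t x = rho2 t x}}.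

Definition weak_solution (b : R -> 'rV[R]_n -> 'rV[R]_n)
    (rho0 : 'rV[R]_n -> R) (rho : R -> 'rV[R]_n -> R) :=
  L1L1 rho /\
  forall phi : R -> 'rV[R]_n -> R, test_function phi ->
    \int[lebesgue_measure]_(t in [set` `]0, T[])
      \int[lebesgue_measure_rV n]_x
        ((derive1 (phi ^~ x) t + dot (b t x) (grad (phi t) x)) * rho t x)
    + \int[lebesgue_measure_rV n]_x (phi 0 x * rho0 x) = 0.

End continuity_equation.

(* Main.v *)
(* The argument is by duality. Let rho be the difference of two solutions and
   suppose that it vanishes before time a. For s - a small and psi a smooth
   compactly supported function of x, approximate solutions phi of the backward
   equation d_t phi + <b, grad phi> = psi 1_]a,s[ with phi = 0 for t >= s are
   inserted into the weak formulation, which gives that the integral of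
   psi 1_]a,s[ rho is zero up to an error; then rho vanishes before s.

   To build phi, replace b by a regularization b_eps at scale eps: the
   hypothesis gives |b - b_eps| <= C eps l and |D b_eps| <= L = C l with
   l = ln(e + 1/eps). Composing psi with N explicit Euler steps
   x |-> x + int_t^t1 b_eps yields |grad phi| <= C exp(L (s - a)), and, up to
   terms vanishing as N goes to infinity, an error
   |grad phi| |b - b_eps| <= C eps l exp(C l (s - a)). If C (s - a) <= 1/2, the
   exponential is at most (e + 1/eps)^(1/2), and the error vanishes with eps.

   Both the regularization of b and the smoothing of phi (in n + 1 variables)
   are quasi-interpolations u |-> \sum_k u(d k) chi(x / d - k), where the
   translates of chi reproduce affine functions; this takes the place of
   convolutions. *)
From HB Require Import structures.
Require Import Defs.
From mathcomp Require Import all_boot all_order all_algebra.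
From mathcomp Require Import ring lra.
From mathcomp Require Import all_classical all_reals all_analysis.
From mathcomp Require Import measurable_realfun.

Set Implicit Arguments.
Unset Strict Implicit.
Unset Printing Implicit Defensive.

Import Order.TTheory GRing.Theory Num.Theory.
Import numFieldNormedType.Exports.

Local Open Scope classical_set_scope.
Local Open Scope ring_scope.

(** * Functions of class C^k *)

Section Ck_theory.
Context {R : realType}.

(** As [rho] is only integrable, the dual error has to be small uniformly, not just on average; this
    is why the gradient of the dual function is bounded pointwise and weighed against the modulus of
    the field. The balance limits the length [s - a], but only through [n] and the constants of the
    field, so that finitely many steps of equal length reach any time below [T]. The linear growth
    of the field keeps the support of the dual function in a ball that depends neither on [eps] nor
    on [N]. In time the field is merely measurable. An Euler step therefore integrates it over time:
    its primitive is Lipschitz in time and differentiable at almost every time. Since the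
    regularized field is built from finitely many nodes, the exceptional times do not depend on the
    space variable. The resulting dual function is Lipschitz and differentiable away from a null set
    of times, which is why it is smoothed once more before it serves as a test function. The kernel
    [chi] is not known to be nonnegative; the constants [(5 * c) ^+ n] stand where a mollifier of
    mass one would give 1. *)

Lemma CkS {V W : normedModType R} k (f : V -> W) : Ck k.+1 f -> Ck k f.
Proof.
elim: k f => [|k IH] f; first by case.
move=> [cf df]; split => // v; split; first exact: (df v).1.
by apply: IH; exact: (df v).2.
Qed.

Lemma Ck_cts {V W : normedModType R} k (f : V -> W) : Ck k f -> continuous f.
Proof. by case: k => [|k] //= []. Qed.

Lemma Ck_cst {V W : normedModType R} k (c : W) : Ck k (fun _ : V => c).
Proof.
elim: k c => [|k IH] c; first by move=> x; exact: cvg_cst.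
split; first by move=> x; exact: cvg_cst.
move=> v; split; first by move=> x; exact: derivable_cst.
rewrite (_ : (fun x => _) = (fun _ : V => 0 : W)); first exact: IH.
by apply/funext => x; rewrite derive_cst.
Qed.

Lemma CkD {V W : normedModType R} k (f g : V -> W) :
  Ck k f -> Ck k g -> Ck k (fun x => f x + g x).
Proof.
elim: k f g => [|k IH] f g.
  by move=> cf cg x; exact: cvgD (cf x) (cg x).
move=> [cf df] [cg dg]; split; first by move=> x; exact: cvgD (cf x) (cg x).
move=> v; split; first by move=> x; apply: derivableD; [exact: (df v).1|exact: (dg v).1].
rewrite (_ : (fun x => _) = fun x => 'D_v f x + 'D_v g x).
  by apply: IH; [exact: (df v).2|exact: (dg v).2].
by apply/funext => x; rewrite -deriveD//; [exact: (df v).1|exact: (dg v).1].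
Qed.

Lemma CkM {V : normedModType R} k (f g : V -> R^o) :
  Ck k f -> Ck k g -> Ck k (fun x => f x * g x : R^o).
Proof.
elim: k f g => [|k IH] f g.
  by move=> cf cg x; exact: cvgM (cf x) (cg x).
move=> kf kg; have [cf df] := kf; have [cg dg] := kg.
split; first by move=> x; exact: cvgM (cf x) (cg x).
move=> v; split; first by move=> x; apply: derivableM; [exact: (df v).1|exact: (dg v).1].
rewrite (_ : (fun x => _) = fun x => f x * 'D_v g x + g x * 'D_v f x).
  by apply: CkD; apply: IH; [exact: CkS|exact: (dg v).2|exact: CkS|exact: (df v).2].
apply/funext => x; rewrite -[LHS]/('D_v (f * g) x) deriveM//.
- exact: (df v).1.
- exact: (dg v).1.
Qed.

Lemma CkV {V : normedModType R} k (f : V -> R^o) :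
  (forall x, f x != 0) -> Ck k f -> Ck k (fun x => (f x)^-1 : R^o).
Proof.
move=> f0; elim: k => [|k IH].
  by move=> cf x; exact: cvgV (f0 x) (cf x).
move=> kf; have [cf df] := kf.
split; first by move=> x; exact: cvgV (f0 x) (cf x).
move=> v; split; first by move=> x; apply: derivableV => //; exact: (df v).1.
have IH' := IH (CkS kf).
rewrite (_ : (fun x => _) = fun x => (-1) * ((f x)^-1 * (f x)^-1 * 'D_v f x)).
  apply: CkM; first exact: Ck_cst.
  by apply: CkM; [exact: CkM|exact: (df v).2].
apply/funext => x; rewrite (deriveV (f0 x)); last exact: (df v).1.
by rewrite /GRing.scale /= mulN1r mulNr expr2 invfM.
Qed.

Lemma Ck_sum {V W : normedModType R} (I : Type) (r : seq I) (P : pred I) k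
    (F : I -> V -> W) :
  (forall i, P i -> Ck k (F i)) -> Ck k (fun x => \sum_(i <- r | P i) F i x).
Proof.
move=> kF; elim: r => [|i r IH].
  rewrite (_ : (fun x => _) = fun _ => 0); first exact: Ck_cst.
  by apply/funext => x; rewrite big_nil.
rewrite (_ : (fun x => _) = if P i then fun x => F i x + \sum_(j <- r | P j) F j x
                            else fun x => \sum_(j <- r | P j) F j x).
  by case: ifP => // Pi; apply: CkD => //; exact: kF.
by apply/funext => x; rewrite big_cons; case: ifP.
Qed.

Lemma Ck_prod {V : normedModType R} (I : Type) (r : seq I) (P : pred I) k
    (F : I -> V -> R^o) :
  (forall i, P i -> Ck k (F i)) -> Ck k (fun x => \prod_(i <- r | P i) F i x : R^o).
Proof.
move=> kF; elim: r => [|i r IH].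
  rewrite (_ : (fun x => _) = fun _ => 1); first exact: Ck_cst.
  by apply/funext => x; rewrite big_nil.
rewrite (_ : (fun x => _) = if P i then fun x => F i x * \prod_(j <- r | P j) F j x
                            else fun x => \prod_(j <- r | P j) F j x).
  by case: ifP => // Pi; apply: CkM => //; exact: kF.
by apply/funext => x; rewrite big_cons; case: ifP.
Qed.

(** Both difference quotients are the same function of [h], so derivability transfers in both
    directions; [l0] is the linear part of [l]. *)
Lemma derive_comp_affine {V U W : normedModType R} (g : U -> W) (l l0 : V -> U) :
  (forall h x v, l (h *: v + x) = h *: l0 v + l x) ->
  forall v x, (derivable (g \o l) x v <-> derivable g (l x) (l0 v)) /\
    'D_v (g \o l) x = 'D_(l0 v) g (l x).
Proof.
move=> ll v x.
have E : (fun h : R^o => h^-1 *: (((g \o l) \o shift x) (h *: v) - (g \o l) x)) =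
   (fun h : R^o => h^-1 *: ((g \o shift (l x)) (h *: l0 v) - g (l x))).
  by apply/funext => h /=; rewrite ll.
by split; [rewrite /derivable E|rewrite /derive E].
Qed.

(** With an affine inner map a directional derivative is again a function composed with [l], and the
    induction closes with no products from a chain rule. *)
Lemma Ck_comp_affine {V U W : normedModType R} k (g : U -> W) (l l0 : V -> U) :
  continuous l ->
  (forall h x v, l (h *: v + x) = h *: l0 v + l x) ->
  Ck k g -> Ck k (g \o l).
Proof.
move=> cl ll; elim: k g => [|k IH] g.
  by move=> cg x; apply: continuous_comp; [exact: cl|exact: cg].
move=> [cg dg]; split.
  by move=> x; apply: continuous_comp; [exact: cl|exact: cg].
move=> v; split.
  by move=> x; apply/(derive_comp_affine g ll v x).1; exact: (dg (l0 v)).1.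
rewrite (_ : (fun x => _) = (fun y => 'D_(l0 v) g y) \o l).
  by apply: IH; exact: (dg (l0 v)).2.
by apply/funext => x /=; rewrite (derive_comp_affine g ll v x).2.
Qed.

Lemma derive1_dir (g : R^o -> R^o) (x v : R^o) :
  derivable g x 1 -> derivable g x v /\ 'D_v g x = v * 'D_1 g x.
Proof.
move=> dg; have [dfg ->] : differentiable g x /\ 'D_v g x = 'd g x v.
  by have/derivable1_diffP dfg := dg; split => //; rewrite deriveE.
split; first exact: diff_derivable.
rewrite deriveE// -[in LHS](mulr1 v) -[LHS]/('d g x (v *: 1)) linearZ.
by [].
Qed.

End Ck_theory.

(** * A smooth step function *)

Section smooth_step.
Context {R : realType}.

(** The family is closed under differentiation, [p] becoming [expo' p], so that an induction
    quantified over [p] gives smoothness. *)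
Let expo (p : {poly R}) (s : R) : R := if 0 < s then p.[s^-1] * expR (- s^-1) else 0.

(** The exponential series gives [u ^+ i <= i! * expR u] for each monomial. *)
Lemma poly_expR_bound (p : {poly R}) :
  exists2 c : R, 0 <= c & forall u, 0 < u -> `|p.[u] * expR (- u)| <= c.
Proof.
exists (\sum_(i < size p) `|p`_i| * i`!%:R).
  by apply: sumr_ge0 => i _; apply: mulr_ge0.
move=> u u0; rewrite expRN normrM normfV (ger0_norm (expR_ge0 _)).
rewrite ler_pdivrMr ?expR_gt0// horner_coef mulr_suml.
apply: le_trans (ler_norm_sum _ _ _) _; apply: ler_sum => i _.
rewrite normrM -mulrA ler_wpM2l// normrX (gtr0_norm u0).
case: (nat_of_ord i) => [|k].
  by rewrite expr0 fact0 mul1r ltW// expR_gt1.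
have := expR_ge1Dxn k (ltW u0); rewrite -ler_pdivrMl ?ltr0n ?fact_gt0// mulrC.
by apply: le_trans; rewrite lerDr.
Qed.

(** [expo p s] is [s ^+ 2] times [expo ('X^2 * p) s], and the last factor is bounded. A quadratic
    bound yields derivative 0 at the gluing point. *)
Let expo_small (p : {poly R}) :
  exists2 c : R, 0 <= c & forall s, `|expo p s| <= c * s ^+ 2.
Proof.
have [c c0 cp] := poly_expR_bound ('X^2 * p).
exists c => // s; rewrite /expo; case: ifPn => [s0|_]; last first.
  by rewrite normr0 mulr_ge0// sqr_ge0.
have := cp s^-1; rewrite invr_gt0 => /(_ s0).
rewrite hornerM hornerXn -mulrA normrM normrX normfV (gtr0_norm s0).
by rewrite exprVn ler_pdivrMl ?exprn_gt0// [leRHS]mulrC.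
Qed.

Let expo' (p : {poly R}) : {poly R} := 'X^2 * (p - p^`()).

Let expo_derive (p : {poly R}) (s : R) :
  is_derive s 1 (expo p : R -> R) (expo (expo' p) s).
Proof.
have [s0|s0|<-] := ltrgtP 0 s.
- pose g : R -> R := fun t => p.[t^-1] * expR (- t^-1).
  apply: (@near_eq_is_derive _ _ _ g).
    near=> t; rewrite /expo /g ifT//; near: t.
    exact: lt_nbhsr.
  have s0' : s != 0 by rewrite gt_eqF.
  have dV : is_derive s 1 (fun t : R => t^-1 : R) (- s ^- 2 : R).
    have := @is_deriveV R id s 1 1 s0' (is_derive_id _ _).
    by rewrite /GRing.scale /= mulr1.
  rewrite /expo s0 /expo' hornerM hornerXn hornerD hornerN.
  have d1 : is_derive s 1 (fun t : R => p.[t^-1] : R) (- s ^- 2 * p^`().[s^-1]).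
    have := @is_derive1_comp _ (horner p) (fun t : R => t^-1) s _ _ (is_derive_poly p s^-1) dV.
    by rewrite mulrC.
  have d2 : is_derive s 1 (fun t : R => expR (- t^-1) : R) (s ^- 2 * expR (- s^-1)).
    have dN : is_derive s 1 (fun t : R => - t^-1 : R) (s ^- 2 : R).
      by have := is_deriveN dV; rewrite opprK.
    have := @is_derive1_comp _ expR (fun t : R => - t^-1) s _ _ (is_derive_expR _) dN.
    by rewrite mulrC.
  have d12 := is_deriveM d1 d2; rewrite /GRing.scale /= in d12.
  rewrite (_ : _ * _ * _ = p.[s^-1] * (s ^- 2 * expR (- s^-1)) +
     expR (- s^-1) * (- s ^- 2 * p^`().[s^-1])); first exact: d12.
  by rewrite exprVn; ring.
- rewrite {2}/expo ltNge (ltW s0) /=.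
  apply: (@near_eq_is_derive _ _ _ (cst 0 : R -> R)).
    near=> t; rewrite /expo ifF//=; apply/negbTE; rewrite -leNgt ltW//; near: t.
    exact: lt_nbhsl.
- rewrite {2}/expo ltxx.
  have [c c0 cp] := expo_small p.
  suff lim0 : h^-1 *: (((expo p : R -> R) \o shift (0:R)) (h *: (1:R)) - expo p 0 : R) @[h --> 0^'] --> (0 : R).
    split; first by apply/cvg_ex; exists 0.
    exact/cvg_lim.
  apply/cvgr0Pnorm_le => _/posnumP[e].
  near=> h; rewrite /= addr0 {2}/expo ltxx subr0 /GRing.scale /= mulr1.
  rewrite normrM normfV.
  have h0 : h != 0 by near: h; exact: nbhs_dnbhs_neq.
  rewrite ler_pdivrMl ?normr_gt0//; apply: le_trans (cp _) _.
  rewrite -real_normK ?num_real// expr2 mulrA mulrC ler_wpM2l//.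
  rewrite (@le_trans _ _ ((c + 1) * `|h|))//; first by rewrite ler_wpM2r// lerDl.
  rewrite -ler_pdivlMl ?ltr_wpDl//.
  near: h; apply: dnbhs0_le; rewrite mulr_gt0// invr_gt0 ltr_wpDl//.
Unshelve. all: by end_near. Qed.

Let Ck_expo k (p : {poly R}) : Ck k (expo p : R^o -> R^o).
Proof.
elim: k p => [|k IH] p; first last.
  split; first exact: (Ck_cts (IH p)).
  move=> v; split.
    by move=> x; apply: (derive1_dir v _).1; have [] := expo_derive p x.
  rewrite (_ : (fun x => _) = fun x => v * expo (expo' p) x).
    by apply: CkM; [exact: Ck_cst|exact: IH].
  apply/funext => x; have [dx <-] := expo_derive p x.
  by rewrite (derive1_dir v dx).2.
move=> x; apply: differentiable_continuous; apply/derivable1_diffP.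
by have [] := expo_derive p x.
Qed.

(** With [f := expo 1], the quotient of [f s] by [f s + f (1 - s)]; the denominator is positive
    because [s] or [1 - s] is. *)
Lemma smooth_step_exists : exists H : R^o -> R^o, [/\ smooth H,
  forall s, s <= 0 -> H s = 0, forall s, 1 <= s -> H s = 1 &
  forall s, 0 <= H s <= 1].
Proof.
have f0 s : 0 <= expo 1 s.
  by rewrite /expo; case: ifP => // _; rewrite hornerE mul1r expR_ge0.
have fp s : 0 < s -> 0 < expo 1 s.
  by move=> s0; rewrite /expo s0 hornerE mul1r expR_gt0.
have fn s : s <= 0 -> expo 1 s = 0 by move=> s0; rewrite /expo ltNge s0.
have den s : 0 < expo 1 s + expo 1 (1 - s).
  have [s0|s0] := ltP 0 s; first by rewrite ltr_pwDl// fp.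
  by rewrite ltr_pwDr// fp// subr_gt0 (le_lt_trans s0).
exists (fun s => expo 1 s * (expo 1 s + expo 1 (1 - s))^-1); split.
- move=> k; apply: CkM; first exact: Ck_expo.
  apply: CkV; first by move=> s; rewrite gt_eqF.
  apply: CkD; first exact: Ck_expo.
  apply: (@Ck_comp_affine _ R^o R^o R^o k (expo 1) (fun s => 1 - s) (fun s => - s)).
  + by move=> s; apply: continuousB; [exact: cst_continuous|exact: cvg_id].
  + by move=> h x v; rewrite /GRing.scale /=; ring.
  + exact: Ck_expo.
- by move=> s s0; rewrite fn// mul0r.
- move=> s s1; rewrite (fn (1 - s)) ?subr_le0// addr0 divff// gt_eqF// fp//.
  by rewrite (lt_le_trans ltr01).
- move=> s; rewrite divr_ge0 ?(ltW (den s))//= ler_pdivrMr// mul1r.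
  by rewrite lerDl.
Qed.

End smooth_step.

(** * Quasi-interpolation *)

Section second_difference.
Context {R : realFieldType} (G : R -> R).
Let D u := G (u + 1) - G u.
Let c u := G (u + 1) - 2 * G u + G (u - 1).

Let cE u : c u = D u - D (u - 1).
Proof. by rewrite /c /D subrK; ring. Qed.

Lemma sum_second_difference N s :
  \sum_(m < N) c (s - m%:R) = D s - D (s - N%:R).
Proof.
elim: N => [|N IH]; first by rewrite big_ord0 subr0 subrr.
rewrite (_ : s - N.+1%:R = s - N%:R - 1); last by rewrite -addn1 natrD; ring.
by rewrite big_ord_recr /= IH cE; ring.
Qed.

(** Summation by parts: the factor [m] turns the telescoping sum of [D] into one of [G] itself. *)
Lemma sum_index_second_difference N s :
  \sum_(m < N) m%:R * c (s - m%:R) = G s - G (s - N%:R) - N%:R * D (s - N%:R).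
Proof.
elim: N => [|N IH]; first by rewrite big_ord0 !subr0 subrr mul0r subr0.
rewrite (_ : s - N.+1%:R = s - N%:R - 1); last by rewrite -addn1 natrD; ring.
by rewrite big_ord_recr /= IH cE /D subrK -(addn1 N) natrD; ring.
Qed.

End second_difference.

Lemma sum_local_le {R : realFieldType} (f : R -> R) (c : R) N (s : R) :
  (forall u, `|f u| <= c) -> (forall u, 2 < `|u| -> f u = 0) ->
  \sum_(m < N) `|f (s - m%:R)| <= 5 * c.
Proof.
move=> fc f0; have c0 : 0 <= c by exact: le_trans (normr_ge0 _) (fc 0).
(* The clamp of [u] to the interval from -2 to 3 grows by exactly 1 from [u] to [u + 1] whenever [u]
   lies between -2 and 2. Each nonzero term is thus paid for by an increment of [k], and the
   increments telescope to at most 5, the length of the interval. *)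
pose k (u : R) : R := Num.max (-2) (Num.min u 3).
have kle u v : u <= v -> k u <= k v.
  by move=> uv; rewrite /k; apply: le_max2 => //; apply: le_min2.
have step u : `|f u| <= c * (k (u + 1) - k u).
  have [u2|u2] := ltP 2 `|u|.
    by rewrite f0// normr0 mulr_ge0// subr_ge0 kle// lerDl.
  move: u2; rewrite ler_norml => /andP[u1 u2].
  rewrite (_ : k (u + 1) - k u = 1) ?mulr1//.
  rewrite /k !min_l; [|lra|lra].
  by rewrite !max_r; lra.
apply: (@le_trans _ _ (c * (k (s + 1) - k (s + 1 - N%:R)))).
  apply: (@le_trans _ _ (\sum_(m < N) c * (k (s - m%:R + 1) - k (s - m%:R)))).
    by apply: ler_sum.
  rewrite -mulr_sumr ler_wpM2l//; elim: N => [|N IH].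
    by rewrite big_ord0 subr0 subrr.
  rewrite big_ord_recr /=.
  rewrite (_ : s + 1 - N.+1%:R = s - N%:R); last by rewrite -addn1 natrD; ring.
  rewrite (_ : s - N%:R + 1 = s + 1 - N%:R); last by ring.
  by move: IH; lra.
rewrite mulrC ler_wpM2r// /k.
have k3 u : Num.max (-2) (Num.min u 3) <= 3 :> R.
  by rewrite ge_max ge_min lexx orbT andbT; lra.
have k2 u : -2 <= Num.max (-2) (Num.min u 3) :> R by rewrite le_max lexx.
by have := k3 (s + 1); have := k2 (s + 1 - N%:R); lra.
Qed.

Lemma compact_support_bounded {R : realType} (f : R -> R) :
  continuous f -> (forall u, 2 < `|u| -> f u = 0) ->
  exists c, forall u, `|f u| <= c.
Proof.
move=> cf f0.
have [||x _ xm] := @EVT_max R (fun u => `|f u|) (-2) 2.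
- by lra.
- apply: continuous_subspaceT => u.
  by apply: continuous_comp; [exact: cf|exact: norm_continuous].
exists `|f x| => u; have [u2|u2] := ltP 2 `|u|; first by rewrite f0// normr0.
by apply: xm; rewrite in_itv /= -ler_norml.
Qed.

(* The translates of [chi] by integers reproduce affine functions and those of
   [chi'] their slopes; the bounds on [s] ensure that no translate which is
   nonzero at [s] is missing from the sums. *)
Definition reproducing_kernel {R : realType} (chi chi' : R^o -> R^o) (c : R) :=
  [/\ smooth chi, forall s, is_derive (s : R^o) 1 chi (chi' s),
      (forall s, `|chi s| <= c) /\ (forall s, `|chi' s| <= c),
      (forall s, 2 < `|s| -> chi s = 0) /\ (forall s, 2 < `|s| -> chi' s = 0) &
   forall N s, 1 < s -> s + 1 < N%:R ->
     [/\ \sum_(m < N) chi (s - m%:R) = 1,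
         \sum_(m < N) m%:R * chi (s - m%:R) = s,
         \sum_(m < N) chi' (s - m%:R) = 0 &
         \sum_(m < N) m%:R * chi' (s - m%:R) = 1]].

(** [G u = u * H u] is a smooth substitute for the positive part of [u], and its second difference
    [chi] is a smooth hat function: it vanishes where [G] is affine on the three points involved,
    and its sums telescope. *)
Lemma reproducing_kernel_exists (R : realType) :
  exists (chi chi' : R^o -> R^o) (c : R), reproducing_kernel chi chi' c.
Proof.
have [H [sH H0 H1 _]] := @smooth_step_exists R.
pose G : R^o -> R^o := fun u => u * H u.
have kG k : Ck k G.
  apply: CkM => //.
  apply: (@Ck_comp_affine R R^o R^o R^o k id id id) => //.
    by move=> h x v.
  elim: k => [|k IH]; first by move=> x; exact: cvg_id.
  split; first by move=> x; exact: cvg_id.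
  move=> v; split; first by move=> x; exact: derivable_id.
  rewrite (_ : (fun x => _) = fun=> v); first exact: Ck_cst.
  by apply/funext => x; exact: derive_id.
pose G' : R^o -> R^o := 'D_1 G.
have [cG dG] := kG 1%N; have [dG1 cG'] := dG 1.
have GG' u : is_derive (u : R^o) 1 G (G' u) by apply: DeriveDef.
have G0 u : u <= 0 -> G u = 0 by move=> u0; rewrite /G H0// mulr0.
have G1 u : 1 <= u -> G u = u by move=> u1; rewrite /G H1// mulr1.
have G'0 u : u < 0 -> G' u = 0.
  move=> u0; rewrite /G' (@near_eq_derive _ _ _ _ (cst 0)) ?derive_cst//.
  by near=> t; rewrite G0// ltW//; near: t; exact: lt_nbhsl.
have G'1 u : 1 < u -> G' u = 1.
  move=> u1; rewrite /G' (@near_eq_derive _ _ _ _ id) ?derive_id//.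
  by near=> t; rewrite G1// ltW//; near: t; exact: lt_nbhsr.
pose chi : R^o -> R^o := fun u => G (u + 1) - 2 * G u + G (u - 1).
pose chi' : R^o -> R^o := fun u => G' (u + 1) - 2 * G' u + G' (u - 1).
have dsh (a u : R^o) : is_derive u 1 (fun t : R^o => G (t + a)) (G' (u + a)).
  have E := @derive_comp_affine R R^o R^o R^o G (fun t => t + a) id.
  have {}E h x v : (h *: v + x : R^o) + a = h * id v + (x + a) by rewrite addrA.
  have [d1 d2] := @derive_comp_affine R R^o R^o R^o G (fun t => t + a) id E 1 u.
  by apply: DeriveDef; [apply/d1|rewrite d2].
have dchi s : is_derive (s : R^o) 1 chi (chi' s).
  have h1 : is_derive (s : R^o) 1 (fun u : R^o => 2 * G u : R^o) (2 * G' s).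
    exact: (@is_deriveZ _ _ _ G 2 s 1 (G' s)).
  exact: is_deriveD (is_deriveB (dsh 1 s) h1) (dsh (-1) s).
have chi0 s : 2 < `|s| -> chi s = 0.
  rewrite ltr_normr => /orP[s2|s2]; rewrite /chi.
    by rewrite !G1; [ring|lra|lra|lra].
  by rewrite !G0; [ring|lra|lra|lra].
have chi'0 s : 2 < `|s| -> chi' s = 0.
  rewrite ltr_normr => /orP[s2|s2]; rewrite /chi'.
    by rewrite !G'1; [ring|lra|lra|lra].
  by rewrite !G'0; [ring|lra|lra|lra].
have Ckshift k a : Ck k (fun u : R^o => G (u + a)).
  apply: (@Ck_comp_affine R R^o R^o R^o k G (fun u => u + a) id) => //.
    by move=> s; apply: continuousD; [exact: cvg_id|exact: cst_continuous].
  by move=> h x v; rewrite addrA.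
have kchi k : Ck k chi.
  apply: CkD => //; apply: CkD => //.
  rewrite (_ : (fun u => _) = fun u => (-2) * G u); last first.
    by apply/funext => u; rewrite mulNr.
  by apply: CkM => //; exact: Ck_cst.
have ccchi' : continuous chi'.
  have [_ /(_ 1)[_]] := kchi 1%N.
  rewrite (_ : (fun x => _) = chi')//.
  by apply/funext => x; have [_ ->] := dchi x.
have [c1 hc1] := compact_support_bounded (Ck_cts (kchi 0%N)) chi0.
have [c2 hc2] := compact_support_bounded ccchi' chi'0.
exists chi, chi', (Num.max c1 c2); split => //.
- by split=> s; rewrite le_max ?hc1 ?hc2 ?orbT.
(* The range of [s] puts the upper ends of the telescoping sums where [G] is the identity and the
   lower ends where [G] is zero. *)
- move=> N s s1 sN; rewrite (sum_second_difference G) (sum_index_second_difference G).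
  rewrite (sum_second_difference G') (sum_index_second_difference G').
  rewrite !(G1 s) ?(G1 (s + 1)) ?(G'1 s) ?(G'1 (s + 1)); [|lra..].
  rewrite !(G0 (s - N%:R)) ?(G0 (s - N%:R + 1)) ?(G'0 (s - N%:R)) ?(G'0 (s - N%:R + 1)); [|lra..].
  by split; ring.
Unshelve. all: by end_near. Qed.

(** * Products of functions of one coordinate *)

Section tensor.
Context {R : realType} {n : nat}.
Implicit Types (x v : 'rV[R]_n).

Lemma coord_affine (j : 'I_n) (h : R) (v x : 'rV[R]_n) :
  (h *: v + x) 0 j = h * v 0 j + x 0 j.
Proof. by rewrite !mxE. Qed.

Lemma continuous_coord (j : 'I_n) :
  continuous (fun x : 'rV[R]_n => x 0 j : R^o).
Proof. by move=> x; exact: coord_continuous. Qed.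

(** Only the factor of index [j] moves along [delta_mx 0 j]; the others form the constant [C]. *)
Lemma is_derive_tensor (f f' : 'I_n -> R^o -> R^o) j x :
  is_derive (x 0 j : R^o) 1 (f j) (f' j (x 0 j)) ->
  is_derive x (delta_mx 0 j) (fun x => \prod_i f i (x 0 i) : R^o)
    (\prod_i (if i == j then f' i else f i) (x 0 i)).
Proof.
move=> [df dfE].
pose C := \prod_(i | i != j) f i (x 0 i).
have dC : is_derive (x 0 j : R^o) 1 (fun u : R^o => C * f j u : R^o) (C * f' j (x 0 j)).
  by apply: (@is_deriveZ _ _ _ (f j) C); apply: DeriveDef.
have E : (fun h : R^o => h^-1 *: (((fun x => \prod_i f i (x 0 i) : R^o) \o shift x)
      (h *: delta_mx 0 j) - \prod_i f i (x 0 i)) : R^o) =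
   (fun h : R^o => h^-1 *: (((fun u : R^o => C * f j u : R^o) \o shift (x 0 j : R^o)) (h *: (1 : R^o)) -
     (C * f j (x 0 j)))).
  apply/funext => h /=; congr (_ *: (_ - _)); last first.
    by rewrite (bigD1 j)//= mulrC.
  rewrite (bigD1 j)//= mulrC !mxE !eqxx /=; congr (_ * _).
  by apply: eq_bigr => i ij; rewrite !mxE (negPf ij) andbF mulr0 add0r.
rewrite (bigD1 j)//= eqxx mulrC.
rewrite (eq_bigr (fun i => f i (x 0 i))); last by move=> i /negPf ->.
case: dC => d1 d2; split; first by rewrite /derivable E.
by rewrite /derive E.
Qed.

Lemma differentiable_tensor (f : 'I_n -> R^o -> R^o) x :
  (forall i u, derivable (f i) u 1) ->
  differentiable (fun x => \prod_i f i (x 0 i) : R^o) x.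
Proof.
move=> df; elim: (index_enum _) => [|i r IH].
  rewrite (_ : (fun x => _) = cst 1); first exact: differentiable_cst.
  by apply/funext => y; rewrite big_nil.
rewrite (_ : (fun x => _) = (fun y : 'rV[R]_n => f i (y 0 i)) * (fun y => \prod_(j <- r) f j (y 0 j))).
  apply: differentiableM => //.
  apply: (@differentiable_comp _ _ R^o R^o (fun y : 'rV[R]_n => y 0 i) (f i)).
    exact: differentiable_coord.
  exact/derivable1_diffP.
by apply/funext => y; rewrite big_cons.
Qed.

Lemma diff_rVE {W : normedModType R} (f : 'rV[R]_n -> W) x v :
  differentiable f x -> 'd f x v = \sum_j v 0 j *: 'D_(delta_mx 0 j) f x.
Proof.
move=> df; rewrite [in LHS](row_sum_delta v) linear_sum.
by apply: eq_bigr => j _; rewrite linearZ /= deriveE.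
Qed.

Lemma is_derive_bigsum {V W : normedModType R} (I : Type) (r : seq I)
    (F : I -> V -> W) (dF : I -> W) (x v : V) :
  (forall i, is_derive x v (F i) (dF i)) ->
  is_derive x v (fun y => \sum_(i <- r) F i y) (\sum_(i <- r) dF i).
Proof.
move=> hF; elim: r => [|i r IH].
  rewrite big_nil (_ : (fun y => _) = cst 0); first exact: is_derive_cst.
  by apply/funext => y; rewrite big_nil.
rewrite big_cons.
rewrite (_ : (fun y => _) = F i + (fun y => \sum_(i <- r) F i y)).
  exact: is_deriveD.
by apply/funext => y; rewrite big_cons.
Qed.

Lemma differentiable_bigsum {V W : normedModType R} (I : Type) (r : seq I)
    (F : I -> V -> W) (x : V) :
  (forall i, differentiable (F i) x) ->
  differentiable (fun y => \sum_(i <- r) F i y) x.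
Proof.
move=> hF; elim: r => [|i r IH].
  rewrite (_ : (fun y => _) = cst 0); first exact: differentiable_cst.
  by apply/funext => y; rewrite big_nil.
rewrite (_ : (fun y => _) = F i + (fun y => \sum_(i <- r) F i y)).
  exact: differentiableD.
by apply/funext => y; rewrite big_cons.
Qed.

End tensor.

Section tensor_sums.
Context {R : comRingType} {n N : nat}.
Implicit Types (F : 'I_n -> 'I_N -> R).

Lemma sum_tensor F :
  \sum_(k : {ffun 'I_n -> 'I_N}) \prod_i F i (k i) = \prod_i \sum_m F i m.
Proof. by rewrite bigA_distr_bigA. Qed.

Lemma sum_tensor_coord F l (h : 'I_N -> R) :
  \sum_(k : {ffun 'I_n -> 'I_N}) h (k l) * \prod_i F i (k i) =
  (\sum_m h m * F l m) * \prod_(i | i != l) \sum_m F i m.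
Proof.
pose F' i m := if i == l then h m * F i m else F i m.
rewrite (eq_bigr (fun k : {ffun 'I_n -> 'I_N} => \prod_i F' i (k i))); last first.
  move=> k _; rewrite [LHS]mulrC (bigD1 l)//= [RHS](bigD1 l)//= /F' eqxx.
  rewrite mulrC mulrA; congr (_ * _).
  by apply: eq_bigr => i /negPf ->.
rewrite sum_tensor (bigD1 l)//= /F' eqxx; congr (_ * _).
by apply: eq_bigr => i /negPf ->.
Qed.

End tensor_sums.

Section quasi_interpolation.
Context {R : realType} {n : nat} {chi chi' : R^o -> R^o} {c : R}.
Hypothesis hk : reproducing_kernel chi chi' c.
Variables (d : R) (M : nat).
Hypothesis d0 : 0 < d.
Let N := M.*2.+1.
Implicit Types (x v g : 'rV[R]_n) (k : {ffun 'I_n -> 'I_N}) (a : {ffun 'I_n -> 'I_N} -> R).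

(** The grid of mesh [d] with coordinates from [- d * M] to [d * M], shifted by [M] so that its
    indices are natural numbers. *)
Definition node k : 'rV[R]_n := \row_i (d * ((k i)%:R - M%:R)).

Definition weight k x : R := \prod_i chi (x 0 i / d + M%:R - (k i)%:R).

Definition dweight k j x : R :=
  \prod_i (if i == j then fun s => d^-1 * chi' (s / d + M%:R - (k i)%:R)
           else fun s => chi (s / d + M%:R - (k i)%:R)) (x 0 i).

Definition qi a x : R := \sum_k a k * weight k x.
Definition dqi a j x : R := \sum_k a k * dweight k j x.

Let affine1 (m : R) (s : R) :
  is_derive (s : R^o) 1 (fun s : R^o => chi (s / d + M%:R - m) : R^o)
    (d^-1 * chi' (s / d + M%:R - m)).
Proof.
have [_ dchi _ _ _] := hk.
pose l (t : R^o) : R^o := t / d + M%:R - m.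
pose l0 (t : R^o) : R^o := t / d.
have ll (h : R) (y w : R^o) : l (h *: w + y) = h * l0 w + l y.
  by rewrite /l /l0 /GRing.scale /=; ring.
have [d1 d2] := @derive_comp_affine R R^o R^o R^o chi l l0 ll 1 s.
have [dl1 dl2] := dchi (l s).
have [e1 e2] := derive1_dir (l0 1) dl1.
apply: DeriveDef; first exact/d1.
by rewrite [LHS]d2 e2 dl2 /l0 mul1r.
Qed.

Lemma is_derive_weight k j x :
  is_derive x (delta_mx 0 j) (weight k : _ -> R^o) (dweight k j x).
Proof.
exact: (@is_derive_tensor _ _ (fun i s => chi (s / d + M%:R - (k i)%:R))
  (fun i s => d^-1 * chi' (s / d + M%:R - (k i)%:R))).
Qed.

Lemma differentiable_weight k x : differentiable (weight k : _ -> R^o) x.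
Proof.
apply: (@differentiable_tensor _ _ (fun i s => chi (s / d + M%:R - (k i)%:R))).
by move=> i u; have [] := affine1 (k i)%:R u.
Qed.

Lemma Ck_weight p k : Ck p (weight k : 'rV[R]_n -> R^o).
Proof.
have [schi _ _ _ _] := hk.
apply: Ck_prod => i _.
pose l (x : 'rV[R]_n) : R^o := x 0 i / d + M%:R - (k i)%:R.
apply: (@Ck_comp_affine R 'rV[R]_n R^o R^o p chi l (fun v => v 0 i / d)) => //.
- rewrite (_ : l = fun y => y 0 i * d^-1 + (M%:R - (k i)%:R)); last first.
    by apply/funext => y; rewrite /l addrA.
  apply: (@CkD _ 'rV[R]_n R^o 0%N); last exact: Ck_cst.
  by apply: (@CkM _ 'rV[R]_n 0%N); [exact: continuous_coord|exact: Ck_cst].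
- by move=> h x v; rewrite /l coord_affine /GRing.scale /=; ring.
Qed.

Let far x k i : 2 * d < `|x 0 i - node k 0 i| -> 2 < `|x 0 i / d + M%:R - (k i)%:R|.
Proof.
rewrite mxE.
rewrite (_ : x 0 i - _ = d * (x 0 i / d + M%:R - (k i)%:R)); last first.
  by field; rewrite gt_eqF.
by rewrite normrM gtr0_norm// [2 * d]mulrC ltr_pM2l.
Qed.

Let nearP x k : `|x - node k| <= 2 * d \/ exists i, 2 * d < `|x 0 i - node k 0 i|.
Proof.
have [[i H]|H] := pselect (exists i, 2 * d < `|x 0 i - node k 0 i|).
  by right; exists i.
left; rewrite [leLHS]/Num.Def.normr /= mx_normrE.
apply/bigmax_leP; split; first by rewrite mulr_ge0// ltW.
move=> [i j] _ /=; rewrite ord1 !mxE leNgt; apply/negP => K; apply: H; exists j.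
by rewrite mxE.
Qed.

Lemma weight_far x k : 2 * d < `|x - node k| -> weight k x = 0.
Proof.
move=> H; have [|[i /far H']] := nearP x k; first by rewrite leNgt H.
have [_ _ _ [chi0 _] _] := hk.
by rewrite /weight (bigD1 i)//= chi0 ?mul0r.
Qed.

Lemma dweight_far x k j : 2 * d < `|x - node k| -> dweight k j x = 0.
Proof.
move=> H; have [|[i /far H']] := nearP x k; first by rewrite leNgt H.
have [_ _ _ [chi0 chi'0] _] := hk.
by rewrite /dweight (bigD1 i)//=; case: ifP => _; rewrite ?chi'0 ?chi0 ?mulr0 ?mul0r.
Qed.

Let c0 : 0 <= c.
Proof. by have [_ _ [h _] _ _] := hk; exact: le_trans (normr_ge0 _) (h 0). Qed.

(** As [chi] may take negative values, this bound plays the role of the unit mass of a mollifier. *)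
Lemma sum_norm_weight x : \sum_k `|weight k x| <= (5 * c) ^+ n.
Proof.
have [_ _ [hc _] [chi0 _] _] := hk.
under eq_bigr do rewrite normr_prod.
rewrite (sum_tensor (fun i (m : 'I_N) => `|chi (x 0 i / d + M%:R - m%:R)|)).
rewrite -[n in leRHS]card_ord -prodr_const.
apply: ler_prod => i _; apply/andP; split.
  by apply: sumr_ge0 => m _; exact: normr_ge0.
exact: sum_local_le.
Qed.

Lemma sum_norm_dweight j x : \sum_k `|dweight k j x| <= d^-1 * (5 * c) ^+ n.
Proof.
have [_ _ [hc hc'] [chi0 chi'0] _] := hk.
under eq_bigr do rewrite normr_prod.
pose F (i : 'I_n) (m : 'I_N) : R := `|(if i == j then fun s => d^-1 * chi' (s / d + M%:R - m%:R)
           else fun s => chi (s / d + M%:R - m%:R)) (x 0 i)|.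
rewrite (sum_tensor F) (bigD1 j)//= -[n in leRHS]card_ord -prodr_const.
rewrite [in leRHS](bigD1 j)//= [leRHS]mulrA; apply: ler_pM.
- by apply: sumr_ge0 => m _; exact: normr_ge0.
- by apply: prodr_ge0 => i _; apply: sumr_ge0 => m _; exact: normr_ge0.
- rewrite /F eqxx; under eq_bigr do rewrite normrM.
  rewrite -mulr_sumr gtr0_norm ?invr_gt0// ler_wpM2l ?invr_ge0 ?(ltW d0)//.
  exact: sum_local_le.
- apply: ler_prod => i /negPf ij; apply/andP; split.
    by apply: sumr_ge0 => m _; exact: normr_ge0.
  by rewrite /F ij; exact: sum_local_le.
Qed.

Section covered.
Variable x : 'rV[R]_n.
Hypothesis cov : forall i, `|x 0 i| <= d * (M%:R - 2).

(** The margin of two cells in [cov] places the rescaled coordinate in the range where the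
    translates of [chi] reproduce affine functions. *)
Let s_gt i : 1 < x 0 i / d + M%:R.
Proof.
have := cov i; rewrite ler_norml => /andP[h _].
have : - (M%:R - 2) <= x 0 i / d by rewrite ler_pdivlMr// mulNr mulrC.
by lra.
Qed.

Let s_lt i : x 0 i / d + M%:R + 1 < N%:R.
Proof.
have := cov i; rewrite ler_norml => /andP[_ h].
have : x 0 i / d <= M%:R - 2 by rewrite ler_pdivrMr// mulrC.
have -> : N%:R = M%:R + M%:R + 1 :> R by rewrite /N -(addn1 M.*2) -addnn !natrD.
by lra.
Qed.

Let spec i := let: And5 _ _ _ _ h := hk in h N _ (s_gt i) (s_lt i).

Let sum_shift (f : R -> R) i (A B : R) :
  \sum_(m < N) f (x 0 i / d + M%:R - m%:R) = A ->
  \sum_(m < N) m%:R * f (x 0 i / d + M%:R - m%:R) = B ->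
  \sum_(m < N) d * (m%:R - M%:R) * f (x 0 i / d + M%:R - m%:R) = d * (B - M%:R * A).
Proof.
move=> <- <-; rewrite mulrBr !mulr_sumr -sumrB.
by apply: eq_bigr => m _; ring.
Qed.

Lemma sum_weight : \sum_k weight k x = 1.
Proof.
rewrite (sum_tensor (fun i (m : 'I_N) => chi (x 0 i / d + M%:R - m%:R))).
by rewrite big1// => i _; have [->] := spec i.
Qed.

Lemma sum_dweight j : \sum_k dweight k j x = 0.
Proof.
pose F (i : 'I_n) (m : 'I_N) : R := (if i == j then fun s => d^-1 * chi' (s / d + M%:R - m%:R)
           else fun s => chi (s / d + M%:R - m%:R)) (x 0 i).
rewrite (sum_tensor F) (bigD1 j)//= /F eqxx -mulr_sumr.
by have [_ _ -> _] := spec j; rewrite mulr0 mul0r.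
Qed.

Lemma sum_node_weight l : \sum_k node k 0 l * weight k x = x 0 l.
Proof.
under eq_bigr do rewrite mxE.
rewrite (sum_tensor_coord (fun i (m : 'I_N) => chi (x 0 i / d + M%:R - m%:R)) l
  (fun m => d * (m%:R - M%:R))).
rewrite [X in _ * X]big1 ?mulr1; last by move=> i _; have [->] := spec i.
have [h1 h2 _ _] := spec l; rewrite (sum_shift h1 h2) mulr1 addrK.
by rewrite mulrCA divff ?gt_eqF ?mulr1.
Qed.

Lemma sum_node_dweight l j : \sum_k node k 0 l * dweight k j x = (l == j)%:R.
Proof.
under eq_bigr do rewrite mxE.
pose F (i : 'I_n) (m : 'I_N) : R := (if i == j then fun s => d^-1 * chi' (s / d + M%:R - m%:R)
           else fun s => chi (s / d + M%:R - m%:R)) (x 0 i).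
rewrite (sum_tensor_coord F l (fun m => d * (m%:R - M%:R))).
have [->|lj] := eqVneq l j.
  rewrite [X in _ * X]big1 ?mulr1; last first.
    by move=> i /negPf ij; rewrite /F ij; have [->] := spec i.
  rewrite /F eqxx; have [_ _ h1 h2] := spec j.
  under eq_bigr do rewrite mulrCA.
  by rewrite -mulr_sumr (sum_shift h1 h2) mulr0 subr0 mulr1 mulVf// gt_eqF.
rewrite [X in _ * X](bigD1 j) 1?eq_sym//= {2}/F eqxx -mulr_sumr.
by have [_ _ -> _] := spec j; rewrite mulr0 mul0r mulr0.
Qed.

Let expand a (v0 : R) g (w : {ffun 'I_n -> 'I_N} -> R) :
  \sum_k (a k - v0 - dot g (node k - x)) * w k =
  \sum_k a k * w k - (v0 - dot g x) * \sum_k w k - \sum_l g 0 l * \sum_k node k 0 l * w k.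
Proof.
rewrite (eq_bigr (fun k => a k * w k - (v0 - dot g x) * w k - \sum_l g 0 l * (node k 0 l * w k))); last first.
  move=> k _; rewrite (_ : dot g (node k - x) = \sum_l g 0 l * node k 0 l - dot g x); last first.
    by rewrite -sumrB; apply: eq_bigr => l _; rewrite !mxE mulrBr.
  under [X in _ = _ - X]eq_bigr do rewrite mulrA.
  by rewrite -mulr_suml; ring.
rewrite !sumrB mulr_sumr exchange_big /=; congr (_ - _).
by apply: eq_bigr => l _; rewrite mulr_sumr.
Qed.

(** The affine function of value [v0] and slope [g] at [x] is reproduced exactly, so that only the
    deviation of the data from it at nodes near [x] counts. *)
Lemma qi_estimate a (v0 E : R) g :
  (forall k, `|x - node k| <= 2 * d -> `|a k - v0 - dot g (node k - x)| <= E) ->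
  `|qi a x - v0| <= E * (5 * c) ^+ n.
Proof.
move=> aE; have -> : qi a x - v0 = \sum_k (a k - v0 - dot g (node k - x)) * weight k x.
  rewrite expand sum_weight mulr1.
  under [X in _ = _ - X]eq_bigr do rewrite sum_node_weight.
  by rewrite -/(dot g x) /qi; ring.
apply: le_trans (ler_norm_sum _ _ _) _.
apply: (@le_trans _ _ (\sum_k E * `|weight k x|)).
  apply: ler_sum => k _; rewrite normrM.
  have [h|h] := leP `|x - node k| (2 * d); first by rewrite ler_wpM2r// aE.
  by rewrite weight_far// normr0 !mulr0.
rewrite -mulr_sumr.
have [E0|E0] := leP 0 E; first by rewrite ler_wpM2l// sum_norm_weight.
(* A negative [E] would leave no node within [2 * d] of [x], whereas the weights sum to one. *)
exfalso; have := sum_weight; rewrite big1 => [/eqP|k _].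
  by rewrite eq_sym oner_eq0.
apply: weight_far; rewrite ltNge; apply/negP => /aE.
by move/(le_trans (normr_ge0 _)); rewrite leNgt E0.
Qed.

(** Differentiating the weights costs [d^-1]. With [g = 0], a modulus of continuity of the data
    yields a bound on the derivative; with [g] the gradient at a point of differentiability, [E] is
    small compared with [d] and the derivative converges to [g]. *)
Lemma dqi_estimate a (v0 E : R) g j : 0 <= E ->
  (forall k, `|x - node k| <= 2 * d -> `|a k - v0 - dot g (node k - x)| <= E) ->
  `|dqi a j x - g 0 j| <= E * (d^-1 * (5 * c) ^+ n).
Proof.
move=> E0 aE.
have -> : dqi a j x - g 0 j = \sum_k (a k - v0 - dot g (node k - x)) * dweight k j x.
  rewrite expand sum_dweight mulr0 subr0.
  under [X in _ = _ - X]eq_bigr do rewrite sum_node_dweight.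
  congr (_ - _); rewrite (bigD1 j)//= eqxx mulr1 big1 ?addr0// => l /negPf ->.
  by rewrite mulr0.
apply: le_trans (ler_norm_sum _ _ _) _.
apply: (@le_trans _ _ (\sum_k E * `|dweight k j x|)).
  apply: ler_sum => k _; rewrite normrM.
  have [h|h] := leP `|x - node k| (2 * d); first by rewrite ler_wpM2r// aE.
  by rewrite dweight_far// normr0 !mulr0.
by rewrite -mulr_sumr ler_wpM2l// sum_norm_dweight.
Qed.

End covered.

Lemma is_derive_qi a j x :
  is_derive x (delta_mx 0 j) (qi a : _ -> R^o) (dqi a j x).
Proof.
apply: is_derive_bigsum => k.
exact: (@is_deriveZ _ _ _ (weight k : _ -> R^o) (a k) _ _ _ (is_derive_weight k j x)).
Qed.

Lemma differentiable_qi a x : differentiable (qi a : _ -> R^o) x.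
Proof.
apply: differentiable_bigsum => k.
exact: (@differentiableZ _ _ _ (weight k : _ -> R^o) (a k) _ (differentiable_weight k x)).
Qed.

Lemma diff_qiE a x v :
  'd (qi a : _ -> R^o) x v = \sum_j v 0 j * dqi a j x.
Proof.
rewrite diff_rVE; last exact: differentiable_qi.
by apply: eq_bigr => j _; have [_ ->] := is_derive_qi a j x.
Qed.

Lemma Ck_qi p a : Ck p (qi a : 'rV[R]_n -> R^o).
Proof.
apply: Ck_sum => k _; apply: CkM; first exact: Ck_cst.
exact: Ck_weight.
Qed.

End quasi_interpolation.

Arguments qi {R n} chi d {M} a x.
Arguments dqi {R n} chi chi' d {M} a j x.
Arguments weight {R n} chi d {M} k x.
Arguments dweight {R n} chi chi' d {M} k j x.

Section uncons.
Context {R : realType} {n : nat}.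

(** Space-time points are viewed as rows of length [n.+1], the type on which quasi-interpolation is
    defined. *)
Definition uncons_rV (y : 'rV[R]_n.+1) : R^o * 'rV[R]_n :=
  (y 0 0, \row_j y 0 (lift ord0 j)).

Lemma uncons_rVK : cancel uncons_rV (@cons_rV R n).
Proof.
move=> y; apply/rowP => i; case: (unliftP ord0 i) => [j ->|->].
  by rewrite cons_rVS mxE.
by rewrite cons_rV0.
Qed.

Lemma cons_rVK : cancel (@cons_rV R n) uncons_rV.
Proof.
move=> [t x]; rewrite /uncons_rV cons_rV0; congr pair.
by apply/rowP => j; rewrite mxE cons_rVS.
Qed.

Lemma cons_rV_affine (h : R) (z w : R^o * 'rV[R]_n) :
  cons_rV (h *: w + z) = h *: cons_rV w + cons_rV z.
Proof.
apply/rowP => i; case: (unliftP ord0 i) => [j ->|->].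
  by rewrite coord_affine !cons_rVS coord_affine.
by rewrite coord_affine !cons_rV0.
Qed.

Lemma uncons_rV_is_linear : linear uncons_rV.
Proof.
move=> h y w; apply: (can_inj cons_rVK).
by rewrite cons_rV_affine !uncons_rVK.
Qed.

HB.instance Definition _ := GRing.isLinear.Build R 'rV[R]_n.+1 (R^o * 'rV[R]_n)%type
  _ uncons_rV uncons_rV_is_linear.

Lemma coord_le_norm m (x : 'rV[R]_m) i : `|x 0 i| <= `|x|.
Proof. by rewrite [leRHS]/Num.Def.normr /= mx_normrE; exact: (le_bigmax_cond _ (fun i => `|x i.1 i.2|) (j := (0, i))). Qed.

Lemma norm_rV_le m (x : 'rV[R]_m) (e : R) : 0 <= e ->
  (forall i, `|x 0 i| <= e) -> `|x| <= e.
Proof.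
move=> e0 H; rewrite [leLHS]/Num.Def.normr /= mx_normrE.
by apply/bigmax_leP; split => // -[i j] _ /=; rewrite ord1.
Qed.

Lemma norm_uncons_rV y : `|uncons_rV y| <= `|y|.
Proof.
rewrite /uncons_rV [leLHS]/Num.Def.normr /= ge_max; apply/andP; split.
  exact: coord_le_norm.
by apply: norm_rV_le => // j; rewrite mxE coord_le_norm.
Qed.

Lemma continuous_cons_rV : continuous (@cons_rV R n : R^o * 'rV[R]_n -> _).
Proof.
move=> z A /nbhs_ballP[e /= e0 eA]; apply/nbhs_ballP; exists e => //= w [w1 [_ w2]].
apply: eA; split => // i j; rewrite !ord1.
case: (unliftP ord0 j) => [k ->|->]; first by rewrite !cons_rVS; exact: w2.
by rewrite !cons_rV0.
Qed.

End uncons.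

(** * Smoothing Lipschitz functions of time and space into test functions *)

Section mollified_test_function.
Context {R : realType} {n : nat} {chi chi' : R^o -> R^o} {c : R}.
Hypothesis hk : reproducing_kernel chi chi' c.
Variables (phi : R -> 'rV[R]_n -> R) (T s R0 Lam : R).
Hypothesis Lam0 : 0 <= Lam.
Hypothesis phi_lip : forall t t' x x',
  `|phi t x - phi t' x'| <= Lam * Num.max `|t - t'| `|x - x'|.
Hypothesis phi_late : forall t x, s <= t -> phi t x = 0.
Hypothesis phi_far : forall t x, R0 <= `|x| -> phi t x = 0.

Variables (d : R) (M : nat).
Hypothesis d0 : 0 < d.
Hypothesis cov : Num.max T (R0 + 2 * d) <= d * (M%:R - 2).

Let ph (z : R^o * 'rV[R]_n) : R^o := phi z.1 z.2.
Let a (k : {ffun 'I_n.+1 -> 'I_(M.*2.+1)}) : R := ph (uncons_rV (node d k)).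

Definition mollify (t : R) (x : 'rV[R]_n) : R := qi chi d a (cons_rV (t, x)).

Definition mollify_dt (t : R) (x : 'rV[R]_n) : R := dqi chi chi' d a 0 (cons_rV (t, x)).

Definition mollify_dx (t : R) (x : 'rV[R]_n) : 'rV[R]_n :=
  \row_j dqi chi chi' d a (lift ord0 j) (cons_rV (t, x)).

Let a_neq0 k : a k != 0 ->
  (uncons_rV (node d k)).1 < s /\ `|(uncons_rV (node d k)).2| < R0.
Proof.
move=> ak; split; rewrite ltNge; apply: contra ak => h; apply/eqP.
  exact: phi_late.
exact: phi_far.
Qed.

Let near_node (k : {ffun 'I_n.+1 -> 'I_(M.*2.+1)}) (t : R) (x : 'rV[R]_n) : `|cons_rV (t, x) - node d k| <= 2 * d ->
  `|t - (uncons_rV (node d k)).1| <= 2 * d /\ `|x - (uncons_rV (node d k)).2| <= 2 * d.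
Proof.
have := norm_uncons_rV (cons_rV (t, x) - node d k).
rewrite linearB /= cons_rVK [leLHS]/Num.Def.normr /= ge_max => /andP[h1 h2] h.
by split; [exact: le_trans h1 h|exact: le_trans h2 h].
Qed.

(** The family [w] is left free so that the weights and their derivatives are treated at once:
    smoothing widens the support by [2 * d], in time as in space. *)
Let qi_out (w : {ffun 'I_n.+1 -> 'I_(M.*2.+1)} -> R) (t : R) (x : 'rV[R]_n) :
  (forall k, 2 * d < `|cons_rV (t, x) - node d k| -> w k = 0) ->
  s + 2 * d <= t \/ R0 + 2 * d <= `|x| -> \sum_k a k * w k = 0.
Proof.
move=> hw h; apply: big1 => k _.
have [->|/a_neq0[k1 k2]] := eqVneq (a k) 0; first by rewrite mul0r.
rewrite hw ?mulr0// ltNge; apply/negP => /near_node[h1 h2].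
case: h => h.
  by move: h1; rewrite ler_norml => /andP[_ h1]; lra.
have := ler_normD (x - (uncons_rV (node d k)).2) (uncons_rV (node d k)).2.
by rewrite subrK; lra.
Qed.

Lemma mollify_out t x : s + 2 * d <= t \/ R0 + 2 * d <= `|x| -> mollify t x = 0.
Proof. by apply: qi_out => k; exact: (weight_far hk d0). Qed.

Lemma mollify_d_out t x j : s + 2 * d <= t \/ R0 + 2 * d <= `|x| ->
  dqi chi chi' d a j (cons_rV (t, x)) = 0.
Proof. by apply: qi_out => k; exact: (dweight_far hk d0). Qed.

Lemma derive1_mollify t x : derive1 (mollify ^~ x) t = mollify_dt t x.
Proof.
rewrite derive1E.
pose l (u : R^o) : 'rV[R]_n.+1 := cons_rV (u, x).
pose l0 (u : R^o) : 'rV[R]_n.+1 := u *: delta_mx 0 0.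
have ll (h : R) (u v : R^o) : l (h *: v + u) = h *: l0 v + l u.
  apply/rowP => i; rewrite coord_affine /l /l0.
  have -> : (v *: delta_mx 0 0 : 'rV[R]_n.+1) 0 i = v * (i == 0)%:R by rewrite !mxE eqxx.
  case: (unliftP ord0 i) => [j ->|->].
    by rewrite !cons_rVS /= !mulr0 add0r.
  by rewrite !cons_rV0 /= mulr1.
have [_ E] := derive_comp_affine (qi chi d a : _ -> R^o) ll 1 t.
rewrite [LHS]E /l0 scale1r.
by have [_ ->] := is_derive_qi hk d a 0 (l t).
Qed.

Lemma grad_mollify t x : grad (mollify t) x = mollify_dx t x.
Proof.
apply/rowP => i; rewrite !mxE.
pose l (u : 'rV[R]_n) : 'rV[R]_n.+1 := cons_rV (t, u).
pose l0 (u : 'rV[R]_n) : 'rV[R]_n.+1 := cons_rV (0, u).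
have ll (h : R) (u v : 'rV[R]_n) : l (h *: v + u) = h *: l0 v + l u.
  by rewrite /l /l0 -cons_rV_affine; congr cons_rV; congr pair; rewrite /= scaler0 add0r.
have [_ E] := derive_comp_affine (qi chi d a : _ -> R^o) ll (delta_mx 0 i) x.
rewrite [LHS]E (_ : l0 (delta_mx 0 i) = delta_mx 0 (lift ord0 i)); last first.
  apply/rowP => j; case: (unliftP ord0 j) => [k ->|->].
    by rewrite /l0 cons_rVS !mxE /= (inj_eq (@lift_inj _ _)).
  by rewrite /l0 cons_rV0 mxE.
by have [_ ->] := is_derive_qi hk d a (lift ord0 i) (l x).
Qed.

Lemma test_function_mollify : s + 2 * d < T -> test_function T mollify.
Proof.
move=> sT; split.
  move=> k; apply: (@Ck_comp_affine _ (R^o * 'rV[R]_n)%type 'rV[R]_n.+1 R^o k (qi chi d a) (@cons_rV R n) (@cons_rV R n)).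
  - exact: continuous_cons_rV.
  - by move=> h x v; exact: cons_rV_affine.
  - exact: (Ck_qi hk).
pose r := R0 + 2 * d.
exists (`[0, s + 2 * d]%classic `*` [set x : 'rV[R]_n | forall i, `[- r, r]%classic (x 0 i)]); split.
- apply: compact_setX; first exact: segment_compact.
  by apply: (@rV_compact _ _ (fun=> `[- r, r]%classic)) => _; exact: segment_compact.
- move=> [t x] [/=]; rewrite !in_itv /= => /andP[-> /le_lt_trans -> //].
- move=> t x; rewrite in_itv /= => /andP[t0 tT] nK; apply: mollify_out.
  have [|ts] := leP (s + 2 * d) t; first by left.
  right; rewrite leNgt; apply/negP => xr; apply: nK; split => /=.
    by rewrite in_itv /= t0 ltW.
  by move=> i; rewrite in_itv /= -ler_norml (le_trans (coord_le_norm _ _) (ltW xr)).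
Qed.

Let covered (t : R) (x : 'rV[R]_n) : 0 <= t <= T -> `|x| <= R0 + 2 * d ->
  forall i, `|cons_rV (t, x) 0 i| <= d * (M%:R - 2).
Proof.
move=> /andP[t1 t2] xR i; apply: le_trans cov; rewrite le_max.
case: (unliftP ord0 i) => [j ->|->].
  by rewrite cons_rVS (le_trans (coord_le_norm _ _) xR) orbT.
by rewrite cons_rV0 /= ger0_norm ?t2.
Qed.

Let two_d (e : R) : e * (2 * d) * (d^-1 * (5 * c) ^+ n.+1) = 2 * e * (5 * c) ^+ n.+1.
Proof. by field; rewrite gt_eqF. Qed.

(** The oscillation [Lam * (2 * d)] of [phi] over a neighbourhood cancels the factor [d^-1]. The
    bound is uniform in [d] and will provide the domination in the passage to the limit. *)
Lemma mollify_d_bounded (t : R) (x : 'rV[R]_n) j : 0 <= t <= T ->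
  `|dqi chi chi' d a j (cons_rV (t, x))| <= 2 * Lam * (5 * c) ^+ n.+1.
Proof.
move=> tT; have [xR|xR] := leP (R0 + 2 * d) `|x|.
  rewrite mollify_d_out; last by right.
  rewrite normr0 mulr_ge0//; first by rewrite mulr_ge0.
  have [_ _ [h _] _ _] := hk.
  by rewrite exprn_ge0// mulr_ge0// (le_trans (normr_ge0 _) (h 0)).
rewrite -two_d -[X in `|X|]subr0.
have zE : (0 : 'rV[R]_n.+1) 0 j = 0 by rewrite mxE.
rewrite -[X in _ - X]zE.
apply: (dqi_estimate hk d0 (covered tT (ltW xR)) (v0 := ph (t, x))).
  by rewrite mulr_ge0// mulr_ge0// ltW.
move=> k /near_node[h1 h2].
rewrite (_ : dot 0 _ = 0) ?subr0; last by rewrite /dot big1// => i _; rewrite mxE mul0r.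
apply: le_trans (phi_lip _ _ _ _) _; rewrite ler_wpM2l// ge_max.
by rewrite distrC h1 distrC h2.
Qed.

Lemma mollify_d_near (t : R) (x : 'rV[R]_n) (e : R) j :
  0 <= t <= T -> `|x| <= R0 + 2 * d -> 0 <= e ->
  (forall z : R^o * 'rV[R]_n, `|z - (t, x)| <= 2 * d ->
    `|ph z - ph (t, x) - 'd ph (t, x) (z - (t, x))| <= e * `|z - (t, x)|) ->
  `|dqi chi chi' d a j (cons_rV (t, x)) - 'd ph (t, x) (uncons_rV (delta_mx 0 j))|
    <= 2 * e * (5 * c) ^+ n.+1.
Proof.
move=> tT xR e0 H; rewrite -two_d.
pose g : 'rV[R]_n.+1 := \row_i 'd ph (t, x) (uncons_rV (delta_mx 0 i)).
have -> : 'd ph (t, x) (uncons_rV (delta_mx 0 j)) = g 0 j by rewrite mxE.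
apply: (dqi_estimate hk d0 (covered tT xR) (v0 := ph (t, x))).
  by rewrite mulr_ge0// mulr_ge0// ltW.
move=> k hkk.
have hE : uncons_rV (node d k) - (t, x) = uncons_rV (node d k - cons_rV (t, x)).
  by rewrite linearB /= cons_rVK.
have -> : dot g (node d k - cons_rV (t, x)) = 'd ph (t, x) (uncons_rV (node d k) - (t, x)).
  rewrite hE {2}(row_sum_delta (node d k - cons_rV (t, x))) !linear_sum.
  by apply: eq_bigr => i _; rewrite mxE !linearZ /= mulrC.
have hz : `|uncons_rV (node d k) - (t, x)| <= 2 * d.
  by rewrite hE (le_trans (norm_uncons_rV _))// distrC.
by apply: le_trans (H _ hz) _; rewrite ler_wpM2l.
Qed.

End mollified_test_function.

(** * Testing with Lipschitz functions *)

Lemma measurable_fun_continuous_rV {R : realType} m (f : 'rV[R]_m -> R) :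
  continuous f -> measurable_fun [set: 'rV[R]_m] (f : _ -> measurableTypeR R).
Proof.
move=> cf; apply: (measurability _ (measurable_realfun.RGenOpens.measurableE R)).
move=> _ [_ [a [b ->]] <-].
rewrite setTI; apply: sub_sigma_algebra; by apply: open_comp => // x _; exact: cf.
Qed.

Lemma continuous_dqi {R : realType} {n M : nat} {chi chi' : R^o -> R^o} {c : R}
    (hk : reproducing_kernel chi chi' c) (d : R) (a : {ffun 'I_n -> 'I_(M.*2.+1)} -> R) j :
  continuous (dqi chi chi' d a j : 'rV[R]_n -> R).
Proof.
have [_ /(_ (delta_mx 0 j))[_]] := Ck_qi hk d 1 a.
rewrite (_ : (fun x => _) = dqi chi chi' d a j)//.
by apply/funext => x; have [_ ->] := is_derive_qi hk d a j x.
Qed.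

Section integral_inequalities.
Context d (S : measurableType d) (R : realType) (mu : {measure set S -> \bar R}).
Implicit Types f g : S -> R.

(** The bound on [f] is restricted to the points where [g] is nonzero because derivatives of test
    functions are controlled only at the times where [rho] lives. *)
Lemma integrable_mul_bounded f g K : measurable_fun setT f ->
  (forall z, g z != 0 -> `|f z| <= K) ->
  mu.-integrable setT (EFin \o g) -> mu.-integrable setT (EFin \o (fun z => f z * g z)).
Proof.
move=> mf fK ig; have /integrableP[/measurable_EFinP mg _] := ig.
apply: (le_integrable measurableT _ _ (integrableZl measurableT K ig)).
  by apply/measurable_EFinP; exact: measurable_funM.
move=> z _; rewrite /= lee_fin normrM normrM.
have [->|gz] := eqVneq (g z) 0; first by rewrite normr0 !mulr0.
by rewrite ler_wpM2r// (le_trans (fK _ gz))// ler_norm.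
Qed.

Lemma integrable_normr f : mu.-integrable setT (EFin \o f) ->
  mu.-integrable setT (EFin \o (fun z => `|f z|)).
Proof. exact: integrable_abse. Qed.

Lemma integrable_scale K f : mu.-integrable setT (EFin \o f) ->
  mu.-integrable setT (EFin \o (fun z => K * f z)).
Proof. by move=> h; exact: (integrableZl measurableT K h). Qed.

Lemma integrable_sub f g : mu.-integrable setT (EFin \o f) ->
  mu.-integrable setT (EFin \o g) -> mu.-integrable setT (EFin \o (fun z => f z - g z)).
Proof. by move=> h1 h2; exact: (integrableB measurableT h1 h2). Qed.

End integral_inequalities.

Lemma differentiable_expansion {R : realType} {V W : normedModType R} (f : V -> W)
    (x : V) (e : R) : differentiable f x -> 0 < e ->
  exists2 eta : R, 0 < eta & forall z, `|z - x| <= eta ->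
    `|f z - f x - 'd f x (z - x)| <= e * `|z - x|.
Proof.
move=> /diff_locally/eqaddoP /(_ _)/[swap] e0 /(_ _ e0) /nbhs_normP[eta /= eta0 H].
exists (eta / 2); first by rewrite divr_gt0.
move=> z zx; have := H (z - x); rewrite /= sub0r normrN => /(_ _).
rewrite -[X in `|X| <= _]/(f (z - x + x) - (f x + 'd f x (z - x))) subrK opprD addrA.
apply.
by rewrite (le_lt_trans zx)// gtr_pMr// invf_lt1// ltr1n.
Qed.

Section limit_of_test_functions.
Context {R : realType} {n : nat}.
Let V := 'rV[R]_n.
Let S := (measurableTypeR R * V)%type.
Let P : {measure set S -> \bar R} :=
  (@lebesgue_measure R \x lebesgue_measure_rV n)%E.
Variables (T s R0 Lam Kpsi B err : R) (b : R -> V -> V) (rho : S -> R)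
  (phi : R -> V -> R) (psi : S -> R).
Hypothesis sT : s < T.
Hypothesis Lam0 : 0 <= Lam.
Hypothesis err0 : 0 <= err.
Hypothesis phi_lip : forall t t' x x',
  `|phi t x - phi t' x'| <= Lam * Num.max `|t - t'| `|x - x'|.
Hypothesis phi_late : forall t x, s <= t -> phi t x = 0.
Hypothesis phi_far : forall t x, R0 <= `|x| -> phi t x = 0.
Hypothesis mb : measurable_fun [set: S] (fun z : S => b z.1 z.2).
Hypothesis bB : forall t x, `|x| <= R0 + 2 -> `|b t x| <= B.
Hypothesis rho_T : forall z, rho z != 0 -> 0 <= z.1 <= T.
Hypothesis irho : P.-integrable [set: S] (EFin \o rho).
Hypothesis weak : forall u, test_function T u ->
  \int[P]_z ((derive1 (u ^~ z.2) z.1 + dot (b z.1 z.2) (grad (u z.1) z.2)) * rho z) = 0.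
Hypothesis mpsi : measurable_fun [set: S] psi.
Hypothesis psi_bnd : forall z, `|psi z| <= Kpsi.
Hypothesis psi_far : forall z, R0 <= `|z.2| -> psi z = 0.

Let ph (z : R^o * V) : R^o := phi z.1 z.2.

Hypothesis phi_transport : {ae P, forall z, rho z = 0 \/
  (differentiable ph z /\ `|'d ph z (1, b z.1 z.2) - psi z| <= err)}.

(* [phi] is only Lipschitz: it is smoothed into test functions, the derivatives
   of which converge wherever [phi] is differentiable. *)
Lemma dual_estimate :
  `|\int[P]_z (psi z * rho z)| <= err * \int[P]_z `|rho z|.
Proof.
have [chi [chi' [c hk]]] := reproducing_kernel_exists R.
have c0 : 0 <= c by have [_ _ [h _] _ _] := hk; exact: le_trans (normr_ge0 _) (h 0).
(* The second term keeps the support of the smoothed functions away from [T]; the first keeps it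
   within radius [R0 + 2], where [bB] bounds the field. *)
pose d0 := Num.min 1 ((T - s) / 4).
have d0_gt0 : 0 < d0 by rewrite lt_min ltr01 divr_gt0// subr_gt0.
pose d (m : nat) := d0 / m.+1%:R.
have d_gt0 m : 0 < d m by rewrite divr_gt0.
have d_le m : d m <= d0 by rewrite ler_pdivrMr// ler_peMr ?ler1n ?(ltW d0_gt0).
have d_cvg e : 0 < e -> \forall m \near \oo, 2 * d m < e.
  move=> e0; have e1 : 0 < e / (2 * d0) by rewrite divr_gt0// mulr_gt0.
  near=> m; rewrite /d mulrA mulrC -ltr_pdivlMr ?mulr_gt0//.
  by near: m; exact: (near_infty_natSinv_lt (PosNum e1)).
have /choice[M hM] : forall m, exists M : nat,
    Num.max T (R0 + 2 * d m) <= d m * (M%:R - 2).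
  move=> m; set X := Num.max _ _.
  exists (Num.truncn (X / d m + 2)).+1; rewrite mulrC -ler_pdivrMr// lerBrDr.
  by apply/ltW; exact: truncnS_gt.
pose a m (k : {ffun 'I_n.+1 -> 'I_((M m).*2.+1)}) : R := ph (uncons_rV (node (d m) k)).
(* [v1] is the space-time velocity [(1, b)], so that [Dphi m] is the transport derivative of the
   smoothed [phi]. *)
pose v1 (z : S) : 'rV[R]_n.+1 := cons_rV (1, b z.1 z.2).
pose Dphi m (z : S) := \sum_j v1 z 0 j * dqi chi chi' (d m) (a m) j (cons_rV z).
have weakD m : \int[P]_z (Dphi m z * rho z) = 0.
  have tf : test_function T (mollify (chi := chi) phi (d m) (M m)).
    apply: (test_function_mollify hk phi_late phi_far) => //.
    have : d m <= (T - s) / 4 by rewrite (le_trans (d_le m))// ge_min lexx orbT.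
    by move: sT; lra.
  rewrite -[RHS](weak tf); apply: eq_Rintegral => -[t x] _ /=; congr (_ * _).
  rewrite (derive1_mollify hk) (grad_mollify hk) /Dphi big_ord_recl /v1 cons_rV0 mul1r.
  by congr (_ + _); apply: eq_bigr => j _; rewrite cons_rVS mxE.
have mD m : measurable_fun [set: S] (Dphi m).
  apply: measurable_sum => j; apply: measurable_funM.
    case: (unliftP ord0 j) => [i ->|->].
      rewrite (_ : (fun z => _) = (fun x : V => x 0 i) \o (fun z => b z.1 z.2)).
        by apply: measurableT_comp => //; exact: measurable_coord_rV.
      by apply/funext => z; rewrite /v1 cons_rVS.
    rewrite (_ : (fun z => _) = cst 1); first exact: measurable_cst.
    by apply/funext => z; rewrite /v1 cons_rV0.
  apply: (@measurableT_comp _ _ _ _ _ _ _ _ (@cons_rV R n)); last exact: measurable_cons_rV.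
  by apply: measurable_fun_continuous_rV; exact: (continuous_dqi hk).
pose KL := 2 * Lam * (5 * c) ^+ n.+1.
have c5 : 0 <= (5 * c) ^+ n.+1 by rewrite exprn_ge0// mulr_ge0.
have KL0 : 0 <= KL by rewrite mulr_ge0// mulr_ge0.
have v1B z j : `|z.2| <= R0 + 2 -> `|v1 z 0 j| <= Num.max 1 B.
  move=> zR; rewrite /v1; case: (unliftP ord0 j) => [i ->|->].
    by rewrite cons_rVS /= (le_trans (coord_le_norm _ _))// le_max bB// orbT.
  by rewrite cons_rV0 /= normr1 le_max lexx.
have d2 m : 2 * d m <= 2.
  have : d m <= 1 by rewrite (le_trans (d_le m))// ge_min lexx.
  by lra.
have D_far m z : R0 + 2 * d m <= `|z.2| -> Dphi m z = 0.
  move: z => [t x] /= xR; apply: big1 => j _.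
  by rewrite (mollify_d_out hk phi_late phi_far) ?mulr0//; right.
have D_sum m z (e : R) (w : 'I_n.+1 -> R) : 0 <= e -> `|z.2| <= R0 + 2 ->
    (forall j, `|dqi chi chi' (d m) (a m) j (cons_rV z) - w j| <= e) ->
    `|Dphi m z - \sum_j v1 z 0 j * w j| <= n.+1%:R * (Num.max 1 B * e).
  move=> e0 zR H; rewrite -sumrB; apply: le_trans (ler_norm_sum _ _ _) _.
  rewrite mulr_natl -[n.+1 in leRHS]card_ord -sumr_const.
  apply: ler_sum => j _; rewrite -mulrBr normrM.
  by apply: ler_pM => //; exact: v1B.
have Dbnd m z : 0 <= z.1 <= T -> `|Dphi m z| <= n.+1%:R * (Num.max 1 B * KL).
  move=> zT; have [zR|zR] := leP (R0 + 2 * d m) `|z.2|.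
    by rewrite D_far// normr0 mulr_ge0// mulr_ge0// le_max ler01.
  have := @D_sum m z KL (fun=> 0) KL0.
  rewrite big1 ?subr0; last by move=> j _; rewrite mulr0.
  apply; first by apply: le_trans (ltW zR) _; rewrite lerD2l.
  move=> j; rewrite subr0; move: z zT {zR} => [t x] zT.
  exact: (mollify_d_bounded hk Lam0 phi_lip phi_late phi_far).
(* The difference [Dphi m - psi] need not tend to zero, but its excess over [err] does, at almost
   every point where [rho] is nonzero. *)
pose f m (z : S) : R := Num.max (`|Dphi m z - psi z| - err) 0 * `|rho z|.
have f_cvg : {ae P, forall z, [set: S] z ->
    (EFin (f m z)) @[m --> \oo] --> (0%:E : \bar R)}.
  apply: (@filterS _ _ (ae_filter_ringOfSetsType P)) phi_transport => -[t x] H _.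
  apply: cvg_EFin; first by near=> m.
  have [r0|r0] := eqVneq (rho (t, x)) 0.
    rewrite (_ : _ \o _ = cst 0); first exact: cvg_cst.
    by apply/funext => m; rewrite /= /f r0 normr0 mulr0.
  case: H => [/eqP|[dph hpsi]]; first by rewrite (negbTE r0).
  apply/cvgr0Pnorm_le => e e0.
  pose C := n.+1%:R * (Num.max 1 B * (2 * (5 * c) ^+ n.+1)).
  have C0 : 0 <= C by rewrite mulr_ge0// mulr_ge0 ?le_max ?ler01// mulr_ge0.
  (* Chosen so that [C * e1 * |rho (t, x)|] is at most [e], where [C] collects the constants of
     [D_sum] and [mollify_d_near]. *)
  pose e1 := e / ((C + 1) * `|rho (t, x)|).
  have C1 : 0 < C + 1 by rewrite ltr_wpDl.
  have e1_gt0 : 0 < e1 by rewrite divr_gt0// mulr_gt0// normr_gt0.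
  have [eta eta0 etaP] : exists2 eta : R, 0 < eta & forall z : R^o * V, `|z - (t, x)| <= eta ->
      `|ph z - ph (t, x) - 'd ph (t, x) (z - (t, x))| <= e1 * `|z - (t, x)|.
    exact: differentiable_expansion.
  near=> m.
  have dm : 2 * d m <= eta by apply: ltW; near: m; exact: d_cvg.
  rewrite /= ger0_norm; last by rewrite mulr_ge0// le_max lexx orbT.
  have [xR|xR] := leP (R0 + 2 * d m) `|x|.
    have [m0 d0'] : 0 <= d m /\ 0 <= 2 * d m by split; rewrite ?mulr_ge0// ltW.
    rewrite /f D_far// psi_far; last by rewrite (le_trans _ xR)// lerDl.
    by rewrite subr0 normr0 sub0r (max_idPr _) ?mul0r ?(ltW e0)// oppr_le0.
  suff : `|Dphi m (t, x) - psi (t, x)| - err <= C * e1.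
    move=> H; rewrite /f.
    apply: (@le_trans _ _ (C * e1 * `|rho (t, x)|)).
      by rewrite ler_wpM2r// ge_max H mulr_ge0// ltW.
    rewrite (_ : C * e1 * _ = C / (C + 1) * e); last first.
      by rewrite /e1; field; rewrite normr_eq0 r0 gt_eqF.
    by rewrite ger_pMl// ler_pdivrMr// mul1r lerDl.
  rewrite lerBlDl; apply: le_trans (lerD hpsi (_ : `|Dphi m (t, x) - 'd ph (t, x) (1, b t x)| <= _)).
    by rewrite [leRHS]addrC; apply: le_trans (ler_normD _ _); rewrite addrA subrK.
  rewrite (_ : 'd ph (t, x) (1, b t x) =
      \sum_j v1 (t, x) 0 j * 'd ph (t, x) (uncons_rV (delta_mx 0 j))); last first.
    rewrite -[(1, b t x)]cons_rVK -/(v1 (t, x)) {1}(row_sum_delta (v1 (t, x))) !linear_sum.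
    by apply: eq_bigr => j _; rewrite !linearZ.
  have -> : C * e1 = n.+1%:R * (Num.max 1 B * (2 * e1 * (5 * c) ^+ n.+1)).
    by rewrite /C; ring.
  apply: D_sum.
  - by rewrite mulr_ge0// mulr_ge0// ltW.
  - by apply: le_trans (ltW xR) _; rewrite lerD2l.
  - move=> j; apply: (mollify_d_near hk (d_gt0 m) (hM m) _ (rho_T r0) (ltW xR) (ltW e1_gt0)).
    by move=> z /le_trans /(_ dm); exact: etaP.
pose K := n.+1%:R * (Num.max 1 B * KL) + Kpsi.
have fK m z : `|f m z| <= K * `|rho z|.
  rewrite /f normrM normr_id.
  have [->|rz] := eqVneq (rho z) 0; first by rewrite normr0 !mulr0.
  rewrite ler_wpM2r// ger0_norm ?le_max ?lexx ?orbT// ge_max.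
  have H : `|Dphi m z - psi z| <= K.
    by apply: le_trans (ler_normB _ _) _; apply: lerD => //; exact: Dbnd (rho_T rz).
  rewrite (le_trans (normr_ge0 _) H) andbT.
  by rewrite lerBlDr (le_trans H)// lerDl.
have ir := integrable_normr irho.
have iKr : P.-integrable setT (EFin \o (fun z => K * `|rho z|)) by exact: integrable_scale.
have mrho : measurable_fun setT rho.
  by have /integrableP[/measurable_EFinP] := irho.
have mf m : measurable_fun setT (f m).
  apply: measurable_funM; last exact: measurableT_comp.
  apply: measurable_maxr; last exact: measurable_cst.
  apply: measurable_funB; last exact: measurable_cst.
  by apply: measurableT_comp => //; exact: measurable_funB.
have if_ m : P.-integrable setT (EFin \o f m).
  apply: le_integrable iKr => //; first exact/measurable_EFinP.
  by move=> z _; rewrite /= lee_fin (le_trans (fK m z))// ler_norm.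
have int_f e : 0 < e -> exists m, \int[P]_z f m z <= e.
  move=> e0.
  have [|||_ _ H] := @dominated_convergence _ _ _ P setT measurableT
      (fun m => EFin \o f m) (cst 0%E) (EFin \o (fun z => K * `|rho z|)) _ _ f_cvg iKr.
  - by move=> m; exact/measurable_EFinP.
  - exact: measurable_cst.
  - by apply: aeW => z m _; rewrite /= lee_fin.
  have {}H : (\int[P]_z (f m z)%:E)%E @[m --> \oo] --> 0%E.
    by move: H; rewrite integral0.
  have /fine_cvgP[_ /cvgr0Pnorm_le/(_ _ e0)[m _ /(_ m (leqnn m))]] := H.
  by move=> h; exists m; apply: le_trans h; exact: ler_norm.
apply/ler_addgt0Pr => e /int_f[m fe].
have iD : P.-integrable setT (EFin \o (fun z => Dphi m z * rho z)).
  apply: (@integrable_mul_bounded _ _ _ _ _ _ (n.+1%:R * (Num.max 1 B * KL))) irho => //.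
  by move=> z rz; exact: Dbnd (rho_T rz).
have ipsi : P.-integrable setT (EFin \o (fun z => psi z * rho z)).
  by apply: (@integrable_mul_bounded _ _ _ _ _ _ Kpsi) irho.
have -> : \int[P]_z (psi z * rho z) = \int[P]_z (psi z * rho z - Dphi m z * rho z).
  by rewrite RintegralB// weakD subr0.
have iB : P.-integrable setT (EFin \o (fun z => psi z * rho z - Dphi m z * rho z)).
  exact: integrable_sub.
apply: le_trans (le_normr_Rintegral _ iB) _ => //.
have ier : P.-integrable setT (EFin \o (fun z => err * `|rho z|)).
  exact: integrable_scale.
apply: le_trans (_ : _ <= \int[P]_z (err * `|rho z| + f m z)) _; last first.
  by rewrite RintegralD// RintegralZl// lerD2l.
apply: le_Rintegral => //.
- exact: integrable_normr.
- exact: (integrableD _ ier (if_ m)).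
- move=> z _; rewrite -mulrBl normrM /f -mulrDl ler_wpM2r// distrC.
  by rewrite -lerBlDl le_max lexx.
Unshelve. all: by end_near. Qed.

End limit_of_test_functions.

(** * Approximate solutions of the dual problem *)

Section differential_calculus.
Context {R : realType}.

Lemma is_diff_fst (V W : normedModType R) (z : V * W) : is_diff z fst fst.
Proof.
have c : continuous (fst : V * W -> V) by move=> w; exact: cvg_fst.
apply: DiffDef.
  exact: (@linear_differentiable R (V * W)%type V (fst : {linear (V * W)%type -> V}) z c).
exact: (@diff_lin R (V * W)%type V (fst : {linear (V * W)%type -> V}) z c).
Qed.

Lemma is_diff_snd (V W : normedModType R) (z : V * W) : is_diff z snd snd.
Proof.
have c : continuous (snd : V * W -> W) by move=> w; exact: cvg_snd.
apply: DiffDef.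
  exact: (@linear_differentiable R (V * W)%type W (snd : {linear (V * W)%type -> W}) z c).
exact: (@diff_lin R (V * W)%type W (snd : {linear (V * W)%type -> W}) z c).
Qed.

Lemma lipschitz_of_diff (V : normedModType R) (f : V -> R^o) (G : R) :
  (forall x, differentiable f x) -> (forall x v, `|'d f x v| <= G * `|v|) ->
  forall x y, `|f x - f y| <= G * `|x - y|.
Proof.
move=> df fG x y.
pose l (t : R^o) : V := t *: (x - y) + y.
pose l0 (t : R^o) : V := t *: (x - y).
have ll (h : R) (u v : R^o) : l (h *: v + u) = h *: l0 v + l u.
  by rewrite /l /l0 scalerDl addrA scalerA.
have D t : is_derive (t : R^o) 1 (f \o l : R^o -> R^o) ('d f (l t) (x - y)).
  have [d1 d2] := derive_comp_affine f ll 1 t.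
  apply: DeriveDef; first by apply/d1; exact: diff_derivable.
  by rewrite d2 deriveE// /l0 scale1r.
have [|c _ E] := @MVT_segment R (f \o l) (fun t => 'd f (l t) (x - y)) 0 1 ler01 (fun t _ => D t).
  apply: continuous_subspaceT => t; apply: (@differentiable_continuous _ R^o R^o).
  by apply/derivable1_diffP; have [] := D t.
move: E; rewrite subr0 mulr1 /= /l scale1r subrK scale0r add0r => ->.
exact: fG.
Qed.

Lemma near_eq_is_diff (V W : normedModType R) (f g : V -> W) (x : V) (df : V -> W) :
  (\near x, f x = g x) -> is_diff x f df -> is_diff x g df.
Proof.
move=> fg [fx <-]; have fgx : f x = g x := nbhs_singleton fg.
have /diff_locallyP[cd E] := fx.
have E' : g \o shift x = cst (g x) + 'd f x +o_ (0 : V) id.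
  apply/eqaddoP => e e0; move: E => /eqaddoP/(_ e e0); apply: filter_app.
  move/nbhs_normP : fg => [r /= r0 H]; near=> h; rewrite /= /cst /=.
  rewrite -[X in `|X| <= _ -> _]/(f (h + x) - (f x + 'd f x h)).
  rewrite -[X in _ -> `|X| <= _]/(g (h + x) - (g x + 'd f x h)).
  rewrite -fgx (H (h + x))//= opprD addrCA subrr addr0 normrN.
  by near: h; exact: nbhs0_lt.
have dE := diff_unique cd E'.
have dg : differentiable g x by apply/diff_locallyP; split; rewrite dE.
exact: DiffDef dg dE.
Unshelve. all: by end_near. Qed.

Lemma near_norm_gt (V : normedModType R) (x : V) (c : R) :
  c < `|x| -> \forall y \near x, c < `|y|.
Proof.
move=> cx; apply/nbhs_normP; exists (`|x| - c); first by rewrite /= subr_gt0.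
move=> y /= xy; have := ler_normD (x - y) y; rewrite subrK.
by move: xy; lra.
Qed.

Lemma near_fst_gt (V : normedModType R) (t c : R) (x : V) :
  c < t -> \forall z \near ((t, x) : R^o * V), c < z.1.
Proof.
move=> ct; apply/nbhs_normP; exists (t - c); first by rewrite /= subr_gt0.
move=> z /=; rewrite [X in X < _ -> _]/Num.Def.normr /= gt_max => /andP[+ _].
by rewrite ltr_norml => /andP[_]; rewrite ltrD2l ltrN2.
Qed.

Lemma near_fst_lt (V : normedModType R) (t c : R) (x : V) :
  t < c -> \forall z \near ((t, x) : R^o * V), z.1 < c.
Proof.
move=> ct; apply/nbhs_normP; exists (c - t); first by rewrite /= subr_gt0.
move=> [u y] /=; rewrite [X in X < _ -> _]/Num.Def.normr /= gt_max => /andP[+ _].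
by rewrite distrC => /(le_lt_trans (ler_norm _)); rewrite ltrD2r.
Qed.

Lemma is_diff_comp' (U V W : normedModType R) (f : U -> V) (g : V -> W) (df : U -> V)
    (dg : V -> W) x :
  is_diff x f df -> is_diff (f x) g dg -> is_diff x (fun y => g (f y)) (fun v => dg (df v)).
Proof. by move=> h1 h2; exact: (@is_diff_comp _ _ _ _ f df g dg x h1 h2). Qed.

Lemma is_diff_add (V W : normedModType R) (f g df dg : V -> W) x :
  is_diff x f df -> is_diff x g dg -> is_diff x (fun y => f y + g y) (fun v => df v + dg v).
Proof. by move=> h1 h2; exact: (@is_diffD _ _ _ f g df dg x h1 h2). Qed.

Lemma is_diff_sub (V W : normedModType R) (f g df dg : V -> W) x :
  is_diff x f df -> is_diff x g dg -> is_diff x (fun y => f y - g y) (fun v => df v - dg v).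
Proof. by move=> h1 h2; exact: (@is_diffB _ _ _ f g df dg x h1 h2). Qed.

Lemma is_diff_mul (V : normedModType R) (f g : V -> R^o) (df dg : V -> R^o) x :
  is_diff x f df -> is_diff x g dg ->
  is_diff x (fun y => f y * g y : R^o) (fun v => f x * dg v + g x * df v : R^o).
Proof. by move=> h1 h2; exact: (@is_diffM _ _ f g df dg x h1 h2). Qed.

Lemma is_diff_scale (V : normedModType R) (k : R) (f df : V -> R^o) x :
  is_diff x f df -> is_diff x (fun y => k * f y : R^o) (fun v => k * df v : R^o).
Proof. by move=> h; exact: (@is_diffZ _ _ _ f df k x h). Qed.

End differential_calculus.

Lemma clamp_lip (R : realFieldType) (a b t t' : R) :
  `|Num.min (Num.max t a) b - Num.min (Num.max t' a) b| <= `|t - t'|.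
Proof.
wlog tt : t t' / t' <= t => [H|].
  by have [|/ltW] := leP t' t; [exact: H|move=> h; rewrite distrC (distrC t); exact: H].
rewrite !ger0_norm ?subr_ge0//; last by rewrite le_min2// le_max2.
have X : Num.max t a <= t - t' + Num.max t' a.
  by case: (leP t a) => ?; case: (leP t' a) => ?; lra.
rewrite lerBlDr; case: (leP (Num.max t' a) b) => _.
  by rewrite ge_min X.
by rewrite ge_min orbC -[X in X <= _]add0r lerD2r subr_ge0 tt.
Qed.

Section dual_scheme.
Context {R : realType} {n : nat}.
Let V := 'rV[R]_n.
Variables (beta beps : R -> V -> V) (Z : set R) (psi : V -> R^o) (s h B L G0 Kpsi r R1 : R).
Hypotheses (h0 : 0 < h) (B0 : 0 <= B) (L0 : 0 <= L) (G0_ge0 : 0 <= G0) (Kpsi0 : 0 <= Kpsi).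
Hypothesis beta_time : forall t t' x, `|beta t x - beta t' x| <= B * `|t - t'|.
Hypothesis beta_diff : forall t x, differentiable (beta t) x.
Hypothesis beta_lip : forall t t' x v, `|x| <= R1 ->
  `|'d (beta t) x v - 'd (beta t') x v| <= L * `|t - t'| * `|v|.
Let betah (z : R^o * V) : V := beta z.1 z.2.
Hypothesis beta_dt : forall t x, Z t ->
  differentiable betah (t, x) /\ 'd betah (t, x) (1, 0) = beps t x.
Hypothesis psi_diff : forall x, differentiable psi x.
Hypothesis psi_lip : forall x v, `|'d psi x v| <= G0 * `|v|.
Hypothesis psi_bnd : forall x, `|psi x| <= Kpsi.
Hypothesis psi_far : forall x, r <= `|x| -> psi x = 0.

(** An explicit solution of the inequality [G_step]: an Euler step multiplies the gradient by at
    most [1 + h * L], and the source adds [h * G0]. *)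
Let G N := N%:R * h * G0 * (1 + h * L) ^+ N.

Let hL1 : 1 <= 1 + h * L.
Proof. by rewrite lerDl mulr_ge0// (ltW h0). Qed.

Let G_ge0 N : 0 <= G N.
Proof.
by rewrite /G !mulr_ge0// ?(ltW h0)// exprn_ge0// (le_trans ler01).
Qed.

Let G_step N : G N * (1 + h * L) + h * G0 <= G N.+1.
Proof.
rewrite /G -(addn1 N) natrD exprD expr1.
rewrite (_ : (N%:R + 1) * h * G0 * _ = N%:R * h * G0 * (1 + h * L) ^+ N * (1 + h * L) +
  h * G0 * ((1 + h * L) ^+ N * (1 + h * L))); last by ring.
rewrite lerD2l -[leLHS]mulr1 ler_wpM2l//; first by rewrite mulr_ge0// (ltW h0).
by rewrite -exprSr exprn_ege1.
Qed.

Let G_le N : G N <= G N.+1.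
Proof.
apply: le_trans (G_step N); rewrite -[leLHS]addr0 lerD//; last by rewrite mulr_ge0// (ltW h0).
by rewrite ler_peMr.
Qed.

(* A solution [phi'] on the last [N] steps, which start at time [t1], is extended
   to earlier times [t] by transporting [phi'] along the explicit Euler step
   [x + beta t1 x - beta t x], where [beta] is a primitive in time of the
   regularized field, and subtracting [(t1 - t) * psi x]. *)
Let spec N (phi : R -> V -> R^o) :=
  [/\ exists2 Lam, 0 <= Lam & forall t t' x x',
        `|phi t x - phi t' x'| <= Lam * Num.max `|t - t'| `|x - x'|,
      forall t x, s <= t -> phi t x = 0,
      forall t x, t <= s - N%:R * h -> phi t x = phi (s - N%:R * h) x,
      forall t x, r + N%:R * h * B <= `|x| -> phi t x = 0 &
      (forall t x, differentiable (phi t) x) /\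
      (forall t x v, `|'d (phi t) x v| <= G N * `|v|)].

(** The true field will be substituted for [v]. Besides the regularization error [v - beps t x], the
    term [h * L * |v|] comes from the space derivative of the displacement, and [h * G0 * |v|] from
    the gradient of the source. The ends of the Euler steps are excluded, as the formula for [phi]
    changes there. *)
Let transport N (phi : R -> V -> R^o) := forall t x, Z t -> s - N%:R * h < t < s ->
  (forall k, (k <= N)%N -> t != s - k%:R * h) -> `|x| <= R1 ->
  differentiable (fun z : R^o * V => phi z.1 z.2) (t, x) /\
  forall v, `|'d (fun z : R^o * V => phi z.1 z.2) (t, x) (1, v) - psi x| <=
    G N * (`|v - beps t x| + h * L * `|v|) + h * G0 * `|v|.

Let step_bound N (t : R) (x v : V) (F : V -> R^o) (Fx : V) (c : R) w :
  (forall v, `|'d F Fx v| <= G N * `|v|) -> 0 <= c <= h ->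
  `|w| <= (1 + h * L) * `|v| ->
  `|'d F Fx w - c * 'd psi x v| <= G N.+1 * `|v|.
Proof.
move=> dF /andP[c0 ch] hw; apply: le_trans (ler_normB _ _) _.
apply: le_trans (ler_wpM2r (normr_ge0 v) (G_step N)).
rewrite mulrDl; apply: lerD.
  by rewrite (le_trans (dF _))// -[leRHS]mulrA ler_wpM2l.
rewrite normrM ger0_norm// -mulrA; apply: ler_pM => //; exact: psi_lip.
Qed.

Lemma dual_scheme N : r + N%:R * h * B <= R1 -> exists phi, spec N phi /\ transport N phi.
Proof.
elim: N => [_|N IH rR].
  exists (fun _ _ => 0); split; last by move=> t x _; rewrite mul0r subr0 => /andP[/lt_trans h1 /h1]; rewrite ltxx.
  split => //.
    by exists 0 => // *; rewrite subrr normr0 mul0r.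
  split=> [t x|t x v]; first exact: differentiable_cst.
  by rewrite /G !mul0r (_ : 'd _ _ _ = 0) ?normr0// diff_cst.
have rR' : r + N%:R * h * B <= R1.
  apply: le_trans rR; rewrite lerD2l ler_wpM2r// ler_wpM2r ?(ltW h0)// ler_nat//.
have [phi' [[[Lam' Lam'0 lip'] late' early' far' [dphi' gphi']] tr']] := IH rR'.
set t1 := s - N%:R * h in early' tr' *.
have t1E : s - N.+1%:R * h = t1 - h by rewrite /t1 -(addn1 N) natrD; ring.
(* Clamping the time to the current step lets one formula cover all times: from [t1] on the
   displacement and the source vanish and [phi] is [phi'], while before [t1 - h] the function is
   frozen. *)
pose cl (t : R) : R := Num.min (Num.max t (t1 - h)) t1.
have cl1 t : 0 <= t1 - cl t <= h.
  rewrite subr_ge0 ge_min lexx orbT /= lerBlDl -lerBlDr le_min.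
  by rewrite le_max lexx orbT /= gerBl (ltW h0).
have cl_lip t t' : `|cl t - cl t'| <= `|t - t'|.
  exact: clamp_lip.
pose Y t x : V := x + (beta t1 x - beta (cl t) x).
pose phi t x : R^o := phi' t (Y t x) - (t1 - cl t) * psi x.
have Yx t x : `|x| - h * B <= `|Y t x|.
  rewrite lerBlDr; have := ler_normD (Y t x) (- (beta t1 x - beta (cl t) x)).
  rewrite {1}/Y addrK normrN => /le_trans; apply; rewrite lerD2l.
  apply: le_trans (beta_time _ _ _) _; rewrite mulrC ler_wpM2r//.
  by have /andP[c1 c2] := cl1 t; rewrite ger0_norm.
have far t x : r + N.+1%:R * h * B <= `|x| -> phi t x = 0.
  move=> rx.
  have NB : N.+1%:R * h * B = N%:R * h * B + h * B by rewrite -(addn1 N) natrD; ring.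
  have hB : 0 <= h * B by rewrite mulr_ge0// (ltW h0).
  have NhB : 0 <= N%:R * h * B by rewrite !mulr_ge0// (ltW h0).
  rewrite /phi far' ?psi_far ?mulr0 ?subr0//; first by lra.
  by have := Yx t x; lra.
have dY t x : is_diff x (Y t) (fun v => v + ('d (beta t1) x v - 'd (beta (cl t)) x v)).
  apply: (is_diff_add (f := id) (df := id) (is_diff_id x)).
  exact: (is_diff_sub (differentiableP (beta_diff t1 x)) (differentiableP (beta_diff (cl t) x))).
have dphi t x : is_diff x (phi t) (fun v => 'd (phi' t) (Y t x)
    (v + ('d (beta t1) x v - 'd (beta (cl t)) x v)) - (t1 - cl t) * 'd psi x v).
  apply: (is_diff_sub (is_diff_comp' (dY t x) (differentiableP (dphi' t (Y t x))))).
  exact: (is_diff_scale (t1 - cl t) (differentiableP (psi_diff x))).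
have w_bound c x v : 0 <= t1 - c <= h -> `|x| <= R1 ->
    `|v + ('d (beta t1) x v - 'd (beta c) x v)| <= (1 + h * L) * `|v|.
  move=> /andP[c0 ch] xR; rewrite mulrDl mul1r; apply: le_trans (ler_normD _ _) _.
  rewrite lerD2l; apply: le_trans (beta_lip _ _ _ xR) _.
  by rewrite ler_wpM2r// [h * L]mulrC ler_wpM2l// ger0_norm.
have gphi t x v : `|'d (phi t) x v| <= G N.+1 * `|v|.
  (* The space derivative of [beta] is controlled only within radius [R1]; beyond it [phi] vanishes
     in a neighbourhood. *)
  have [xR|xR] := leP `|x| R1; last first.
    have : is_diff x (phi t) (0 : V -> R^o).
      apply: (@near_eq_is_diff _ _ _ (cst 0)).
      near=> y; rewrite far//; apply: (le_trans rR); apply: ltW; near: y.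
      exact: (near_norm_gt xR).
    by move=> [_ ->]; rewrite -[(0 : V -> R^o) v]/(0 : R^o) normr0 mulr_ge0.
  have [_ ->] := dphi t x; apply: step_bound => //.
  exact: w_bound.
exists phi; split; first split.
(* The increment in space costs [G N.+1] by the mean value inequality. In time, [phi'] varies
   through its first argument and through [Y], which has speed at most [B], and the source
   contributes [Kpsi]. *)
- exists (G N.+1 + (Lam' * (1 + B) + Kpsi)).
    by rewrite addr_ge0// addr_ge0// mulr_ge0// addr_ge0.
  move=> t t' x x'.
  have -> : phi t x - phi t' x' = (phi t x - phi t x') + (phi t x' - phi t' x').
    by rewrite addrA subrK.
  apply: le_trans (ler_normD _ _) _; rewrite mulrDl; apply: lerD.
    apply: le_trans (lipschitz_of_diff _ (gphi t) x x') _.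
      by move=> y; have [] := dphi t y.
    by rewrite ler_wpM2l// le_max lexx orbT.
  apply: (@le_trans _ _ ((Lam' * (1 + B) + Kpsi) * `|t - t'|)); last first.
    rewrite ler_wpM2l ?le_max ?lexx//.
    by rewrite addr_ge0// mulr_ge0// addr_ge0.
  have -> : phi t x' - phi t' x' = (phi' t (Y t x') - phi' t' (Y t' x')) + (cl t - cl t') * psi x'.
    by rewrite /phi; ring.
  apply: le_trans (ler_normD _ _) _; rewrite [leRHS]mulrDl; apply: lerD.
    apply: le_trans (lip' _ _ _ _) _; rewrite -mulrA ler_wpM2l// ge_max.
    rewrite mulrDl mul1r lerDl mulr_ge0//= /Y opprD addrACA subrr add0r.
    rewrite opprB addrC addrA subrK.
    apply: le_trans (beta_time _ _ _) _.
    by rewrite (le_trans (ler_wpM2l B0 (cl_lip _ _)))// distrC lerDr.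
  by rewrite normrM mulrC; apply: ler_pM.
- move=> t x st; have tt1 : t1 <= t by rewrite (le_trans _ st)// gerBl mulr_ge0// (ltW h0).
  by rewrite /phi /Y /cl min_r ?le_max ?tt1// subrr addr0 late'// subrr mul0r subr0.
- move=> t x; rewrite t1E => tt.
  have t1h : t1 - h <= t1 by rewrite gerBl (ltW h0).
  rewrite /phi /Y /cl (max_r tt) (max_r (lexx _)) early' ?(le_trans tt)//.
  by rewrite [in RHS]early'.
- exact: far.
- by split => // t x; have [] := dphi t x.
move=> t x Zt; rewrite t1E => /andP[t_gt t_lt] tk xR.
have near_gt c : c < t -> \forall z \near ((t, x) : R^o * V), c < z.1.
  exact: near_fst_gt.
have near_lt c : t < c -> \forall z \near ((t, x) : R^o * V), z.1 < c.
  exact: near_fst_lt.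
have [t1t|tt1|/eqP tt1] := ltgtP t1 t; last first.
- by have := tk N (leqnSn N); rewrite -/t1 eq_sym tt1.
(* Within the current step [phi'] is frozen at its value at [t1], so that time enters only through
   the displacement and the source; the joint differentiability of [betah] then suffices. *)
- pose F (z : R^o * V) : R^o :=
    phi' t1 (z.2 + (beta t1 z.2 - betah z)) - (t1 - z.1) * psi z.2.
  have nF : \forall z \near ((t, x) : R^o * V), F z = phi z.1 z.2.
    near=> z.
    have z1 : z.1 < t1 by near: z; exact: near_lt.
    have z2 : t1 - h < z.1 by near: z; exact: near_gt.
    by rewrite /F /phi /Y /cl (max_l (ltW z2)) (min_l (ltW z1)) [in RHS]early' ?(ltW z1).
  have [dbetah betah1] := beta_dt x Zt.
  have dsnd := is_diff_snd ((t, x) : R^o * V).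
  have dfst := is_diff_fst ((t, x) : R^o * V).
  have dF : is_diff ((t, x) : R^o * V) F (fun w => 'd (phi' t1) (x + (beta t1 x - beta t x))
      (w.2 + ('d (beta t1) x w.2 - 'd betah (t, x) w)) -
      ((t1 - t) * 'd psi x w.2 + psi x * (0 - w.1))).
    apply: is_diff_sub.
      apply: (is_diff_comp' (f := fun z : R^o * V => z.2 + (beta t1 z.2 - betah z))
         (df := fun w => w.2 + ('d (beta t1) x w.2 - 'd betah (t, x) w))
         _ (differentiableP (dphi' t1 _))).
      apply: (is_diff_add dsnd); apply: is_diff_sub (differentiableP dbetah).
      exact: (is_diff_comp' dsnd (differentiableP (beta_diff t1 x))).
    apply: (@is_diff_mul _ _ (fun z => t1 - z.1) (fun z => psi z.2)
      (fun w => 0 - w.1) (fun w => 'd psi x w.2)).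
    exact: (is_diff_comp' dsnd (differentiableP (psi_diff x))).
  have [dphit ->] := near_eq_is_diff nF dF.
  split => // v /=.
  have dbt : 'd betah (t, x) (0, v) = 'd (beta t) x v.
    have dp : is_diff x (fun y : V => (t, y) : R^o * V) (fun w => (0, w)).
      exact: (@is_diff_pair R V R^o V (cst (t : R^o)) (0 : V -> R^o) id id x
        (is_diff_cst _ _) (is_diff_id _)).
    have dp' : is_diff ((t, x) : R^o * V) betah ('d betah (t, x)) by exact: differentiableP.
    by have [_ E] := is_diff_comp' dp dp'; rewrite -[RHS]/('d (fun y : V => betah (t, y)) x v) E.
  have -> : 'd betah (t, x) (1, v) = beps t x + 'd (beta t) x v.
    rewrite -betah1 -dbt -linearD; congr ('d _ _ _).
    by congr pair; rewrite /= ?addr0 ?add0r.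
  set w := v + _.
  (* The time derivative of the source term is exactly [psi x]. *)
  have -> : 'd (phi' t1) (x + (beta t1 x - beta t x)) w -
      ((t1 - t) * 'd psi x v + psi x * (0 - 1)) - psi x =
      'd (phi' t1) (x + (beta t1 x - beta t x)) w - (t1 - t) * 'd psi x v by ring.
  have th : 0 <= t1 - t <= h by rewrite subr_ge0 (ltW tt1) /= lerBlDr -lerBlDl ltW.
  apply: le_trans (ler_normB _ _) _; apply: lerD.
    apply: le_trans (gphi' _ _ _) _; apply: ler_pM => //.
    (* The time derivative of the displacement is [- beps t x]: it compensates the motion [v] up to
       the regularization error and a variation of the space derivative of [beta] over the step. *)
    have -> : w = (v - beps t x) + ('d (beta t1) x v - 'd (beta t) x v).
      by rewrite /w opprD; rewrite !addrA; congr (_ + _); rewrite addrAC.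
    apply: le_trans (ler_normD _ _) _; rewrite lerD2l.
    apply: le_trans (beta_lip _ _ _ xR) _; case/andP: th => th1 th2.
    by rewrite ler_wpM2r// [h * L]mulrC ler_wpM2l// ger0_norm.
  by case/andP: th => th1 th2; rewrite normrM ger0_norm// -mulrA ler_pM.
- have nF : \forall z \near ((t, x) : R^o * V), phi' z.1 z.2 = phi z.1 z.2.
    near=> z.
    have z1 : t1 < z.1 by near: z; exact: near_gt.
    rewrite /phi /Y /cl min_r ?le_max ?(ltW z1)//.
    by rewrite subrr addr0 subrr mul0r subr0.
  have tt : t1 < t < s by rewrite t1t.
  have [dF bF] := tr' t x Zt tt (fun k kN => tk k (leqW kN)) xR.
  have [dphit E] := near_eq_is_diff nF (differentiableP dF).
  split => // v; rewrite E; apply: le_trans (bF v) _.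
  by rewrite lerD2r ler_wpM2r// addr_ge0// !mulr_ge0// (ltW h0).
Unshelve. all: by end_near. Qed.

End dual_scheme.

Lemma is_diff_bigsum {R : realType} {V W : normedModType R} (I : Type) (r : seq I)
    (F dF : I -> V -> W) (x : V) :
  (forall i, is_diff x (F i) (dF i)) ->
  is_diff x (fun y => \sum_(i <- r) F i y) (fun v => \sum_(i <- r) dF i v).
Proof.
move=> hF; elim: r => [|i r IH].
  have -> : (fun y => \sum_(i <- [::]) F i y) = cst 0 by apply/funext => y; rewrite big_nil.
  have -> : (fun y => \sum_(i <- [::]) dF i y) = 0 by apply/funext => y; rewrite big_nil.
  exact: is_diff_cst.
have E (H : I -> V -> W) : (fun y => \sum_(j <- i :: r) H j y) =
    fun y => H i y + \sum_(j <- r) H j y by apply/funext => y; rewrite big_cons.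
by rewrite !E; exact: is_diff_add.
Qed.

Lemma ae_forall_count d (S : measurableType d) (R : realType)
    (mu : {measure set S -> \bar R}) (I : countType) (P : I -> S -> Prop) :
  (forall i, {ae mu, forall t, P i t}) -> {ae mu, forall t, forall i, P i t}.
Proof.
move=> H.
have H' m : {ae mu, forall t, if @unpickle I m is Some i then P i t else True}.
  by case: unpickle => [i|]; [exact: H|exact: aeW].
have := ae_foralln H'; apply: (@filterS _ _ (ae_filter_ringOfSetsType mu)) => t h i.
by have := h (pickle i); rewrite pickleK.
Qed.

(** * Primitives in time and the regularized field *)

Section primitive.
Context {R : realType}.
Let mu := @lebesgue_measure R.
Variable T : R.

Lemma lebesgue_measure_itv_lty b1 b2 (x y : R) :
  (mu [set` Interval (BSide b1 x) (BSide b2 y)] < +oo)%E.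
Proof.
apply: (le_lt_trans (_ : _ <= mu `[x, y])%E).
  apply: le_measure; rewrite ?inE//.
  by move=> t /=; rewrite !in_itv /=; case: b1 b2 => -[] /andP[] /= h1 h2; rewrite ?(ltW h1) ?(ltW h2) ?h1 ?h2.
have E : mu `[x, y] = _ := lebesgue_measure_itv `[x, y].
by rewrite E /=; case: ifP => _; rewrite ?ltry// ltNye.
Qed.

Definition primitive (f : R -> R) (t : R) : R := \int[mu]_(s in `]-oo, t]) f s.

Lemma integrable_bounded_itv (f : R -> R) K : measurable_fun setT f ->
  (forall t, `|f t| <= K) -> (forall t, t \notin `[0, T] -> f t = 0) ->
  mu.-integrable setT (EFin \o f).
Proof.
move=> mf fK f0.
have : mu.-integrable `[0, T] (EFin \o f).
  apply: measurable_bounded_integrable => //.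
  - exact: lebesgue_measure_itv_lty.
  - exact: measurable_funTS.
  - exists K; split; first exact: num_real.
    by move=> x Kx y _ /=; exact: le_trans (fK y) (ltW Kx).
rewrite integrable_mkcond//; congr (_.-integrable _ _).
apply/funext => t; rewrite patchE; case: ifPn => // tT.
rewrite /= f0//; move: tT; rewrite notin_setE /=; exact: contra_notN.
Qed.

(** Comparing two integrands serves twice: with [g = 0] it bounds the variation in time of one
    primitive, and with the field at two points it turns the modulus in space into a bound on the
    mixed increment. *)
Lemma primitive_lip (f g : R -> R) K w t t' : measurable_fun setT f -> measurable_fun setT g ->
  (forall t, `|f t| <= K) -> (forall t, t \notin `[0, T] -> f t = 0) ->
  (forall t, `|g t| <= K) -> (forall t, t \notin `[0, T] -> g t = 0) ->
  (forall t, `|f t - g t| <= w) ->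
  `|primitive f t - primitive f t' - (primitive g t - primitive g t')| <= w * `|t - t'|.
Proof.
move=> mf mg fK f0 gK g0 fgw.
have jf := integrable_bounded_itv mf fK f0.
have jg := integrable_bounded_itv mg gK g0.
wlog tt : t t' / t' <= t => [H|].
  have [|/ltW tt] := leP t' t; first exact: H.
  have := H _ _ tt; rewrite (distrC t').
  by apply: le_trans; rewrite -[leLHS]normrN le_eqVlt; apply/orP; left; apply/eqP; congr (`|_|); ring.
have E h : mu.-integrable setT (EFin \o h) ->
    primitive h t - primitive h t' = \int[mu]_(s in `]t', t]) h s.
  move=> ih; apply: Rintegral_itvB; [exact: integrableS ih| by [] | by rewrite bnd_simp].
rewrite !E// -RintegralB//; [|exact: integrableS jf|exact: integrableS jg].
have iD : mu.-integrable `]t', t] (EFin \o (fun s => f s - g s)).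
  by apply: (@integrableS _ _ _ _ setT) => //; exact: (integrableB measurableT jf jg).
apply: le_trans (le_normr_Rintegral _ iD) _ => //.
apply: (@le_trans _ _ (\int[mu]_(s in `]t', t]) (cst w s))).
  apply: le_Rintegral => //.
  - exact: (integrable_abse iD).
  - apply: measurable_bounded_integrable => //.
    + exact: lebesgue_measure_itv_lty.
    + by exists `|w|; split => // x wx y _ /=; exact: ltW.
rewrite Rintegral_cst//; set m := (X in fine X); have -> : m = (t - t')%:E.
  apply: etrans (lebesgue_measure_itv `]t', t]) _; rewrite /= lte_fin.
  case: ltP => [_|t't]; first by rewrite EFinB.
  by rewrite (le_anti (introT andP (conj tt t't))) subrr.
by rewrite /= ger0_norm ?subr_ge0.
Qed.

Lemma primitive_derive (f : R -> R) K : measurable_fun setT f ->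
  (forall t, `|f t| <= K) -> (forall t, t \notin `[0, T] -> f t = 0) ->
  {ae mu, forall t, is_derive (t : R) 1 (primitive f) (f t)}.
Proof.
move=> mf fK f0; have jf := integrable_bounded_itv mf fK f0.
have : {ae mu, forall x, derivable (primitive f) x 1 /\ derive1 (primitive f) x = f x}.
  apply: FTC1Ny; first by move=> y; exact: integrableS jf.
  by apply: open_integrable_locally => //; exact: openT.
apply: (@filterS _ _ (ae_filter_ringOfSetsType mu)) => t [d1 d2].
have d3 : 'D_1 (primitive f) t = f t by rewrite -derive1E.
exact: DeriveDef d1 d3.
Qed.

End primitive.

Section time_primitive_field.
Context {R : realType} {n : nat} {chi chi' : R^o -> R^o} {c : R}.
Let V := 'rV[R]_n.
Hypothesis hk : reproducing_kernel chi chi' c.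
Variables (T C1 w : R) (b : R -> V -> V).
Hypothesis mb : measurable_fun [set: measurableTypeR R * V] (fun z => b z.1 z.2).
Hypothesis b_out : forall t x, t \notin `[0, T] -> b t x = 0.
Hypothesis C1_ge0 : 0 <= C1.
Hypothesis b_growth : forall t x, `|b t x| <= C1 * (1 + `|x|).
Variables (eps R1 : R) (M : nat).
Hypothesis eps0 : 0 < eps.
Hypothesis w0 : 0 <= w.
Hypothesis b_mod : forall t x y, `|x - y| <= 2 * eps -> `|b t x - b t y| <= w.
Hypothesis cov : R1 <= eps * (M%:R - 2).

Let b_at (x : V) (j : 'I_n) (t : R) : R := b t x 0 j.

(** The time primitive of [regularized_field], with the integral moved inside the finite sum. Only
    the scalar primitives at the nodes occur, so that one null set of times serves for all [x]. *)
Definition field_primitive (t : R) (x : V) : V :=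
  \sum_j qi chi eps (fun k : {ffun 'I_n -> 'I_(M.*2.+1)} =>
    primitive (b_at (node eps k) j) t) x *: delta_mx 0 j.

Definition regularized_field (t : R) (x : V) : V :=
  \sum_j qi chi eps (fun k : {ffun 'I_n -> 'I_(M.*2.+1)} =>
    b t (node eps k) 0 j) x *: delta_mx 0 j.

Definition primitive_diff_time (t : R) := forall (k : {ffun 'I_n -> 'I_(M.*2.+1)}) (j : 'I_n),
  is_derive (t : R) 1 (primitive (b_at (node eps k) j)) (b t (node eps k) 0 j).

Let Kn := (5 * c) ^+ n.

Let Kn0 : 0 <= Kn.
Proof.
have [_ _ [h _] _ _] := hk.
by rewrite exprn_ge0// mulr_ge0// (le_trans (normr_ge0 _) (h 0)).
Qed.

Let sum_delta_coord (F : 'I_n -> R) j : (\sum_i F i *: delta_mx 0 i : V) 0 j = F j.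
Proof.
have -> : \sum_i F i *: delta_mx 0 i = \row_i F i :> V.
  by rewrite [RHS]row_sum_delta; apply: eq_bigr => i _; rewrite mxE.
by rewrite mxE.
Qed.

Let m_at x j : measurable_fun [set: R] (b_at x j).
Proof.
rewrite (_ : b_at x j = (fun y : V => y 0 j) \o ((fun z => b z.1 z.2) \o (fun t => (t, x)))) //.
apply: measurableT_comp; first exact: measurable_coord_rV.
by apply: measurableT_comp => //; exact: measurable_fun_pair.
Qed.

Let b_at_le x j t : `|b_at x j t| <= C1 * (1 + `|x|).
Proof. by rewrite (le_trans (coord_le_norm _ _)). Qed.

Let b_at_out x j t : t \notin `[0, T] -> b_at x j t = 0.
Proof. by move=> tT; rewrite /b_at b_out// mxE. Qed.

Let prim_lip x y j t t' u : (forall t, `|b_at x j t - b_at y j t| <= u) ->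
  `|primitive (b_at x j) t - primitive (b_at x j) t' -
    (primitive (b_at y j) t - primitive (b_at y j) t')| <= u * `|t - t'|.
Proof.
pose K := C1 * (1 + Num.max `|x| `|y|).
apply: (@primitive_lip _ T _ _ K) => //.
- by move=> s; apply: le_trans (b_at_le _ _ _) _; rewrite ler_wpM2l// lerD2l le_max lexx.
- exact: b_at_out.
- by move=> s; apply: le_trans (b_at_le _ _ _) _; rewrite ler_wpM2l// lerD2l le_max lexx orbT.
- exact: b_at_out.
Qed.

Let prim_lip0 x j t t' :
  `|primitive (b_at x j) t - primitive (b_at x j) t'| <= C1 * (1 + `|x|) * `|t - t'|.
Proof.
have p0 s : primitive (fun _ : R => 0) s = 0 by rewrite /primitive /Rintegral integral0.
pose K := C1 * (1 + `|x|).
have := @primitive_lip R T (b_at x j) (fun=> 0) K K t t'.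
rewrite !p0 subrr subr0; apply => //.
- exact: b_at_out.
- by move=> s; rewrite normr0 mulr_ge0// addr_ge0.
- by move=> s; rewrite subr0.
Qed.

Let norm_node (k : {ffun 'I_n -> 'I_(M.*2.+1)}) : `|node eps k : V| <= eps * M%:R.
Proof.
apply: norm_rV_le => [|i]; first by rewrite mulr_ge0// ltW.
rewrite mxE normrM (gtr0_norm eps0) ler_wpM2l// ?(ltW eps0)//.
rewrite ler_norml lerBrDr addrC subrr ler0n /= lerBlDr -natrD ler_nat addnn.
by rewrite -ltnS ltn_ord.
Qed.

Lemma field_primitive_time t t' x : `|field_primitive t x - field_primitive t' x| <=
  C1 * (1 + eps * M%:R) * Kn * `|t - t'|.
Proof.
have C0 : 0 <= C1 * (1 + eps * M%:R).
  by rewrite mulr_ge0// addr_ge0// mulr_ge0// ltW.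
apply: norm_rV_le => [|j]; first by rewrite mulr_ge0// mulr_ge0.
rewrite !mxE !sum_delta_coord /qi -sumrB.
under eq_bigr do rewrite -mulrBl.
apply: le_trans (ler_norm_sum _ _ _) _.
apply: (@le_trans _ _ (\sum_k (C1 * (1 + eps * M%:R) * `|t - t'|) * `|weight chi eps (M := M) k x|)).
  apply: ler_sum => k _; rewrite normrM ler_wpM2r//.
  apply: le_trans (prim_lip0 _ _ _ _) _; rewrite ler_wpM2r// ler_wpM2l// lerD2l.
  exact: norm_node.
rewrite -mulr_sumr [leRHS]mulrAC ler_wpM2l//; first by rewrite mulr_ge0.
exact: (sum_norm_weight hk).
Qed.

Let dqi_vec (a : 'I_n -> {ffun 'I_n -> 'I_(M.*2.+1)} -> R) x :
  is_diff x (fun y : V => \sum_j qi chi eps (a j) y *: delta_mx 0 j : V)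
    (fun v => \sum_j (\sum_i v 0 i * dqi chi chi' eps (a j) i x) *: delta_mx 0 j).
Proof.
apply: is_diff_bigsum => j.
have dq := differentiable_qi hk eps (a j) x.
apply: DiffDef; first exact: differentiableZl.
rewrite diffZl//; apply/funext => v; congr (_ *: _).
exact: (diff_qiE hk).
Qed.

Lemma field_primitive_diff t x : differentiable (field_primitive t) x.
Proof.
by have [] := dqi_vec (fun j k => primitive (b_at (node eps k) j) t) x.
Qed.

Let field_primitive_dE t x v : 'd (field_primitive t) x v =
  \sum_j (\sum_i v 0 i * dqi chi chi' eps (fun k : {ffun 'I_n -> 'I_(M.*2.+1)} =>
    primitive (b_at (node eps k) j) t) i x) *: delta_mx 0 j.
Proof.
rewrite /field_primitive.
have [_ E] := dqi_vec (fun j k => primitive (b_at (node eps k) j) t) x.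
exact: (congr1 (fun f => f v) E).
Qed.

Let covered (x : V) : `|x| <= R1 -> forall i, `|x 0 i| <= eps * (M%:R - 2).
Proof. by move=> xR i; rewrite (le_trans (coord_le_norm _ _))// (le_trans xR). Qed.

(** The increments of the primitives between [t'] and [t] differ by at most [w * |t - t'|] at points
    within [2 * eps] of each other; differentiating the weights divides by [eps]. With a
    log-Lipschitz modulus, [w / eps] is only logarithmic in [eps]. *)
Lemma field_primitive_lip t t' (x v : V) : `|x| <= R1 ->
  `|'d (field_primitive t) x v - 'd (field_primitive t') x v| <=
    n%:R * (w / eps * Kn) * `|t - t'| * `|v|.
Proof.
move=> xR.
rewrite [X in `|X - _|]field_primitive_dE [X in `|_ - X|]field_primitive_dE.
have we : 0 <= w / eps * Kn by rewrite mulr_ge0// divr_ge0// ltW.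
apply: norm_rV_le => [|j]; first by rewrite mulr_ge0// mulr_ge0// mulr_ge0.
rewrite !mxE !sum_delta_coord -sumrB.
apply: le_trans (ler_norm_sum _ _ _) _.
apply: (@le_trans _ _ (\sum_(i < n) (w / eps * Kn * `|t - t'|) * `|v|)); last first.
  rewrite sumr_const card_ord -[leLHS]mulr_natl le_eqVlt; apply/orP; left.
  by apply/eqP; ring.
apply: ler_sum => i _; rewrite -mulrBr normrM mulrC.
apply: ler_pM => //; last exact: coord_le_norm.
rewrite /dqi -sumrB; under eq_bigr do rewrite -mulrBl.
pose a (k : {ffun 'I_n -> 'I_(M.*2.+1)}) := primitive (b_at (node eps k) j) t - primitive (b_at (node eps k) j) t'.
rewrite -[X in `|X|](subr0 (dqi chi chi' eps a i x)).
have zE : (0 : V) 0 i = 0 by rewrite mxE.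
rewrite -[X in _ - X]zE.
have -> : w / eps * Kn * `|t - t'| = w * `|t - t'| * (eps^-1 * (5 * c) ^+ n).
  by rewrite /Kn; ring.
apply: (dqi_estimate hk eps0 (covered xR)
  (v0 := primitive (b_at x j) t - primitive (b_at x j) t')).
- by rewrite mulr_ge0.
- move=> k xk; rewrite (_ : dot 0 _ = 0) ?subr0; last first.
    by rewrite /dot big1// => l _; rewrite mxE mul0r.
  apply: prim_lip => s; rewrite /b_at.
  have -> : b s (node eps k) 0 j - b s x 0 j = (b s (node eps k) - b s x) 0 j by rewrite !mxE.
  by rewrite (le_trans (coord_le_norm _ _))// b_mod// distrC.
Qed.

Lemma regularized_field_close t (x : V) : `|x| <= R1 ->
  `|b t x - regularized_field t x| <= w * Kn.
Proof.
move=> xR; apply: norm_rV_le => [|j]; first by rewrite mulr_ge0.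
rewrite !mxE sum_delta_coord distrC.
apply: (qi_estimate hk eps0 (covered xR) (g := 0)) => k xk.
rewrite (_ : dot 0 _ = 0) ?subr0; last first.
  by rewrite /dot big1// => l _; rewrite mxE mul0r.
have -> : b t (node eps k) 0 j - b t x 0 j = (b t (node eps k) - b t x) 0 j by rewrite !mxE.
by rewrite (le_trans (coord_le_norm _ _))// b_mod// distrC.
Qed.

(** Each summand is a function of [t] times a function of [x], so differentiability in each variable
    gives joint differentiability. *)
Lemma field_primitive_dt t x : primitive_diff_time t ->
  differentiable (fun z : R^o * V => field_primitive z.1 z.2) (t, x) /\
  'd (fun z : R^o * V => field_primitive z.1 z.2) (t, x) (1, 0) = regularized_field t x.
Proof.
move=> Zt.
suff : is_diff ((t, x) : R^o * V) (fun z : R^o * V => field_primitive z.1 z.2)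
  (fun u => \sum_j (\sum_(k : {ffun 'I_n -> 'I_(M.*2.+1)})
    (primitive (b_at (node eps k) j) t * 'd (weight chi eps k : _ -> R^o) x u.2 +
     weight chi eps k x * (u.1 * b t (node eps k) 0 j))) *: delta_mx 0 j).
  move=> [d1 ->]; split => //; apply: eq_bigr => j _; congr (_ *: _).
  by apply: eq_bigr => k _; rewrite /= linear0 mulr0 add0r mul1r mulrC.
apply: is_diff_bigsum => j.
have [d1 d2] : is_diff ((t, x) : R^o * V) (fun z : R^o * V => qi chi eps (fun k : {ffun 'I_n -> 'I_(M.*2.+1)} =>
    primitive (b_at (node eps k) j) z.1) z.2 : R^o)
  (fun u => \sum_(k : {ffun 'I_n -> 'I_(M.*2.+1)})
    (primitive (b_at (node eps k) j) t * 'd (weight chi eps k : _ -> R^o) x u.2 +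
     weight chi eps k x * (u.1 * b t (node eps k) 0 j)) : R^o).
  apply: is_diff_bigsum => k.
  have dsnd := is_diff_snd ((t, x) : R^o * V).
  have dfst := is_diff_fst ((t, x) : R^o * V).
  have [e1 e2] := Zt k j.
  have dp : is_diff (t : R^o) (primitive (b_at (node eps k) j) : R^o -> R^o)
      (fun u => u * b t (node eps k) 0 j).
    apply: DiffDef; first exact/derivable1_diffP.
    apply/funext => u; rewrite -e2 -deriveE; last exact/derivable1_diffP.
    exact: (derive1_dir u e1).2.
  apply: (is_diff_mul (is_diff_comp' dfst dp) (is_diff_comp' dsnd (differentiableP _))).
  exact: (differentiable_weight hk).
apply: DiffDef; first exact: differentiableZl.
by rewrite diffZl//; apply/funext => u; rewrite d2.
Qed.

Lemma primitive_diff_time_ae : {ae @lebesgue_measure R, forall t, primitive_diff_time t}.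
Proof.
have H (kj : {ffun 'I_n -> 'I_(M.*2.+1)} * 'I_n) : {ae @lebesgue_measure R, forall t,
    is_derive (t : R) 1 (primitive (b_at (node eps kj.1) kj.2)) (b t (node eps kj.1) 0 kj.2)}.
  apply: (@primitive_derive _ T _ (C1 * (1 + `|node eps kj.1 : V|))) => //.
  exact: b_at_out.
have := ae_forall_count H; apply: (@filterS _ _ (ae_filter_ringOfSetsType _)).
by move=> t h k j; exact: (h (k, j)).
Qed.

End time_primitive_field.

(** * Vanishing of integrals over short times *)

Section ae_product.
Context {R : realType} {n : nat}.
Let V := 'rV[R]_n.
Let mu := @lebesgue_measure R.
Let P : {measure set (measurableTypeR R * V) -> \bar R} :=
  (@lebesgue_measure R \x lebesgue_measure_rV n)%E.

Lemma ae_fst (Q : R -> Prop) : {ae mu, forall t, Q t} -> {ae P, forall z, Q z.1}.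
Proof.
move=> [A [mA A0 QA]]; exists (A `*` setT); split.
- exact: measurableX.
- have E : P (A `*` setT) = (mu A * lebesgue_measure_rV n setT)%E.
    exact: product_measure1E.
  by rewrite E A0 mul0e.
- by move=> z /= Qz; split => //; exact: QA.
Qed.

Lemma ae_neq (c : R) : {ae mu, forall t, t != c}.
Proof.
exists [set c]; split; [exact: measurable_set1|exact: lebesgue_measure_set1|].
by move=> t /= /negP; rewrite negbK => /eqP.
Qed.

End ae_product.

Lemma near_snd_norm_gt {R : realType} (U V : normedModType R) (t : U) (x : V) (c : R) :
  c < `|x| -> \forall z \near (t, x), c < `|z.2|.
Proof.
move=> cx; apply/nbhs_normP; exists (`|x| - c); first by rewrite /= subr_gt0.
move=> [u y] /=; rewrite [X in X < _ -> _]/Num.Def.normr /= gt_max => /andP[_ h].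
by have := ler_normD (x - y) y; rewrite subrK; move: h; lra.
Qed.

(* The modulus [e * ln (expR 1 + 1 / e)] of the field times the growth
   [expR (ln (expR 1 + 1 / e) / 2)] of the gradient of the dual solution. *)
Lemma osgood_vanishing {R : realType} (delta : R) : 0 < delta ->
  exists2 e : R, 0 < e <= 1 &
    e * ln (expR 1 + 1 / e) * expR (ln (expR 1 + 1 / e) / 2) <= delta.
Proof.
(* [y] is the intended value of the logarithm, and [e] is solved from it. As [y >= 3] gives
   [expR y - E >= expR y / 2], the left-hand side is at most [2 * y * expR (- y / 2)], hence at most
   [16 / y]. *)
move=> d0; pose y : R := Num.max (16 / delta) 3.
have y3 : 3 <= y by rewrite le_max lexx orbT.
have y0 : 0 < y by rewrite (lt_le_trans _ y3).
have yd : 16 / delta <= y by rewrite le_max lexx.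
pose E : R := expR 1; have E1 : 2 <= E by have := expR_ge1Dx (1 : R); rewrite /E; lra.
have uE : 2 * E <= expR y.
  rewrite -[y](subrK 1) expRD ler_wpM2r ?expR_ge0//.
  by have := expR_ge1Dx (y - 1); lra.
have uE1 : 1 <= expR y - E by lra.
have uE0 : 0 < expR y - E by lra.
exists (expR y - E)^-1.
  by rewrite invr_gt0 uE0 invf_le1.
rewrite div1r invrK addrCA subrr addr0 expRK.
have h2 : 0 < expR (y / 2) by exact: expR_gt0.
have yE : expR y = expR (y / 2) * expR (y / 2) by rewrite -expRD; congr expR; lra.
have hy : y ^+ 2 / 8 <= expR (y / 2).
  have := expR_ge1Dxn 1 (ltW (divr_gt0 y0 (ltr0Sn R 1))).
  rewrite (_ : 2`!%:R = 2) // => h; apply: le_trans h.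
  by rewrite (_ : (y / 2) ^+ 2 / 2 = y ^+ 2 / 8) ?lerDr//; field.
rewrite -mulrA mulrC ler_pdivrMr//.
apply: (@le_trans _ _ (delta * (expR y / 2))); last by rewrite ler_wpM2l ?(ltW d0)//; lra.
rewrite yE [leRHS](_ : _ = expR (y / 2) * (delta * (expR (y / 2) / 2))); last by ring.
rewrite [leLHS]mulrC ler_pM2l//; apply: (@le_trans _ _ (delta * (y ^+ 2 / 8 / 2))); last first.
  by rewrite ler_pM2l// ler_pM2r ?invr_gt0.
rewrite expr2 (_ : delta * _ = y * (delta * y / 16)); last by field.
rewrite ler_peMr// ?(ltW y0)// ler_pdivlMr// mul1r mulrC -ler_pdivrMr//.
Qed.

Lemma le_of_le_add_div {R : realType} (x y D : R) : 0 <= D ->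
  (forall N, (0 < N)%N -> x <= y + D / N%:R) -> x <= y.
Proof.
move=> D0 H; apply/ler_addgt0Pr => e e0.
apply: le_trans (H (Num.truncn (D / e)).+1 isT) _; rewrite lerD2l.
by rewrite ler_pdivrMr ?ltr0n// mulrC -ler_pdivrMr// ltW// truncnS_gt.
Qed.

Section short_time.
Context {R : realType} {n : nat} {chi chi' : R^o -> R^o} {c : R}.
Let V := 'rV[R]_n.
Let S := (measurableTypeR R * V)%type.
Let P : {measure set S -> \bar R} := (@lebesgue_measure R \x lebesgue_measure_rV n)%E.
Hypothesis hk : reproducing_kernel chi chi' c.
Variables (T C1 C2 : R) (b : R -> V -> V) (rho : S -> R).
Hypothesis mb : measurable_fun [set: S] (fun z : S => b z.1 z.2).
Hypothesis b_out : forall t x, t \notin `[0, T] -> b t x = 0.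
Hypothesis C1_ge0 : 0 <= C1.
Hypothesis C2_ge0 : 0 <= C2.
Hypothesis b_growth : forall t x, `|b t x| <= C1 * (1 + `|x|).
Let lg (e : R) := ln (expR 1 + 1 / e) : R.
Hypothesis b_mod : forall e t x y, 0 < e -> `|x - y| <= 2 * e ->
  `|b t x - b t y| <= C2 * (e * lg e).
Hypothesis rho_T : forall z, rho z != 0 -> 0 <= z.1 <= T.
Hypothesis irho : P.-integrable [set: S] (EFin \o rho).
Hypothesis weak : forall u, test_function T u ->
  \int[P]_z ((derive1 (u ^~ z.2) z.1 + dot (b z.1 z.2) (grad (u z.1) z.2)) * rho z) = 0.
Let Kn := (5 * c) ^+ n.
Variables (tau a s : R).
Hypothesis tau1 : tau * (C1 * Kn) <= 4^-1.
Hypothesis tau2 : tau * (n%:R * C2 * Kn) <= 2^-1.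
Hypothesis a_lt_s : a < s.
Hypothesis s_tau : s - a <= tau.
Hypothesis s_lt_T : s < T.
Hypothesis rho_past : {ae P, forall z, z.1 < a -> rho z = 0}.
Variables (psi : V -> R^o) (G0 Kpsi r : R).
Hypotheses (G0_ge0 : 0 <= G0) (Kpsi0 : 0 <= Kpsi) (r0 : 0 <= r).
Hypothesis psi_diff : forall x, differentiable psi x.
Hypothesis psi_lip : forall x v, `|'d psi x v| <= G0 * `|v|.
Hypothesis psi_bnd : forall x, `|psi x| <= Kpsi.
Hypothesis psi_far : forall x, r <= `|x| -> psi x = 0.

Let psia (z : S) : R := (z.1 \in `]a, s[)%:R * psi z.2.

Let lg_ge1 e : 0 < e -> 1 <= lg e.
Proof.
move=> e0; rewrite /lg -[X in X <= _](@expRK R) ler_ln ?posrE ?expR_gt0//.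
  by rewrite lerDl divr_ge0// ltW.
by rewrite addr_gt0 ?expR_gt0// divr_gt0.
Qed.

Let Kn0 : 0 <= Kn.
Proof.
have [_ _ [h _] _ _] := hk.
by rewrite exprn_ge0// mulr_ge0// (le_trans (normr_ge0 _) (h 0)).
Qed.

Let mpsia : measurable_fun [set: S] psia.
Proof.
apply: measurable_funM.
  rewrite (_ : (fun z => _) = (\1_[set` `]a, s[] : R -> R) \o (@fst _ _)).
    by apply: measurableT_comp => //; exact: measurable_indic.
  by apply/funext => z /=; rewrite indicE mem_setE.
apply: (@measurableT_comp _ _ _ _ _ _ (psi : V -> R)) => //.
apply: measurable_fun_continuous_rV => x; exact: differentiable_continuous.
Qed.

(** The estimate before any limit, for mesh [e] and [N] Euler steps: the function given by
    [dual_scheme] is inserted into [dual_estimate]. *)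
Lemma fixed_step_estimate (e : R) (N : nat) (h w L B G : R) :
  0 < e -> e <= 1 -> (0 < N)%N ->
  h = (s - a) / N%:R -> w = C2 * (e * lg e) -> L = n%:R * (w / e * Kn) ->
  B = C1 * (1 + (2 * r + 4)) -> G = (s - a) * G0 * (1 + h * L) ^+ N ->
  `|\int[P]_z (psia z * rho z)| <=
    (G * (w * Kn + h * L * B) + h * G0 * B) * \int[P]_z `|rho z|.
Proof.
move=> e0 e1 N0 hE wE LE BE GE.
have sa : 0 < s - a by rewrite subr_gt0.
have N0' : 0 < N%:R :> R by rewrite ltr0n.
have h0 : 0 < h by rewrite hE divr_gt0.
have Nh : N%:R * h = s - a by rewrite hE mulrCA divff ?mulr1// gt_eqF.
have e_ge0 := ltW e0.
have lg0 : 0 <= lg e := le_trans ler01 (lg_ge1 e0).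
have w0 : 0 <= w by rewrite wE mulr_ge0// mulr_ge0.
have L0 : 0 <= L by rewrite LE mulr_ge0// mulr_ge0// divr_ge0.
(* The grid has to cover radius [R1], so the speed bound [Bb] grows linearly with [R1]. By [tau1]
   the total displacement is at most [(R1 + 4) / 4], and this choice of [R1] absorbs it. *)
pose R1 := 2 * r + 4.
have R10 : 0 <= R1 by rewrite addr_ge0// mulr_ge0.
have B0 : 0 <= B by rewrite BE mulr_ge0// addr_ge0.
(* One unit for the truncation and two for the margin required by [cov]. *)
pose M := (Num.truncn (R1 / e)).+3.
have trunc := truncn_itv (divr_ge0 R10 (ltW e0)).
have MR : M%:R = (Num.truncn (R1 / e))%:R + 3 :> R by rewrite -natrD addn3.
have cov : R1 <= e * (M%:R - 2).
  rewrite mulrC -ler_pdivrMr// MR; case/andP: trunc => _.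
  by rewrite -[in X in _ < X]addn1 natrD; lra.
have eM : e * M%:R <= R1 + 3.
  rewrite MR mulrDr; apply: lerD; last by rewrite ger_pMl//.
  by rewrite mulrC -ler_pdivlMr//; case/andP: trunc.
pose Bb := C1 * (1 + e * M%:R) * Kn.
have Bb0 : 0 <= Bb by rewrite mulr_ge0// mulr_ge0// addr_ge0// mulr_ge0.
have tauB : (s - a) * Bb <= (R1 + 4) / 4.
  rewrite (_ : _ * Bb = (s - a) * (C1 * Kn) * (1 + e * M%:R)); last by rewrite /Bb; ring.
  rewrite [leRHS]mulrC; apply: ler_pM.
  - by rewrite mulr_ge0 ?mulr_ge0// ltW.
  - by rewrite addr_ge0// mulr_ge0.
  - by apply: le_trans tau1; rewrite ler_wpM2r// mulr_ge0.
  - by rewrite addrC; move: eM; lra.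
have rR : r + N%:R * h * Bb <= R1.
  by rewrite Nh; move: tauB r0; rewrite /R1; lra.
have bm t x y : `|x - y| <= 2 * e -> `|b t x - b t y| <= w by rewrite wE; exact: b_mod.
have L0' := L0; rewrite LE in L0'.
have [phi [[[Lam Lam0 lip] late early far [dphi gphi]] tr]] :=
  dual_scheme s h0 Bb0 L0' G0_ge0 Kpsi0
   (fun t t' x => field_primitive_time hk mb b_out C1_ge0 b_growth M e0 t t' x)
   (fun t x => field_primitive_diff hk b e M t x)
   (fun t t' x v xR => field_primitive_lip hk mb b_out C1_ge0 b_growth e0 w0 bm cov t t' v xR)
   (fun t x Zt => field_primitive_dt hk x Zt)
   psi_diff psi_lip psi_bnd psi_far rR.
have NhE : N%:R * h * G0 = (s - a) * G0 by rewrite Nh.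
have saN : s - N%:R * h = a by rewrite Nh; ring.
have Lam_lip : forall t t' x x', `|phi t x - phi t' x'| <= Lam * Num.max `|t - t'| `|x - x'| by [].
have far' t x : R1 <= `|x| -> phi t x = 0 by move=> h1; rewrite far// (le_trans rR).
have bB t x : `|x| <= R1 + 2 -> `|b t x| <= C1 * (1 + (R1 + 2)).
  by move=> xR; rewrite (le_trans (b_growth t x))// ler_wpM2l// lerD2l.
have psia_bnd z : `|psia z| <= Kpsi.
  rewrite /psia normrM; case: (_ \in _); first by rewrite normr1 mul1r.
  by rewrite normr0 mul0r.
have psia_far z : R1 <= `|z.2| -> psia z = 0.
  by move=> h1; rewrite /psia psi_far ?mulr0// (le_trans _ h1)// /R1; move: r0; lra.
have hL0 : 0 <= h * L by rewrite mulr_ge0// (ltW h0).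
have G_ge0 : 0 <= G.
  by rewrite GE mulr_ge0 ?exprn_ge0// ?mulr_ge0 ?(ltW sa)// addr_ge0.
have hG0 : 0 <= h * G0 by rewrite mulr_ge0// (ltW h0).
have err0 : 0 <= G * (w * Kn + h * L * B) + h * G0 * B.
  by rewrite addr_ge0 ?(mulr_ge0 hG0)// mulr_ge0// addr_ge0// mulr_ge0.
apply: (dual_estimate s_lt_T Lam0 err0 Lam_lip late far' mb bB rho_T irho weak mpsia psia_bnd psia_far).
have aeZ := ae_fst (n := n) (primitive_diff_time_ae mb b_out b_growth e M).
have aeN := ae_fst (n := n) (ae_forall_count (fun k : 'I_N.+1 => ae_neq (s - k%:R * h))).
have zero (t : R) (x : V) : (\forall z \near ((t, x) : R^o * V), phi z.1 z.2 = 0) ->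
    psia (t, x) = 0 ->
    differentiable (fun z : R^o * V => phi z.1 z.2 : R^o) (t, x) /\
    `|'d (fun z : R^o * V => phi z.1 z.2 : R^o) (t, x) (1, b t x) - psia (t, x)| <=
    G * (w * Kn + h * L * B) + h * G0 * B.
  move=> n0 ->.
  have : is_diff ((t, x) : R^o * V) (fun z : R^o * V => phi z.1 z.2 : R^o) (0 : R^o * V -> R^o).
    apply: (@near_eq_is_diff _ _ _ (cst 0)).
    by apply: filterS n0 => z ->.
  move=> [d1 ->]; split => //.
  by rewrite -[(0 : R^o * V -> R^o) _]/(0 : R^o) subrr normr0.
apply: (@filterS3 _ _ (ae_filter_ringOfSetsType P) _ _ _ _ _ rho_past aeZ aeN).
move=> [t x] /= past Zt tk.
have [/past|a_le_t] := ltP t a; first by left.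
right.
(* [a] and [s] are themselves ends of Euler steps, of index [N] and 0, and belong to the discarded
   times. *)
have t_a : t != a by have := tk ord_max; rewrite /= saN.
have a_t : a < t by rewrite lt_neqAle eq_sym t_a.
have [ts|st] := ltP t s; last first.
  have t_s : t != s by have := tk ord0; rewrite /= mul0r subr0.
  have s_t : s < t by rewrite lt_neqAle eq_sym t_s.
  apply: zero; first by apply: filterS (near_fst_gt _ s_t) => z /ltW; exact: late.
  by rewrite /psia /= in_itv /= [t < s]ltNge st andbF mul0r.
have psiaE : psia (t, x) = psi x by rewrite /psia /= in_itv /= a_t ts mul1r.
have [xR|xR] := leP `|x| R1; last first.
  apply: zero; last by apply: psia_far; exact: ltW.
  near=> z; apply: far'; apply: ltW; near: z.
  exact: near_snd_norm_gt.
have ats : s - N%:R * h < t < s by rewrite saN a_t.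
have tk' k : (k <= N)%N -> t != s - k%:R * h.
  by move=> kN; have := tk (inord k); rewrite inordK.
have [d1 d2] := tr t x Zt ats tk' xR.
split => //; rewrite psiaE; apply: le_trans (d2 (b t x)) _.
have bxB : `|b t x| <= B by rewrite BE (le_trans (b_growth t x))// ler_wpM2l// lerD2l.
rewrite Nh -LE -GE; apply: lerD; last by rewrite ler_wpM2l.
rewrite ler_wpM2l//; apply: lerD; last by rewrite ler_wpM2l.
exact: (regularized_field_close hk e0 w0 bm cov).
Unshelve. all: by end_near. Qed.

(** The order of the limits matters: [L] blows up as [e] tends to zero, so [N] goes to infinity
    first, at fixed [e], to remove the terms in [h]. *)
Lemma short_time_vanishing : \int[P]_z (psia z * rho z) = 0.
Proof.
apply/eqP; rewrite -normr_le0; set I := `|_|.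
pose Q := \int[P]_z `|rho z|.
have Q0 : 0 <= Q by apply: Rintegral_ge0 => z _; exact: normr_ge0.
have sa : 0 <= s - a by rewrite subr_ge0 ltW.
pose K0 := (s - a) * G0 * C2 * Kn * Q.
have K00 : 0 <= K0 by rewrite /K0 mulr_ge0// mulr_ge0// mulr_ge0// mulr_ge0.
have step e : 0 < e <= 1 -> I <= K0 * (e * lg e * expR (lg e / 2)).
  move=> /andP[e0 e1]; have e_ge0 := ltW e0.
  have lg0 : 0 <= lg e := le_trans ler01 (lg_ge1 e0).
  pose w := C2 * (e * lg e); pose L := n%:R * (w / e * Kn).
  have w0 : 0 <= w by rewrite mulr_ge0// mulr_ge0.
  have L0 : 0 <= L by rewrite mulr_ge0// mulr_ge0// divr_ge0.
  pose B := C1 * (1 + (2 * r + 4)).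
  have B0 : 0 <= B by rewrite mulr_ge0// addr_ge0// addr_ge0// mulr_ge0.
  pose Gb := (s - a) * G0 * expR (lg e / 2).
  have Gb0 : 0 <= Gb by rewrite mulr_ge0 ?expR_ge0// mulr_ge0.
  have LE : L = n%:R * C2 * Kn * lg e by rewrite /L /w; field; rewrite gt_eqF.
  have -> : K0 * (e * lg e * expR (lg e / 2)) = Gb * (w * Kn) * Q.
    by rewrite /K0 /Gb /w; ring.
  apply: (@le_of_le_add_div _ _ _ ((s - a) * (Gb * (L * B) + G0 * B) * Q)).
    by rewrite mulr_ge0// mulr_ge0// addr_ge0// mulr_ge0// mulr_ge0.
  move=> N N0; pose h := (s - a) / N%:R.
  have h0 : 0 <= h by rewrite divr_ge0.
  have hL0 : 0 <= h * L by rewrite mulr_ge0.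
  pose G := (s - a) * G0 * (1 + h * L) ^+ N.
  (* [(1 + h * L) ^+ N] is at most [expR (N * h * L)], and [L] is a multiple of [lg e]; [tau2]
     brings the exponent down to [lg e / 2]. *)
  have GGb : G <= Gb.
    rewrite ler_wpM2l ?mulr_ge0//.
    apply: (@le_trans _ _ (expR (h * L) ^+ N)).
      by apply: lerXn2r; rewrite ?nnegrE ?expR_ge0 ?addr_ge0// expR_ge1Dx.
    rewrite -expRM_natl ler_expR.
    have -> : N%:R * (h * L) = (s - a) * (n%:R * C2 * Kn) * lg e.
      by rewrite LE /h; field; rewrite pnatr_eq0 -lt0n.
    rewrite [leRHS]mulrC ler_wpM2r//; apply: le_trans tau2.
    by rewrite ler_wpM2r// mulr_ge0// mulr_ge0.
  apply: le_trans (fixed_step_estimate e0 e1 N0 erefl erefl erefl erefl erefl) _.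
  rewrite -/w -/L -/h -/G -/B -/Q.
  have -> : Gb * (w * Kn) * Q + (s - a) * (Gb * (L * B) + G0 * B) * Q / N%:R =
     (Gb * (w * Kn + h * L * B) + h * G0 * B) * Q by rewrite /h; ring.
  rewrite ler_wpM2r// lerD2r ler_wpM2r// addr_ge0// mulr_ge0//.
apply/ler_addgt0Pr => d d0; rewrite add0r.
have K1 : 0 < K0 + 1 by rewrite ltr_wpDl.
have [e e01 he] := osgood_vanishing (divr_gt0 d0 K1).
apply: le_trans (step e e01) _.
apply: le_trans (ler_wpM2l K00 he) _.
by rewrite mulrCA ger_pMr// ler_pdivrMr// mul1r lerDl.
Qed.

End short_time.

(** * From integrals to vanishing almost everywhere *)

(** The measurable sets over which [g] integrates to zero form a lambda-system, complements being
    handled by the vanishing total integral. Dynkin's theorem extends the property from [G] to all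
    measurable sets. *)
Lemma ae_eq0_of_pi_system d (S : measurableType d) (R : realType)
    (mu : {measure set S -> \bar R}) (G : set (set S)) (g : S -> R) :
  @measurable _ S = <<s G>> -> setI_closed G ->
  mu.-integrable setT (EFin \o g) ->
  (\int[mu]_z (g z)%:E = 0)%E ->
  (forall A, G A -> (\int[mu]_(z in A) (g z)%:E = 0)%E) ->
  {ae mu, forall z, g z = 0}.
Proof.
move=> GE GI ig gT gG.
pose H := [set A | measurable A /\ (\int[mu]_(z in A) (g z)%:E = 0)%E].
have mg : measurable_fun setT g by have /integrableP[/measurable_EFinP] := ig.
have iS A : measurable A -> mu.-integrable A (EFin \o g).
  by move=> mA; exact: integrableS ig.
have sub : measurable `<=` H.
  rewrite GE; apply: lambda_system_subset => //.
  - apply/dynkin_lambda_system; split => [|A [mA A0]|F tF HF].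
    + by split => //; exact: measurableT.
    + split; first exact: measurableC.
      move: gT; rewrite -(setUCr A) integral_setU_EFin//.
      * by rewrite A0 add0e.
      * exact: measurableC.
      * by rewrite setUCr.
      * by apply/disj_setPS; rewrite setICr.
    + split; first by apply: bigcup_measurable => k _; have [] := HF k.
      rewrite (@integral_bigcup _ _ _ mu F (EFin \o g))//.
      * by rewrite eseries0// => k _ _; have [] := HF k.
      * by move=> k; have [] := HF k.
      * by apply: iS; apply: bigcup_measurable => k _; have [] := HF k.
  - move=> A GA; split; last exact: gG.
    by rewrite GE; exact: sub_sigma_algebra.
have : ae_eq mu setT (EFin \o g) (cst 0%E).
  apply: integral_ae_eq => // E _ mE.
  by rewrite integral0; have [] := sub _ mE.
by apply: filterS => z /= /(_ I)[].
Qed.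

Section lipschitz_superlevel.
Context {R : realType} {n : nat}.
Let V := 'rV[R]_n.

Definition lipschitz (K : R) (f : V -> R) := forall x y, `|f x - f y| <= K * `|x - y|.

Lemma lipschitz_continuous K f : 0 <= K -> lipschitz K f -> continuous f.
Proof.
move=> K0 fL x A /(@nbhs_normP _ R^o (f x))[e /= e0 eA].
suff : nbhs (x : V) (f @^-1` A) by [].
apply/(@nbhs_normP _ V x).
have K1 : 0 < K + 1 by rewrite ltr_wpDl.
exists (e / (K + 1)); first exact: divr_gt0.
move=> y; rewrite /= ltr_pdivlMr// mulrC => xy; apply: eA.
apply: le_lt_trans (fL x y) _; apply: le_lt_trans xy.
by rewrite ler_wpM2r// lerDl.
Qed.

Lemma lipschitz_min K L f g : lipschitz K f -> lipschitz L g ->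
  lipschitz (Num.max K L) (fun x => Num.min (f x) (g x)).
Proof.
move=> fK gL x y; set D := `|x - y|.
have h1 : `|f x - f y| <= Num.max K L * D.
  by apply: le_trans (fK x y) _; rewrite ler_wpM2r// le_max lexx.
have h2 : `|g x - g y| <= Num.max K L * D.
  by apply: le_trans (gL x y) _; rewrite ler_wpM2r// le_max lexx orbT.
move: h1 h2; rewrite !ler_norml => /andP[? ?] /andP[? ?].
by rewrite !minEle; do 2 case: (leP (f _) (g _)) => ?; apply/andP; split; lra.
Qed.

Lemma lipschitz_max K L f g : lipschitz K f -> lipschitz L g ->
  lipschitz (Num.max K L) (fun x => Num.max (f x) (g x)).
Proof.
move=> fK gL x y; set D := `|x - y|; set m := Num.max K L.
have h1 : `|f x - f y| <= m * D.
  by apply: le_trans (fK x y) _; rewrite ler_wpM2r// le_max lexx.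
have h2 : `|g x - g y| <= m * D.
  by apply: le_trans (gL x y) _; rewrite ler_wpM2r// le_max lexx orbT.
move: h1 h2; rewrite !ler_norml => /andP[? ?] /andP[? ?].
by rewrite !maxEle; do 2 case: (leP (f _) (g _)) => ?; apply/andP; split; lra.
Qed.

Lemma lipschitz_cst c : lipschitz 0 (cst c).
Proof. by move=> x y; rewrite /= subrr normr0 mul0r. Qed.

Lemma open_lipschitz (U : set V) : open U ->
  exists2 f, lipschitz 1 f & U = [set x | 0 < f x].
Proof.
(* [sup (A x)] is the distance from [x] to the complement of [U], capped at 1 so as to be finite
   when [U] is the whole space. *)
move=> oU; pose A x := [set r : R | 0 <= r <= 1 /\ forall y, `|x - y| < r -> U y].
have A0 x : A x 0.
  by split; [rewrite lexx ler01|move=> y; rewrite ltNge normr_ge0].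
have ub x : has_ubound (A x) by exists 1 => r [/andP[]].
have ne x : A x !=set0 by exists 0.
have hs x : has_sup (A x) by [].
have half x y : sup (A x) <= sup (A y) + `|x - y|.
  apply: ge_sup => // r [/andP[r0 r1] rU].
  have [rxy|xyr] := leP r `|x - y|.
    apply: le_trans rxy _; rewrite lerDr.
    exact: (ub_le_sup (ub y) (A0 y)).
  rewrite -lerBlDr; apply: (ub_le_sup (ub y)); split.
    by rewrite subr_ge0 (ltW xyr) lerBlDr (le_trans r1)// lerDl.
  move=> z yz; apply: rU; have := ler_normD (x - y) (y - z).
  by rewrite addrA subrK; move: yz; lra.
exists (fun x => sup (A x)).
  move=> x y; rewrite mul1r ler_norml lerBlDr lerNl opprB lerBlDr addrC.
  by rewrite (addrC (`|_|)) {1}distrC !half.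
apply/seteqP; split => [x Ux|x /= h].
  have /nbhs_normP[e /= e0 eU] : nbhs x U by exact: open_nbhs_nbhs.
  have : A x (Num.min e 1).
    split; first by rewrite ge_min lexx orbT le_min (ltW e0) ler01.
    by move=> y; rewrite lt_min => /andP[xy _]; exact: eU.
  move/(ub_le_sup (ub x)) => h; apply: lt_le_trans h.
  by rewrite lt_min e0 ltr01.
have [r [_ rU] r0] := sup_adherent h (hs x).
by apply: rU; rewrite subrr normr0; move: r0; rewrite subrr.
Qed.

(** A pi-system suited to the short-time result, in which the final time is free while the initial
    time is fixed. Positivity sets of Lipschitz functions intersect by taking minima and still
    describe all open sets. *)
Definition slab : set (set (measurableTypeR R * V)) :=
  [set A | exists s f K, [/\ 0 <= K, lipschitz K f & A = [set z | z.1 < s /\ 0 < f z.2]]].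

Lemma slab_setI : setI_closed slab.
Proof.
move=> _ _ [s [f [K [K0 fK ->]]]] [t [g [L [L0 gL ->]]]].
exists (Num.min s t), (fun x => Num.min (f x) (g x)), (Num.max K L); split.
- by rewrite le_max K0.
- exact: lipschitz_min.
by apply/seteqP; split => z /=; rewrite !lt_min;
  [move=> [[-> ->] [-> ->]]|move=> [/andP[-> ->] /andP[-> ->]]].
Qed.

Lemma measurable_slab : @measurable _ (measurableTypeR R * V)%type = <<s slab>>.
Proof.
apply/seteqP; split; last first.
  apply: smallest_sub; first exact: sigma_algebra_measurable.
  move=> _ [s [f [K [K0 fK ->]]]].
  rewrite (_ : [set z | _] = [set` `]-oo, s[] `*` (f @^-1` `]0, +oo[)); last first.
    by apply/seteqP; split => z /=; rewrite !in_itv /= andbT.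
  apply: measurableX; first exact: measurable_itv.
  rewrite -[X in measurable X]setTI.
  by apply: (measurable_fun_continuous_rV (lipschitz_continuous K0 fK)) => //; exact: measurable_itv.
(* For the sigma-algebra generated by slabs both projections are measurable, hence it contains the
   product one. *)
pose Z := g_sigma_algebraType slab.
have mZ A : slab A -> measurable (A : set Z) by exact: sub_sigma_algebra.
have m1 : measurable_fun setT (fst : Z -> measurableTypeR R).
  apply: (measurability _ (measurable_realfun.RGenInftyO.measurableE R)).
  move=> _ [_ [s ->] <-]; rewrite setTI; apply: mZ.
  exists s, (cst 1), 0; split => //; first exact: lipschitz_cst.
  by apply/seteqP; split => z /=; rewrite in_itv /=; [move=> ->|case].
have m2 : measurable_fun setT (snd : Z -> V).
  apply: (@measurability _ _ _ _ _ _ (@open V)) => // _ [U oU <-].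
  have [f fL ->] := open_lipschitz oU.
  rewrite setTI (_ : _ @^-1` _ = \bigcup_k ([set z : Z | z.1 < k%:R /\ 0 < f z.2])).
    by apply: bigcup_measurable => k _; apply: mZ; exists k%:R, f, 1.
  apply/seteqP; split => [z /= fz|z [k _ []]//].
  exists (Num.truncn `|z.1|).+1 => //; split => //.
  exact: le_lt_trans (ler_norm _) (truncnS_gt _).
apply: smallest_sub; first exact: (@sigma_algebra_measurable _ Z).
move=> X [] [A mA <-]; first exact: m1.
exact: m2.
Qed.

End lipschitz_superlevel.

Section superlevel_integrals.
Context {R : realType} {n : nat} {chi chi' : R^o -> R^o} {c : R}.
Let V := 'rV[R]_n.
Let S := (measurableTypeR R * V)%type.
Variable P : {measure set S -> \bar R}.
Hypothesis hk : reproducing_kernel chi chi' c.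
Variable g : S -> R.
Hypothesis ig : P.-integrable [set: S] (EFin \o g).
Hypothesis smooth_zero : forall (psi : V -> R^o) (G0 Kpsi r : R), 0 <= G0 -> 0 <= Kpsi -> 0 <= r ->
  (forall x, differentiable psi x) -> (forall x v, `|'d psi x v| <= G0 * `|v|) ->
  (forall x, `|psi x| <= Kpsi) -> (forall x, r <= `|x| -> psi x = 0) ->
  \int[P]_z (psi z.2 * g z) = 0.

Let Kn := (5 * c) ^+ n.

Let Kn0 : 0 <= Kn.
Proof.
have [_ _ [h _] _ _] := hk.
by rewrite exprn_ge0// mulr_ge0// (le_trans (normr_ge0 _) (h 0)).
Qed.

Lemma qi_lipschitz (f : V -> R) K r d M : 0 < d <= 1 -> 0 <= K ->
  lipschitz K f -> (forall x, r <= `|x| -> f x = 0) -> r + 2 <= d * (M%:R - 2) ->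
  let psi := qi chi d (fun k : {ffun 'I_n -> 'I_(M.*2.+1)} => f (node d k)) in
  (forall x, r + 2 <= `|x| -> psi x = 0) /\
  (forall x, `|psi x - f x| <= 2 * d * K * Kn).
Proof.
move=> /andP[d0 d1] K0 fL far cov psi.
have pfar x : r + 2 <= `|x| -> psi x = 0.
  move=> rx; rewrite /psi /qi big1// => k _.
  have [h|h] := leP `|x - node d k| (2 * d); last by rewrite (weight_far hk d0 h) mulr0.
  rewrite far ?mul0r//; have := ler_normD (x - node d k) (node d k).
  by rewrite subrK; move: h rx d1; lra.
have close x : `|psi x - f x| <= 2 * d * K * Kn.
  have [xr|xr] := leP `|x| (r + 2); last first.
    rewrite pfar ?(ltW xr)// far ?subrr ?normr0; last by move: xr; lra.
    by rewrite mulr_ge0// mulr_ge0// mulr_ge0// ltW.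
  apply: (@qi_estimate _ _ _ _ _ hk _ _ d0 _ _ _ _ _ (0 : V)).
    by move=> i; rewrite (le_trans (coord_le_norm _ _))// (le_trans xr).
  move=> k xk; rewrite /dot big1 ?subr0; last by move=> i _; rewrite mxE mul0r.
  rewrite distrC; apply: le_trans (fL _ _) _.
  by rewrite mulrC ler_wpM2r.
by [].
Qed.

(** The quasi-interpolant of mesh [1 / N] falls under [smooth_zero], and its uniform distance to [f]
    is of order [K / N]. *)
Lemma lipschitz_integral_eq0 (f : V -> R) K r : 0 <= K -> 0 <= r ->
  lipschitz K f -> (forall x, `|f x| <= 1) -> (forall x, r <= `|x| -> f x = 0) ->
  \int[P]_z (f z.2 * g z) = 0.
Proof.
move=> K0 r0 fL f1 far; apply/eqP; rewrite -normr_le0; set I := `|_|.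
have mfst (h : V -> R) : continuous h -> measurable_fun [set: S] (fun z : S => h z.2).
  by move=> ch; apply: measurableT_comp => //; exact: measurable_fun_continuous_rV.
pose Q := \int[P]_z `|g z|.
have Q0 : 0 <= Q by apply: Rintegral_ge0 => z _; exact: normr_ge0.
apply: (@le_of_le_add_div _ _ _ (2 * K * Kn * Q)) => [|N N0].
  by rewrite mulr_ge0// mulr_ge0// mulr_ge0.
rewrite add0r; pose d : R := N%:R^-1.
have N0' : 0 < N%:R :> R by rewrite ltr0n.
have d0 : 0 < d by rewrite invr_gt0.
have d1 : d <= 1 by rewrite invf_le1// ler1n.
pose M := (Num.truncn ((r + 2) / d)).+3.
have cov : r + 2 <= d * (M%:R - 2).
  rewrite mulrC -ler_pdivrMr// /M.
  have := truncnS_gt ((r + 2) / d); rewrite -[X in _ < X%:R -> _]addn1 natrD.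
  by rewrite -addn3 natrD; lra.
pose a (k : {ffun 'I_n -> 'I_(M.*2.+1)}) := f (node d k).
have d01 : 0 < d <= 1 by rewrite d0.
have [pfar pclose] := qi_lipschitz d01 K0 fL far cov.
have pbnd x : `|qi chi d a x| <= 1 + 2 * d * K * Kn.
  rewrite -[qi chi d a x](subrK (f x)); apply: le_trans (ler_normD _ _) _.
  by rewrite addrC lerD.
have B0 : 0 <= 1 + 2 * d * K * Kn by rewrite (le_trans (normr_ge0 _) (pbnd 0)).
have psi0 : \int[P]_z (qi chi d a z.2 * g z) = 0.
  apply: (@smooth_zero _ (n%:R * (d^-1 * Kn)) (1 + 2 * d * K * Kn) (r + 2)) => //.
  - by rewrite mulr_ge0// mulr_ge0// ltW// invr_gt0.
  - by rewrite addr_ge0.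
  - by move=> x; exact: (differentiable_qi hk).
  - move=> x v; rewrite (diff_qiE hk); apply: le_trans (ler_norm_sum _ _ _) _.
    apply: (@le_trans _ _ (\sum_(j < n) (d^-1 * Kn * `|v|))); last first.
      by rewrite sumr_const card_ord -[X in X <= _]mulr_natl [X in X <= _]mulrA lexx.
    apply: ler_sum => j _; rewrite normrM mulrC; apply: ler_pM => //; last exact: coord_le_norm.
    rewrite /dqi; apply: le_trans (ler_norm_sum _ _ _) _.
    apply: le_trans (sum_norm_dweight hk M d0 j x).
    by apply: ler_sum => k _; rewrite normrM ler_piMl// f1.
have mf := mfst f (lipschitz_continuous K0 fL).
have mp : measurable_fun [set: S] (fun z : S => qi chi d a z.2).
  by apply: mfst => x; exact: (differentiable_continuous (differentiable_qi hk d a x)).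
have if_ : P.-integrable [set: S] (EFin \o (fun z => f z.2 * g z)).
  by apply: (integrable_mul_bounded (K := 1)) ig.
have ip : P.-integrable [set: S] (EFin \o (fun z => qi chi d a z.2 * g z)).
  by apply: (integrable_mul_bounded (K := 1 + 2 * d * K * Kn)) ig.
have -> : I = `|\int[P]_z (qi chi d a z.2 * g z - f z.2 * g z)|.
  by rewrite RintegralB// psi0 sub0r normrN.
apply: le_trans (le_normr_Rintegral _ (integrable_sub ip if_)) _ => //.
rewrite (_ : _ / _ = 2 * d * K * Kn * Q); last by rewrite /d; ring.
rewrite -RintegralZl//; last exact: integrable_normr.
apply: le_Rintegral => //.
- by apply: integrable_normr; exact: integrable_sub.
- by apply: integrable_scale; exact: integrable_normr.
- by move=> z _; rewrite -mulrBl normrM ler_wpM2r.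
Qed.

Lemma superlevel_integral_eq0 (f : V -> R) K : 0 <= K -> lipschitz K f ->
  (\int[P]_(z in [set z : S | (0 < f z.2)%R]) (g z)%:E = 0)%E.
Proof.
move=> K0 fL; pose A := [set z : S | 0 < f z.2].
(* Lipschitz functions with bounded support, eventually equal at each point to the indicator of the
   set where [f] is positive. *)
pose h (m : nat) (x : V) := Num.max 0 (Num.min 1 (Num.min (m%:R * f x) (m%:R - `|x|))).
have h01 m x : 0 <= h m x <= 1.
  by rewrite /h le_max lexx /= ge_max ler01 ge_min lexx.
have hL m : exists2 L, 0 <= L & lipschitz L (h m).
  exists (Num.max 0 (Num.max 0 (Num.max (m%:R * K) 1))).
    by rewrite le_max lexx.
  apply: lipschitz_max; first exact: lipschitz_cst.
  apply: lipschitz_min; first exact: lipschitz_cst.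
  apply: lipschitz_min => x y.
    by rewrite -mulrBr normrM ger0_norm// -mulrA ler_wpM2l.
  rewrite opprB addrCA addrAC subrr add0r mul1r distrC; exact: ler_dist_dist.
have hfar m x : m%:R <= `|x| -> h m x = 0.
  move=> mx; apply/max_idPl; rewrite ge_min; apply/orP; right.
  by rewrite ge_min subr_le0 mx orbT.
have h0 m : \int[P]_z (h m z.2 * g z) = 0.
  have [L L0 lip] := hL m.
  apply: (lipschitz_integral_eq0 L0 (ler0n R m)) => //; last exact: hfar.
  by move=> x; have /andP[? ?] := h01 m x; rewrite ger0_norm.
have mA : measurable A.
  rewrite /A (_ : [set z | _] = setT `*` (f @^-1` `]0, +oo[)); last first.
    by apply/seteqP; split => z /=; rewrite !in_itv /= andbT => // -[].
  apply: measurableX; first exact: measurableT.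
  rewrite -[X in measurable X]setTI.
  by apply: (measurable_fun_continuous_rV (lipschitz_continuous K0 fL)) => //; exact: measurable_itv.
have mg : measurable_fun setT g by have /integrableP[/measurable_EFinP] := ig.
have mh m : measurable_fun [set: S] (fun z : S => h m z.2).
  have [L L0 lip] := hL m.
  apply: measurableT_comp => //.
  by apply: measurable_fun_continuous_rV; exact: lipschitz_continuous lip.
have ih m : P.-integrable [set: S] (EFin \o (fun z => h m z.2 * g z)).
  apply: (integrable_mul_bounded (K := 1)) ig => // z _.
  by have /andP[? ?] := h01 m z.2; rewrite ger0_norm.
have hcvg (z : S) : (h m z.2 * g z)%:E @[m --> \oo] --> ((EFin \o g) \_ A) z.
  apply: cvg_near_cst; rewrite patchE.
  case: ifPn => [|/negP]; rewrite mem_setE /A /= => fz.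
    near=> m; rewrite (_ : h m z.2 = 1) ?mul1r// /h.
    have m1 : 1 <= m%:R * f z.2.
      rewrite -ler_pdivrMr//; near: m; exact: nbhs_infty_ger.
    have m2 : 1 <= m%:R - `|z.2|.
      rewrite lerBrDr; near: m; exact: nbhs_infty_ger.
    rewrite (_ : Num.min 1 _ = 1); last by apply/min_idPl; rewrite le_min m1.
    by apply/max_idPr.
  apply: nearW => m; rewrite (_ : h m z.2 = 0) ?mul0r// /h.
  apply/max_idPl; rewrite ge_min; apply/orP; right; rewrite ge_min.
  by rewrite mulr_ge0_le0// leNgt; apply/negP.
have [||||_ _ H] := @dominated_convergence _ _ _ P setT measurableT
    (fun m => EFin \o (fun z => h m z.2 * g z)) ((EFin \o g) \_ A) (EFin \o (fun z => `|g z|))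
    _ _ _ (integrable_normr ig).
- by move=> m; have /integrableP[] := ih m.
- by apply/(measurable_restrictT _ mA); apply: measurable_funTS; exact/measurable_EFinP.
- by apply: aeW => z _; exact: hcvg.
- apply: aeW => z m _; rewrite /= lee_fin normrM ler_piMl//.
  by have /andP[? ?] := h01 m z.2; rewrite ger0_norm.
rewrite -/A integral_mkcond; apply/esym/(cvg_unique _ _ H) => //.
apply: cvg_near_cst; apply: nearW => m.
rewrite /= -[LHS]fineK; first by congr EFin; exact: h0.
exact: (integrable_fin_num measurableT (ih m)).
Unshelve. all: by end_near. Qed.

End superlevel_integrals.

(** * Propagation of the vanishing from time 0 to time T *)

Section vanishing.
Context {R : realType} {n : nat} {chi chi' : R^o -> R^o} {c : R}.
Let V := 'rV[R]_n.
Let S := (measurableTypeR R * V)%type.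
Let P : {measure set S -> \bar R} := (@lebesgue_measure R \x lebesgue_measure_rV n)%E.
Hypothesis hk : reproducing_kernel chi chi' c.
Variables (T C1 C2 : R) (b : R -> V -> V) (rho : S -> R).
Hypothesis mb : measurable_fun [set: S] (fun z : S => b z.1 z.2).
Hypothesis b_out : forall t x, t \notin `[0, T] -> b t x = 0.
Hypothesis C1_ge0 : 0 <= C1.
Hypothesis C2_ge0 : 0 <= C2.
Hypothesis b_growth : forall t x, `|b t x| <= C1 * (1 + `|x|).
Hypothesis b_mod : forall e t x y, 0 < e -> `|x - y| <= 2 * e ->
  `|b t x - b t y| <= C2 * (e * ln (expR 1 + 1 / e)).
Hypothesis rho_T : forall z, rho z != 0 -> 0 <= z.1 <= T.
Hypothesis irho : P.-integrable [set: S] (EFin \o rho).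
Hypothesis weak : forall u, test_function T u ->
  \int[P]_z ((derive1 (u ^~ z.2) z.1 + dot (b z.1 z.2) (grad (u z.1) z.2)) * rho z) = 0.
Let Kn := (5 * c) ^+ n.
Let vanish_before (s : R) := {ae P, forall z, z.1 < s -> rho z = 0}.

Let Kn0 : 0 <= Kn.
Proof.
have [_ _ [h _] _ _] := hk.
by rewrite exprn_ge0// mulr_ge0// (le_trans (normr_ge0 _) (h 0)).
Qed.

Let cut a s (z : S) : R := (z.1 \in `]a, s[)%:R * rho z.

Let integrable_cut a s : P.-integrable [set: S] (EFin \o cut a s).
Proof.
apply: (integrable_mul_bounded (K := 1)) irho => //.
  rewrite (_ : (fun z => _) = (\1_[set` `]a, s[] : R -> R) \o (@fst _ _)).
    by apply: measurableT_comp => //; exact: measurable_indic.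
  by apply/funext => z /=; rewrite indicE mem_setE.
by move=> z _; case: (_ \in _); rewrite ?normr1 ?normr0 ?ler01.
Qed.

(** Varying the final time and the function [psi] in the short-time result shows that [rho], cut to
    the times between [a] and [s], integrates to zero over all slabs; the time [a] is a null set. *)
Lemma vanish_before_step tau a s : tau * (C1 * Kn) <= 4^-1 ->
  tau * (n%:R * C2 * Kn) <= 2^-1 -> a < s -> s - a <= tau -> s < T ->
  vanish_before a -> vanish_before s.
Proof.
move=> tau1 tau2 a_s s_tau s_T past.
have cut0 s' (f : V -> R) K : s' <= s -> 0 <= K -> lipschitz K f ->
    (\int[P]_(z in [set z : S | (0 < f z.2)%R]) (cut a s' z)%:E = 0)%E.
  move=> s's K0 fL; have [as'|s'a] := ltP a s'; last first.
    apply: integral0_eq => z _; rewrite /cut in_itv /= (_ : _ && _ = false) ?mul0r//.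
    by apply/negP => /andP[/lt_trans h /h]; rewrite ltNge s'a.
  apply: (superlevel_integral_eq0 hk (integrable_cut a s')) K0 fL.
  move=> psi G0 Kpsi r h1 h2 h3 h4 h5 h6 h7.
  have s'_tau : s' - a <= tau by apply: le_trans s_tau; rewrite lerD2r.
  have := short_time_vanishing hk mb b_out C1_ge0 C2_ge0 b_growth b_mod rho_T irho weak
    tau1 tau2 as' s'_tau (le_lt_trans s's s_T) past h1 h2 h3 h4 h5 h6 h7.
  move=> E; rewrite -[RHS]E; apply: eq_Rintegral => z _.
  by rewrite /cut mulrA (mulrC (psi _)).
have : {ae P, forall z, cut a s z = 0}.
  apply: (ae_eq0_of_pi_system (@measurable_slab R n) slab_setI (integrable_cut a s)).
    have E : [set: S] = [set z : S | 0 < (cst 1 : V -> R) z.2].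
      by apply/seteqP; split => z //= _; exact: ltr01.
    rewrite -[LHS]/(integral P [set: S] (fun z => (cut a s z)%:E)) E.
    by apply: (cut0 s (cst 1) 0) => //; exact: lipschitz_cst.
  move=> _ [s' [f [K [K0 fL ->]]]].
  (* Intersecting with a slab amounts to lowering the final time of the cut. *)
  transitivity (\int[P]_(z in [set z : S | (0 < f z.2)%R]) (cut a (Num.min s' s) z)%:E)%E; last first.
    by apply: cut0 K0 fL; rewrite ge_min lexx orbT.
  rewrite integral_mkcond [RHS]integral_mkcond; apply: eq_integral => z _.
  rewrite !patchE /cut; have [f0|f0] := ltP 0 (f z.2); last first.
    by rewrite !memNset//= => [|[_]]; rewrite ltNge f0.
  rewrite [z \in [set z | 0 < f z.2]]mem_set//.
  have [zs'|s'z] := ltP z.1 s'.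
    by rewrite mem_set// !in_itv /= lt_min zs'.
  rewrite memNset /= => [|[]]; last by rewrite ltNge s'z.
  by rewrite !in_itv /= lt_min [z.1 < s']ltNge s'z /= andbF mul0r.
apply: (@filterS3 _ _ (ae_filter_ringOfSetsType P)) past (ae_fst (n := n) (ae_neq a)).
move=> z /= before za z0 zs; have [/before//|] := ltP z.1 a.
rewrite le_eqVlt eq_sym (negPf za) /= => az.
by move: z0; rewrite /cut in_itv /= az zs mul1r.
Qed.

Lemma vanishing : {ae P, forall z, z.1 < T -> rho z = 0}.
Proof.
(* [tau] depends only on [n], the kernel and the constants of the field, hence is the same at every
   step; the summand 1 keeps it finite when the constants vanish. *)
pose X := C1 * Kn + n%:R * C2 * Kn + 1; pose tau := (4 * X)^-1.
have X1 : 0 <= C1 * Kn by rewrite mulr_ge0.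
have X2 : 0 <= n%:R * C2 * Kn by rewrite mulr_ge0// mulr_ge0.
have X0 : 0 < X by rewrite ltr_wpDl// addr_ge0.
have tau0 : 0 < tau by rewrite invr_gt0 mulr_gt0.
have tauX Y : Y <= X -> tau * Y <= 4^-1.
  by move=> YX; rewrite /tau mulrC ler_pdivrMr ?mulr_gt0// mulKf// pnatr_eq0.
have tau1 : tau * (C1 * Kn) <= 4^-1 by apply: tauX; rewrite /X; move: X2; lra.
have tau2 : tau * (n%:R * C2 * Kn) <= 2^-1.
  apply: le_trans (tauX _ _) _; first by rewrite /X; move: X1; lra.
  by rewrite lef_pV2 ?posrE// ler_nat.
(* The induction starts for free, since [rho] is zero at negative times. *)
have start : vanish_before 0.
  apply: aeW => z z0; apply/eqP/negPn/negP => /rho_T/andP[].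
  by rewrite leNgt z0.
have early s : s < T -> vanish_before s.
  move=> sT; have [s0|s0] := leP s 0.
    apply: (@filterS _ _ (ae_filter_ringOfSetsType P)) start => z h zs.
    by apply: h; exact: lt_le_trans zs s0.
  pose N := (Num.truncn (s / tau)).+1; pose h := s / N%:R.
  have N0 : 0 < N%:R :> R by rewrite ltr0n.
  have h0 : 0 < h by rewrite divr_gt0.
  have htau : h <= tau.
    by rewrite ler_pdivrMr// mulrC -ler_pdivrMr// ltW// truncnS_gt.
  have Nh : N%:R * h = s by rewrite mulrC divfK// gt_eqF.
  suff H k : (k <= N)%N -> vanish_before (k%:R * h) by rewrite -Nh; exact: H.
  elim: k => [_|k IH kN]; first by rewrite mul0r.
  apply: (vanish_before_step tau1 tau2) (IH (ltnW kN)).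
  - by rewrite ltr_pM2r// ltr_nat.
  - by rewrite -mulrBl -natrB// subSnn mul1r.
  - by apply: le_lt_trans sT; rewrite -Nh ler_pM2r// ler_nat.
(* Test functions must vanish near [T], so only times below [T] are reached by steps; a countable
   union recovers all of them. *)
have Tm m : T - m.+1%:R^-1 < T by rewrite gtrBl invr_gt0.
have := ae_forall_count (fun m : nat => early (T - m.+1%:R^-1) (Tm m)).
apply: (@filterS _ _ (ae_filter_ringOfSetsType P)) => z H zT.
have [m] := ltr_add_invr zT.
by rewrite -ltrBrDr; exact: H.
Qed.

End vanishing.

(** * Reduction to a field with bounds at every time *)

(** This lets the modulus pass from the Euclidean norm to the sup norm and from [r] to a comparable
    scale [e]. For [r >= e] the logarithm decreases. For [r < e] it exceeds that at [e] by at most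
    [ln (e / r) <= e / r], so the product exceeds [r * lg e] by at most [e], itself at most
    [e * lg e]. *)
Lemma loglip_modulus {R : realType} (K e r : R) : 2 <= K -> 0 < e -> 0 < r -> r <= K * e ->
  r * ln (expR 1 + 1 / r) <= K * (e * ln (expR 1 + 1 / e)).
Proof.
move=> K2 e0 r0 rK; set E := expR 1; set lg := fun s : R => ln (E + 1 / s).
have E0 : 0 < E by exact: expR_gt0.
have pos s : 0 < s -> 0 < E + 1 / s by move=> s0; rewrite addr_gt0// divr_gt0.
have lg1 : 1 <= lg e.
  rewrite /lg -[X in X <= _](@expRK R) ler_ln ?posrE ?expR_gt0// ?pos//.
  by rewrite lerDl divr_ge0// ltW.
have [er|re] := leP e r.
  rewrite mulrA; apply: ler_pM => //; first exact: ltW.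
    rewrite -/(lg r) /lg -ln1 ler_ln ?posrE ?ltr01// ?pos//.
    by rewrite ler_wpDr ?divr_ge0// ?(ltW r0)// /E; have := expR_ge1Dx (1 : R); lra.
  by rewrite ler_ln ?posrE ?pos// lerD2l !div1r lef_pV2 ?posrE.
have l0 : 0 < e / r by rewrite divr_gt0.
have h1 : lg r <= lg e + ln (e / r).
  rewrite /lg -lnM ?posrE ?pos// ler_ln ?posrE ?mulr_gt0 ?invr_gt0 ?pos//.
  rewrite mulrDl div1r -[X in _ <= _ + X]mulrA mul1r mulKf ?gt_eqF//.
  by rewrite lerD2r ler_pMr// ler_pdivlMr// mul1r ltW.
have h2 : ln (e / r) <= e / r by exact: (le_trans (ltW (ln_sublinear l0))).
apply: (@le_trans _ _ (r * (lg e + e / r))).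
  by rewrite ler_pM2l// (le_trans h1)// lerD2l.
rewrite mulrDr mulrCA divff ?gt_eqF// mulr1.
apply: (@le_trans _ _ (2 * (e * lg e))); last by rewrite ler_wpM2r// mulr_ge0 ?(ltW e0)// (le_trans ler01).
have a1 : r * lg e <= e * lg e by rewrite ler_wpM2r ?(ltW re)// (le_trans ler01).
have a2 : e <= e * lg e by rewrite ler_peMr// ltW.
by move: a1 a2; lra.
Qed.

Section euclidean_norm.
Context {R : realType} {n : nat}.
Implicit Types x : 'rV[R]_n.

Lemma norm_le_enorm x : `|x| <= enorm x.
Proof.
apply: norm_rV_le => [|i]; first exact: sqrtr_ge0.
rewrite -sqrtr_sqr; apply: ler_wsqrtr; rewrite /dot (bigD1 i)//= expr2 lerDl.
by apply: sumr_ge0 => j _; rewrite -expr2 sqr_ge0.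
Qed.

Lemma enorm_le_norm x : enorm x <= n.+1%:R * `|x|.
Proof.
have h : 0 <= n.+1%:R * `|x| by rewrite mulr_ge0.
rewrite -[leRHS]ger0_norm// -sqrtr_sqr; apply: ler_wsqrtr.
apply: (@le_trans _ _ (\sum_(i < n) `|x| ^+ 2)).
  apply: ler_sum => i _; rewrite -expr2 -real_normK ?num_real//.
  by rewrite lerXn2r ?nnegrE// coord_le_norm.
rewrite sumr_const card_ord -[leLHS]mulr_natl exprMn ler_wpM2r ?sqr_ge0//.
by rewrite -natrX ler_nat (leq_trans (leqnSn n))// -mulnn leq_pmulr.
Qed.

End euclidean_norm.

(** * Iterated integrals, derivatives of test functions and restriction in time *)

Section fubini_ae.
Context d1 d2 (T1 : measurableType d1) (T2 : measurableType d2) (R : realType).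
Variables (m1 : {sigma_finite_measure set T1 -> \bar R}) (m2 : {sigma_finite_measure set T2 -> \bar R}).
Let P : {measure set (T1 * T2)%type -> \bar R} := (m1 \x m2)%E.

(** The inner real integral is the [fine] part of an extended one, which is finite for almost every
    [t]; so both agree outside a null set. *)
Lemma iterated_Rintegral (f : T1 * T2 -> R) : P.-integrable setT (EFin \o f) ->
  \int[m1]_t (\int[m2]_x f (t, x)) = \int[P]_z f z.
Proof.
move=> if_; rewrite /Rintegral -(integral12_prod_meas1 if_); congr fine.
have mF := measurable_fubini_F if_.
apply: ae_eq_integral => //.
  by apply/measurable_EFinP; exact: measurableT_comp.
apply: (@filterS _ _ (ae_filter_ringOfSetsType m1)) (ae_integrable1 if_) => t h _ /=.
by rewrite fineK//; exact: integrable_fin_num h.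
Qed.

Lemma integrable_ae_eq d (S : measurableType d) (mu : {measure set S -> \bar R}) (f g : S -> R) :
  mu.-integrable setT (EFin \o f) -> measurable_fun setT g ->
  {ae mu, forall z, g z = f z} ->
  mu.-integrable setT (EFin \o g) /\ \int[mu]_z g z = \int[mu]_z f z.
Proof.
move=> /integrableP[mf foo] mg gf.
have mg' : measurable_fun setT (EFin \o g) by exact/measurable_EFinP.
split.
  apply/integrableP; split => //; apply: le_lt_trans foo.
  rewrite le_eqVlt; apply/orP; left; apply/eqP; apply: ae_eq_integral => //.
  - exact: measurableT_comp.
  - exact: measurableT_comp.
  - by apply: (@filterS _ _ (ae_filter_ringOfSetsType mu)) gf => z /= ->.
congr fine; apply: ae_eq_integral => //.
by apply: (@filterS _ _ (ae_filter_ringOfSetsType mu)) gf => z /= ->.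
Qed.

(** By Tonelli the integrals of [|f|] over the sections have integral zero, so almost all of them
    are zero. *)
Lemma ae_sections (f : T1 * T2 -> R) : measurable_fun setT f ->
  {ae P, forall z, f z = 0} -> {ae m1, forall t, {ae m2, forall x, f (t, x) = 0}}.
Proof.
move=> mf f0.
have mE : measurable_fun setT (EFin \o f) by exact/measurable_EFinP.
have mA : measurable_fun setT (fun z => `|(f z)%:E|)%E by exact: measurableT_comp.
have A0 z : (0 <= `|(f z)%:E|)%E by exact: abse_ge0.
have : (\int[m1]_t (fubini_F m2 (fun z => `|(f z)%:E|) t) = 0)%E.
  rewrite -(@fubini_tonelli1 _ _ _ _ _ m1 m2 _ mA A0).
  apply/(ae_eq_integral_abs P measurableT mE).
  by apply: (@filterS _ _ (ae_filter_ringOfSetsType P)) f0 => z /= ->.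
have mF : measurable_fun setT (fubini_F m2 (fun z => `|(f z)%:E|)%E).
  exact: measurable_fun_fubini_tonelli_F.
have F0 t : (0 <= fubini_F m2 (fun z => `|(f z)%:E|) t)%E by exact: integral_ge0.
rewrite (eq_integral (fun t => `|fubini_F m2 (fun z => `|(f z)%:E|) t|)%E); last first.
  by move=> t _; rewrite gee0_abs.
move=> /(ae_eq_integral_abs m1 measurableT mF).
apply: (@filterS _ _ (ae_filter_ringOfSetsType m1)) => t /= /(_ I) Ft.
have mt : measurable_fun setT (fun x => (f (t, x))%:E).
  exact: (measurableT_comp mE (pair1_measurable t)).
have /(ae_eq_integral_abs m2 measurableT mt) := Ft.
by apply: (@filterS _ _ (ae_filter_ringOfSetsType m2)) => x /= /(_ I)[].
Qed.

End fubini_ae.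

Section test_function_derivatives.
Context {R : realType} {n : nat}.
Let V := 'rV[R]_n.
Let S := (measurableTypeR R * V)%type.

(** The measurable sets of the product are generated by rectangles, not by open sets; going through
    [cons_rV], which is measurable, bridges the two. *)
Lemma measurable_fun_continuous_prod (f : R^o * V -> R^o) : continuous f ->
  measurable_fun [set: S] (f : S -> R).
Proof.
move=> cf.
have -> : (f : S -> R) = (f \o @uncons_rV R n) \o @cons_rV R n.
  by apply/funext => z /=; rewrite cons_rVK.
apply: (@measurableT_comp _ _ _ _ _ _ _ _ (@cons_rV R n)); last exact: measurable_cons_rV.
apply: measurable_fun_continuous_rV => y.
apply: (@continuous_comp _ _ _ (@uncons_rV R n : _ -> R^o * V) f); last exact: cf.
move=> A /= /(@nbhs_normP _ (R^o * V)%type)[e /= e0 eA]; apply/(@nbhs_normP _ 'rV[R]_n.+1 y).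
exists e => //= w yw; apply: eA; apply: le_lt_trans yw => /=.
by rewrite -linearB; exact: norm_uncons_rV.
Qed.

Variables (T : R) (u : R -> V -> R).
Hypothesis tf : test_function T u.
Let U (z : R^o * V) : R^o := u z.1 z.2.

Lemma derive1_time t x : derive1 (u ^~ x) t = 'D_(1, 0) U (t, x).
Proof.
rewrite derive1E.
pose l (s : R^o) : R^o * V := (s, x).
pose l0 (s : R^o) : R^o * V := (s, 0).
have ll (h : R) (s v : R^o) : l (h *: v + s) = h *: l0 v + l s.
  by rewrite /l /l0; congr pair; rewrite /= scaler0 add0r.
have [_ E] := derive_comp_affine U ll 1 t.
exact: E.
Qed.

Lemma grad_space t x : grad (u t) x = \row_i 'D_(0, delta_mx 0 i) U (t, x).
Proof.
apply/rowP => i; rewrite !mxE.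
pose l (y : V) : R^o * V := (t, y).
pose l0 (y : V) : R^o * V := (0, y).
have ll (h : R) (y v : V) : l (h *: v + y) = h *: l0 v + l y.
  by rewrite /l /l0; congr pair; rewrite /= scaler0 add0r.
have [_ E] := derive_comp_affine U ll (delta_mx 0 i) x.
exact: E.
Qed.

Lemma continuous_derive_test v : continuous (fun z => 'D_v U z).
Proof. by have [/(_ 1%N)[_ /(_ v)[_ h]] _] := tf; exact: h. Qed.

(** Off the closed set [K] a test function vanishes in a neighbourhood. The times are taken strictly
    inside because its values outside [[0, T[] are not constrained. *)
Lemma derive_test_support : exists K : set (R^o * V), compact K /\
  forall z v, 0 < z.1 < T -> ~ K z -> 'D_v U z = 0.
Proof.
have [_ [K [cK _ off]]] := tf.
exists K; split => // z v /andP[z0 zT] Kz.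
have cl : closed (K : set (R^o * V)) by apply: compact_closed => //; exact: norm_hausdorff.
have n0 : \forall w \near z, cst 0 w = U w.
  have nK : nbhs z (~` (K : set (R^o * V))).
    by apply: open_nbhs_nbhs; split => //; exact: closed_openC.
  have n1 : \forall w \near z, 0 < w.1 by case: z z0 {zT Kz nK} => t x /=; exact: near_fst_gt.
  have n2 : \forall w \near z, w.1 < T by case: z zT {z0 Kz nK n1} => t x /=; exact: near_fst_lt.
  apply: filterS3 nK n1 n2 => -[t x] /= Kw w0 wT.
  by rewrite /U off// in_itv /= (ltW w0) wT.
have [dU dE] : is_diff z U (0 : R^o * V -> R^o) by exact: near_eq_is_diff n0 _.
by rewrite deriveE// dE.
Qed.

Lemma test_derive_bound v : exists2 M, 0 <= M &
  forall z : S, 0 < z.1 < T -> `|'D_v U z| <= M.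
Proof.
have [K [cK off]] := derive_test_support.
have cD : {within K, continuous (fun z => 'D_v U z)}.
  by apply: continuous_subspaceT; exact: continuous_derive_test.
have /compact_bounded[M [_ MK]] := continuous_compact cD cK.
exists (Num.max 0 (M + 1)) => [|z zT]; first by rewrite le_max lexx.
have [Kz|Kz] := pselect (K z).
  by rewrite le_max; apply/orP; right; apply: (MK (M + 1)) => //=; [rewrite ltrDl|exists z].
by rewrite (off z v zT Kz) normr0 le_max lexx.
Qed.

Lemma test_derive_far v : exists r,
  forall z : S, 0 < z.1 < T -> r < `|z.2| -> 'D_v U z = 0.
Proof.
have [K [cK off]] := derive_test_support.
have /compact_bounded[M [_ MK]] := cK.
exists (M + 1) => z zT rz; apply: off => // Kz.
have := MK (M + 1) _ z Kz; rewrite ltrDl ltr01 => /(_ isT).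
by rewrite /= leNgt [X in _ < X]/Num.Def.normr /= lt_max rz orbT.
Qed.

Definition transport_derivative (b : R -> V -> V) (z : S) :=
  derive1 (u ^~ z.2) z.1 + dot (b z.1 z.2) (grad (u z.1) z.2).

Lemma transport_derivativeE b z : transport_derivative b z =
  'D_(1, 0) U z + \sum_i b z.1 z.2 0 i * 'D_(0, delta_mx 0 i) U z.
Proof.
case: z => t x; rewrite /transport_derivative derive1_time grad_space; congr (_ + _).
by apply: eq_bigr => i _; rewrite !mxE.
Qed.

Lemma measurable_transport_derivative (b : R -> V -> V) :
  measurable_fun [set: S] (fun z : S => b z.1 z.2) ->
  measurable_fun [set: S] (transport_derivative b).
Proof.
move=> mb; rewrite (funext (transport_derivativeE b)).
apply: measurable_funD.
  by apply: measurable_fun_continuous_prod; exact: continuous_derive_test.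
apply: measurable_sum => i; apply: measurable_funM.
  rewrite (_ : (fun z => _) = (fun x : V => x 0 i) \o (fun z => b z.1 z.2))//.
  by apply: measurableT_comp => //; exact: measurable_coord_rV.
by apply: measurable_fun_continuous_prod; exact: continuous_derive_test.
Qed.

(** The field is unbounded, but its growth is harmless where the space derivatives do not vanish,
    which is a bounded region. *)
Lemma transport_derivative_bound b C : 0 <= C ->
  (forall t x, `|b t x| <= C * (1 + `|x|)) ->
  exists M, forall z : S, 0 < z.1 < T -> `|transport_derivative b z| <= M.
Proof.
move=> C0 bC; have [M0 M00 h0] := test_derive_bound (1, 0).
have /choice[M hM] : forall i : 'I_n, exists M, 0 <= M /\
    forall z : S, 0 < z.1 < T -> `|'D_(0, delta_mx 0 i) U z| <= M.
  by move=> i; have [M ? ?] := test_derive_bound (0, delta_mx 0 i); exists M.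
have /choice[r hr] : forall i : 'I_n, exists r,
    forall z : S, 0 < z.1 < T -> r < `|z.2| -> 'D_(0, delta_mx 0 i) U z = 0.
  by move=> i; exact: test_derive_far.
exists (M0 + \sum_i C * (1 + `|r i|) * M i) => z zT; rewrite transport_derivativeE.
apply: le_trans (ler_normD _ _) _; apply: lerD; first exact: h0.
apply: le_trans (ler_norm_sum _ _ _) _; apply: ler_sum => i _.
have [Mi0 hMi] := hM i.
have [rz|zr] := ltP (r i) `|z.2|.
  by rewrite (hr i z zT rz) mulr0 normr0 mulr_ge0// mulr_ge0// addr_ge0.
rewrite normrM; apply: ler_pM => //; last exact: hMi.
apply: le_trans (coord_le_norm _ _) _; apply: le_trans (bC _ _) _.
by rewrite ler_wpM2l// lerD2l (le_trans zr)// ler_norm.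
Qed.

End test_function_derivatives.

Section reduction.
Context {R : realType} {n : nat}.
Let V := 'rV[R]_n.
Let S := (measurableTypeR R * V)%type.
Let mu := @lebesgue_measure R.
Let P : {measure set S -> \bar R} := (@lebesgue_measure R \x lebesgue_measure_rV n)%E.

Definition restrict_time {W : Type} (w0 : W) (J : set R) (f : R -> V -> W) (t : R) (x : V) : W :=
  if t \in J then f t x else w0.

Lemma measurable_restrict_time d (W : measurableType d) (w0 : W) (J : set (measurableTypeR R))
    (f : R -> V -> W) : measurable J ->
  measurable_fun (J `*` [set: V] : set S) (fun z : S => f z.1 z.2) ->
  measurable_fun [set: S] (fun z : S => restrict_time w0 J f z.1 z.2).
Proof.
move=> mJ mf; have E b : [set: S] `&` (fun z : S => z.1 \in J) @^-1` [set b] =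
    (if b then J else ~` J) `*` [set: V].
  apply/seteqP; split => [z [_ /= <-]|z [/= zJ _]]; split => //.
    by case: ifPn => [|/negP h]; rewrite ?inE//; apply: contra_not h; rewrite inE.
  by case: b zJ => zJ; [exact: mem_set|exact: memNset].
apply: measurable_fun_if => //.
- apply: (measurable_fun_bool true); rewrite E; exact: measurableX.
- by rewrite E.
Qed.

Lemma integrable_restrict_time (T : R) (rho : R -> V -> R) : L1L1 T rho ->
  P.-integrable [set: S]
    (EFin \o (fun z : S => restrict_time 0 [set` `]0, T[] rho z.1 z.2)).
Proof.
move=> [mrho irho].
have mJ : measurable ([set` `]0, T[] : set (measurableTypeR R)) by exact: measurable_itv.
have mr := measurable_restrict_time (0 : measurableTypeR R) mJ mrho.
apply/(integrable12ltyP mu (lebesgue_measure_rV n)); first exact/measurable_EFinP.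
apply: le_lt_trans irho; rewrite [leRHS]integral_mkcond.
rewrite le_eqVlt; apply/orP; left; apply/eqP; apply: eq_integral => t _.
rewrite patchE /restrict_time; case: ifPn => tJ; first by apply: eq_integral => x _; rewrite /= tJ.
by apply: integral0_eq => x _; rewrite /= (negPf tJ) normr0.
Qed.

Lemma transport_restrict_time (T : R) (b b' : R -> V -> V) (rho : R -> V -> R)
    (phi : R -> V -> R) (C : R) :
  test_function T phi ->
  measurable_fun ([set` `[0, T]] `*` [set: V] : set S) (fun z : S => b z.1 z.2) ->
  measurable_fun [set: S] (fun z : S => b' z.1 z.2) ->
  0 <= C -> (forall t x, `|b' t x| <= C * (1 + `|x|)) ->
  {ae mu, forall t, t \in `]0, T[ -> forall x, b' t x = b t x} ->
  L1L1 T rho ->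
  let f z := transport_derivative phi b' z * restrict_time 0 [set` `]0, T[] rho z.1 z.2 in
  P.-integrable [set: S] (EFin \o f) /\
  \int[mu]_(t in [set` `]0, T[]) \int[lebesgue_measure_rV n]_x
        ((derive1 (phi ^~ x) t + dot (b t x) (grad (phi t) x)) * rho t x) =
  \int[P]_z f z.
Proof.
move=> tf mb mb' C0 b'C b'E L1 f.
have ir := integrable_restrict_time L1.
have [M hM] := transport_derivative_bound tf C0 b'C.
have if_ : P.-integrable [set: S] (EFin \o f).
  apply: (integrable_mul_bounded (K := M)) ir.
    exact: (measurable_transport_derivative tf mb').
  move=> z; rewrite /restrict_time; case: ifPn => [zJ _|_]; last by rewrite eqxx.
  by apply: hM; move: zJ; rewrite mem_setE in_itv.
split => //.
(* [b] is measurable only on the time interval, and [b'] agrees with it only at almost every time.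
   The extension [b0] mediates: it equals [b] throughout []0, T[] and is measurable everywhere. *)
pose b0 := restrict_time 0 [set` `[0, T]] b.
have mJ : measurable ([set` `[0, T]] : set (measurableTypeR R)) by exact: measurable_itv.
have mb0 : measurable_fun [set: S] (fun z : S => b0 z.1 z.2).
  exact: measurable_restrict_time.
pose g z := transport_derivative phi b0 z * restrict_time 0 [set` `]0, T[] rho z.1 z.2.
have mr : measurable_fun [set: S] (fun z : S => restrict_time 0 [set` `]0, T[] rho z.1 z.2).
  by have /integrableP[/measurable_EFinP] := ir.
have mg : measurable_fun [set: S] g.
  by apply: measurable_funM => //; exact: (measurable_transport_derivative tf mb0).
have b0E t x : t \in `]0, T[ -> b0 t x = b t x.
  rewrite in_itv /= => /andP[t0 tT].
  by rewrite /b0 /restrict_time mem_setE in_itv /= (ltW t0) (ltW tT).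
have gf : {ae P, forall z, g z = f z}.
  apply: (@filterS _ _ (ae_filter_ringOfSetsType P)) (ae_fst (n := n) b'E) => z h.
  rewrite /g /f /restrict_time mem_setE; case: ifPn => [zJ|_]; last by rewrite !mulr0.
  by rewrite /transport_derivative h// b0E.
have [ig <-] := integrable_ae_eq if_ mg gf.
rewrite -(iterated_Rintegral ig) Rintegral_mkcond.
apply: eq_Rintegral => t _; rewrite patchE mem_setE /g /restrict_time.
case: ifPn => tJ.
  apply: eq_Rintegral => x _ /=; rewrite mem_setE tJ /transport_derivative /=.
  by rewrite b0E.
by rewrite /Rintegral integral0_eq// => x _; rewrite /= mem_setE (negPf tJ) mulr0.
Qed.

End reduction.

(** The field is replaced by zero at the exceptional times, so that it can be sampled at nodes and
    integrated in time with bounds valid at every time. The weak formulations do not see the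
    change. *)
Lemma everywhere_loglip_representative {R : realType} {n : nat} (T C : R)
    (b : R -> 'rV[R]_n -> 'rV[R]_n) :
  measurable_fun ([set` `[0, T]] `*` [set: 'rV[R]_n] : set (measurableTypeR R * 'rV[R]_n))
    (fun z : measurableTypeR R * 'rV[R]_n => b z.1 z.2) ->
  {ae lebesgue_measure, forall t, t \in `[0, T] ->
      forall x, enorm (b t x) <= C * (1 + enorm x)} ->
  {ae lebesgue_measure, forall t, t \in `[0, T] ->
      forall x y, x != y ->
        enorm (b t x - b t y) <=
          C * enorm (x - y) * ln (expR 1 + 1 / enorm (x - y))} ->
  exists (b' : R -> 'rV[R]_n -> 'rV[R]_n) (C1 C2 : R),
    measurable_fun [set: measurableTypeR R * 'rV[R]_n]
      (fun z : measurableTypeR R * 'rV[R]_n => b' z.1 z.2) /\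
    (forall t x, t \notin `[0, T] -> b' t x = 0) /\
    0 <= C1 /\ 0 <= C2 /\
    (forall t x, `|b' t x| <= C1 * (1 + `|x|)) /\
    (forall e t x y, 0 < e -> `|x - y| <= 2 * e ->
      `|b' t x - b' t y| <= C2 * (e * ln (expR 1 + 1 / e))) /\
    {ae lebesgue_measure, forall t, t \in `]0, T[ -> forall x, b' t x = b t x}.
Proof.
move=> mb growth loglip.
(* [N] is a measurable null set containing the exceptional times, so that the set [J] of times kept
   is measurable. *)
have [N [mN N0 good]] :=
  @filterI _ _ (ae_filter_ringOfSetsType (@lebesgue_measure R)) _ _ growth loglip.
pose J : set (measurableTypeR R) := [set` `[0, T]] `\` N.
have mJ : measurable J by apply: measurableD => //; exact: measurable_itv.
have JT t : t \in J -> t \in `[0, T] by rewrite inE => -[].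
have goodJ t : t \in J ->
    (forall x, enorm (b t x) <= C * (1 + enorm x)) /\
    (forall x y, x != y -> enorm (b t x - b t y) <=
          C * enorm (x - y) * ln (expR 1 + 1 / enorm (x - y))).
  rewrite inE => -[tT tN].
  have [h1 h2] : (t \in `[0, T] -> forall x, enorm (b t x) <= C * (1 + enorm x)) /\
     (t \in `[0, T] -> forall x y, x != y -> enorm (b t x - b t y) <=
          C * enorm (x - y) * ln (expR 1 + 1 / enorm (x - y))).
    by apply: contrapT => h; apply: tN; exact: good.
  by split; [exact: h1|exact: h2].
pose D : R := n.+1%:R; have D1 : 1 <= D by rewrite ler1n.
have D0 : 0 <= D := le_trans ler01 D1.
have CD : 0 <= `|C| * (2 * D) by rewrite mulr_ge0// mulr_ge0.
(* The sign of [C] is unknown, hence the absolute value; [D] compares the two norms, and a sup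
   distance of at most [2 * e] is a Euclidean one of at most [2 * D * e]. *)
exists (restrict_time 0 J b), (`|C| * D), (`|C| * (2 * D)); split; [|split; [|split; [|split; [|split; [|split]]]]].
- apply: measurable_restrict_time => //; apply: measurable_funS mb.
    by apply: measurableX => //; exact: measurable_itv.
  by move=> [t x] [[]].
- by move=> t x; rewrite /restrict_time; case: ifPn => // /JT ->.
- exact: mulr_ge0.
- by [].
- move=> t x; rewrite /restrict_time; case: ifPn => [tJ|_]; last first.
    by rewrite normr0 mulr_ge0 ?mulr_ge0// addr_ge0.
  apply: le_trans (norm_le_enorm _) _; apply: le_trans ((goodJ t tJ).1 x) _.
  have e0 : 0 <= 1 + enorm x by rewrite addr_ge0// sqrtr_ge0.
  apply: (@le_trans _ _ (`|C| * (1 + enorm x))); first by rewrite ler_wpM2r// ler_norm.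
  rewrite -mulrA ler_wpM2l// mulrDr mulr1 lerD// (le_trans (enorm_le_norm x))//.
- move=> e t x y e0 xy; have lg0 : 0 <= ln (expR 1 + 1 / e).
    rewrite ln_ge0// (le_trans (_ : 1 <= expR 1))//.
      by have := expR_ge1Dx (1 : R); lra.
    by rewrite lerDl divr_ge0// ltW.
  have rhs0 : 0 <= `|C| * (2 * D) * (e * ln (expR 1 + 1 / e)).
    by rewrite mulr_ge0// mulr_ge0// ltW.
  rewrite /restrict_time; case: ifPn => [tJ|_]; last by rewrite subrr normr0.
  have [<-|xNy] := eqVneq x y; first by rewrite subrr normr0.
  apply: le_trans (norm_le_enorm _) _; apply: le_trans ((goodJ t tJ).2 x y xNy) _.
  set r := enorm (x - y).
  have r0 : 0 < r.
    by apply: lt_le_trans (norm_le_enorm _); rewrite normr_gt0 subr_eq0.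
  have re : r <= 2 * D * e.
    apply: le_trans (enorm_le_norm _) _.
    by rewrite -/D (mulrC 2) -mulrA ler_wpM2l.
  have D2 : 2 <= 2 * D by rewrite ler_peMr.
  have := loglip_modulus D2 e0 r0 re; set l := r * _ => lr.
  have l0 : 0 <= l.
    rewrite mulr_ge0 ?(ltW r0)// ln_ge0// (le_trans (_ : 1 <= expR 1))//.
      by have := expR_ge1Dx (1 : R); lra.
    by rewrite lerDl divr_ge0// ltW.
  rewrite -mulrA -/l -mulrA; apply: (@le_trans _ _ (`|C| * l)).
    by rewrite ler_wpM2r// ler_norm.
  by rewrite ler_wpM2l.
- exists N; split => // t /= h; apply: contrapT => tN; apply: h.
  rewrite in_itv /= => /andP[t0 tT] x; rewrite /restrict_time mem_set//.
  by split => //=; rewrite in_itv /= (ltW t0) (ltW tT).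
Qed.

Theorem proposition2 (R : realType) (n : nat) (T C : R)
    (b : R -> 'rV[R]_n -> 'rV[R]_n) (rho0 : 'rV[R]_n -> R)
    (T_gt0 : 0 < T)
    (b_borel : measurable_fun ([set` `[0, T]] `*` [set: 'rV[R]_n])
      (fun z : R * 'rV[R]_n => b z.1 z.2))
    (b_growth : {ae lebesgue_measure, forall t, t \in `[0, T] ->
      forall x, enorm (b t x) <= C * (1 + enorm x)})
    (b_loglip : {ae lebesgue_measure, forall t, t \in `[0, T] ->
      forall x y, x != y ->
        enorm (b t x - b t y) <=
          C * enorm (x - y) * ln (expR 1 + 1 / enorm (x - y))})
    (rho0_L1 : (lebesgue_measure_rV n).-integrable [set: 'rV[R]_n]
      (EFin \o rho0))
    (rho1 rho2 : R -> 'rV[R]_n -> R) :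
  weak_solution T b rho0 rho1 -> weak_solution T b rho0 rho2 ->
  L1L1_eq T rho1 rho2.
Proof.
move=> [L1 w1] [L2 w2].
have [chi [chi' [c hk]]] := reproducing_kernel_exists R.
have [b' [C1 [C2 [mb' [b'_out [C10 [C20 [b'_growth [b'_mod b'E]]]]]]]]] :=
  everywhere_loglip_representative b_borel b_growth b_loglip.
pose S := (measurableTypeR R * 'rV[R]_n)%type.
pose P : {measure set S -> \bar R} := (@lebesgue_measure R \x lebesgue_measure_rV n)%E.
pose J : set R := [set` `]0, T[].
pose cut (r : R -> 'rV[R]_n -> R) (z : S) := restrict_time 0 J r z.1 z.2.
pose rho (z : S) := cut rho1 z - cut rho2 z.
have i1 : P.-integrable [set: S] (EFin \o cut rho1) := integrable_restrict_time L1.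
have i2 : P.-integrable [set: S] (EFin \o cut rho2) := integrable_restrict_time L2.
have irho : P.-integrable [set: S] (EFin \o rho) by exact: integrable_sub.
have rho_out z : z.1 \notin `]0, T[ -> rho z = 0.
  by move=> zJ; rewrite /rho /cut /restrict_time /J mem_setE (negPf zJ) subrr.
have rho_T z : rho z != 0 -> 0 <= z.1 <= T.
  move=> rz; have : z.1 \in `]0, T[ by apply/negPn/negP => /rho_out/eqP; rewrite (negPf rz).
  by rewrite in_itv /= => /andP[z0 zT]; rewrite (ltW z0) (ltW zT).
have weak u : test_function T u -> \int[P]_z (transport_derivative u b' z * rho z) = 0.
  move=> tu.
  have [f1 e1] := transport_restrict_time tu b_borel mb' C10 b'_growth b'E L1.
  have [f2 e2] := transport_restrict_time tu b_borel mb' C10 b'_growth b'E L2.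
  (* The initial terms of the two weak formulations are equal and cancel in the difference. *)
  have := w1 u tu; rewrite e1 => /eqP; rewrite addr_eq0 => /eqP E1.
  have := w2 u tu; rewrite e2 => /eqP; rewrite addr_eq0 => /eqP E2.
  transitivity (\int[P]_z (transport_derivative u b' z * cut rho1 z -
      transport_derivative u b' z * cut rho2 z)).
    by apply: eq_Rintegral => z _; rewrite /rho mulrBr.
  by rewrite RintegralB// [X in X - _]E1 [X in _ - X]E2 subrr.
have rho_T0 := vanishing hk mb' b'_out C10 C20 b'_growth b'_mod rho_T irho weak.
have rho_0 : {ae P, forall z, rho z = 0}.
  apply: (@filterS _ _ (ae_filter_ringOfSetsType P)) rho_T0 => z h.
  have [/h//|Tz] := ltP z.1 T.
  by apply: rho_out; rewrite in_itv /= [z.1 < T]ltNge Tz andbF.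
have mrho : measurable_fun [set: S] rho by have /integrableP[/measurable_EFinP] := irho.
apply: (@filterS _ _ (ae_filter_ringOfSetsType _)) (ae_sections mrho rho_0) => t h tT.
apply: (@filterS _ _ (ae_filter_ringOfSetsType _)) h => x /eqP.
by rewrite /rho /cut /restrict_time /= /J mem_setE tT subr_eq0 => /eqP.
Qed.
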